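(* Let $H$ and $K$ be separable Hilbert spaces, let $c\geq0$, and let the prediction set be $\Xi=\Xi_c$ with associated outer measure $\mathcal{E}$. Let $A\colon[0,T]\times\Omega\to\mathbb{R}$ be a process such that $\omega\mapsto A_t(\omega)$ is continuous for all $t$ and, for all $\omega\in\Omega$, the total variation process $t\mapsto|A|_t(\omega)$ of $t\mapsto A_t(\omega)$ is absolutely continuous with $d|A|(\omega)/dt\leq c$. Let $\mu\colon[0,T]\times K\to L(\mathbb{R},K)$ and $\sigma\colon[0,T]\times K\to L(H,K)$ be functions for which there is a constant $L>0$ such that for all $k,k'\in K$ and $t,t'\in[0,T]$ \[\|\sigma(t,k)-\sigma(t',k')\|_{L(H,K)}\leq L(|t-t'|+\|k-k'\|_K),\qquad\|\mu(t,k)-\mu(t',k')\|_{L(\mathbb{R},K)}\leq L(|t-t'|+\|k-k'\|_K).\] Let $x_0\in K$. Then there exists a unique (up to equality for typical paths) $X\colon\Omega\to C([0,T],K)$ such that $X\in\mathcal{H}^2(K,\mathbb{R})$ and $X$ solves the SDE $dX_t=\mu(t,X_t)\,dA_t+\sigma(t,X_t)\,dS_t$, $X_0=x_0$, i.e. \[X_t=x_0+(\mu(\cdot,X)\cdot A)_t+(\sigma(\cdot,X)\cdot S)_t,\qquad t\in[0,T],\] for typical paths.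
   Context: **Path space.** $T>0$ is a finite horizon, $H$ a separable Hilbert space, and $C([0,T],H)$ is endowed with the supremum norm. For $\omega\in C([0,T],H)$ and $m\in\mathbb{N}$ put $\sigma^m_0(\omega)=0$ and $\sigma^m_k(\omega):=\inf\{t\in[\sigma^m_{k-1}(\omega),T]:\|\omega(t)-\omega(\sigma^m_{k-1}(\omega))\|_H\geq2^{-m}\}$ (with $\inf\emptyset:=T$). $\Omega$ is the Borel set of all $\omega\in C([0,T],H)$ for which the pathwise quadratic variation $\langle\omega\rangle_t:=\lim_{m\to\infty}\sum_{k=1}^\infty\|\omega(\sigma^m_k(\omega)\wedge t)-\omega(\sigma^m_{k-1}(\omega)\wedge t)\|_H^2$ exists as a limit in the supremum norm in $C([0,T],\mathbb{R})$. Set $S_t(\omega):=\omega(t)$ and $\mathbb{S}_t(\omega):=\|S_t(\omega)\|_H^2-\langle\omega\rangle_t$. $\mathbb{F}$ is the raw filtration $\mathcal{F}_t:=\sigma(S_s:s\leq t)$ on $\Omega$, and $\mathbb{F}_+$ is its right-continuous version. **Simple integrands.** For separable Hilbert spaces $H',K'$, $L(H',K')$ is the Banach space of bounded linear operators with the operator norm. $\mathcal{H}_s(H',K')$ is the set of processes $F\colon[0,T]\times\Omega\to L(H',K')$ of the form $F_t(\omega)=\sum_{n=0}^\infty f_n(\omega)1_{(\tau_n(\omega),\tau_{n+1}(\omega)]}(t)$, where $0=\tau_0\leq\tau_1\leq\dots\leq T$ are $\mathbb{F}_+$-stopping times such that for each $\omega$ there is $n(\omega)$ with $\tau_{n(\omega)}(\omega)=T$,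 and $f_n\colon\Omega\to L(H',K')$ is $\mathcal{F}_{\tau_n+}$-measurable. For any $N\colon[0,T]\times\Omega\to H'$ set $(F\cdot N)_t(\omega):=\sum_{n=0}^\infty f_n(\omega)\big(N_{\tau_{n+1}(\omega)\wedge t}(\omega)-N_{\tau_n(\omega)\wedge t}(\omega)\big)$. $\mathcal{H}_{s,c}(H',K')$ is the set of those $\sum_nf_n1_{(\tau_n,\tau_{n+1}]}\in\mathcal{H}_s(H',K')$ for which all $\tau_n$ are deterministic and each $f_n\colon\Omega\to L(H',K')$ is continuous. **Prediction set.** $\Xi_c$ is the set of all $\omega\in\Omega$ such that $\omega$ is H\''older continuous and $\langle\omega\rangle$ is absolutely continuous with $d\langle\omega\rangle/dt\leq c$. **Outer measure.** For a prediction set $\Xi\subseteq\Omega$ and $X\colon\Omega\to[0,+\infty]$, $\mathcal{E}(X)$ is the infimum of all $\lambda\geq0$ for which there are sequences $(F^n)$ in $\mathcal{H}_s(H,\mathbb{R})$ and $(G^n)$ in $\mathcal{H}_s(\mathbb{R},\mathbb{R})$ such that $\lambda+(F^n\cdot S)_t+(G^n\cdot\mathbb{S})_t\geq0$ on $\Xi$ for all $n$ and all $t\in[0,T]$, and $\lambda+\liminf_n\big((F^n\cdot S)_T+(G^n\cdot\mathbb{S})_T\big)\geq X$ on $\Xi$. Here $\Xi=\Xi_c$. A property holds for *typical paths* if $\mathcal{E}(1_N)=0$ for the set $N$ of paths where it fails. **The spaces $\mathcal{H}^2$.** For separable Hilbert spaces $H',K'$ and $F\colon[0,T]\times\Omega\to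 L(H',K')$, $\|F\|_{\mathcal{H}^2(H',K')}:=\big(\int_0^T\mathcal{E}(\|F_t\|_{L(H',K')}^2)\,dt\big)^{1/2}$. $\mathcal{H}^2(H',K')$ is the set of all such $F$ with $\|F\|_{\mathcal{H}^2(H',K')}<+\infty$ for which there is a sequence $(F^n)$ in $\mathcal{H}_{s,c}(H',K')$ with $\|F-F^n\|_{\mathcal{H}^2(H',K')}\to0$. A $K$-valued process is regarded as an $L(K,\mathbb{R})$-valued one through the Riesz isometry $K\cong L(K,\mathbb{R})$; this is the meaning of $X\in\mathcal{H}^2(K,\mathbb{R})$. **Integrals.** For $F\in\mathcal{H}^2(H,K)$, $(F\cdot S)\colon\Omega\to C([0,T],K)$ is the map, unique up to equality for typical paths, with $\mathcal{E}(\sup_{t\in[0,T]}\|(F\cdot S)_t-(F^n\cdot S)_t\|_K^2)\to0$ for every sequence $(F^n)$ in $\mathcal{H}_{s,c}(H,K)$ with $\|F-F^n\|_{\mathcal{H}^2(H,K)}\to0$. For $F\in\mathcal{H}^2(\mathbb{R},K)$, $(F\cdot A)\colon\Omega\to C([0,T],K)$ is defined in the same way, with $S$ replaced by $A$ and $H$ by $\mathbb{R}$. For $X\in\mathcal{H}^2(K,\mathbb{R})$, the process $\mu(\cdot,X)$, $(t,\omega)\mapsto\mu(t,X_t(\omega))$, belongs to $\mathcal{H}^2(\mathbb{R},K)$ and $\sigma(\cdot,X)$, $(t,\omega)\mapsto\sigma(t,X_t(\omega))$, belongs to $\mathcal{H}^2(H,K)$, so that $(\mu(\cdot,X)\cdot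 A)$ and $(\sigma(\cdot,X)\cdot S)$ are defined.
   Formalization: The process A is additionally assumed adapted to the right-continuous filtration F_+; without this the claim fails, e.g. for A_t(ω)=t·c·sin(ω(T)), μ≡1, σ=0, H=K=ℝ, c>0, where the forced solution is not in H². *)

(* Defs.v *)
From HB Require Import structures.
From mathcomp Require Import all_boot all_order all_algebra.
From mathcomp Require Import all_classical all_reals all_analysis.
From mathcomp Require Import measurable_realfun ring.
Set Implicit Arguments.
Unset Strict Implicit.
Unset Printing Implicit Defensive.
Import Order.TTheory GRing.Theory Num.Theory numFieldNormedType.Exports.
Local Open Scope classical_set_scope.
Local Open Scope ring_scope.

HB.mixin Record CompleteNormedModule_isHilbert (R : realType) V
    & CompleteNormedModule R V := {
  dot : V -> V -> R ;
  dotC : forall x y, dot x y = dot y x ;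
  dotPl : forall (a : R) x y z, dot (a *: x + y) z = a * dot x z + dot y z ;
  dotE : forall x : V, dot x x = `|x| ^+ 2
}.

#[short(type="hilbertType")]
HB.structure Definition Hilbert (R : realType) :=
  {V of CompleteNormedModule R V & CompleteNormedModule_isHilbert R V}.

Definition separable (X : topologicalType) : Prop :=
  exists2 D : set X, countable D & dense D.

Section BoundedOperators.
Context {R : realType} (V W : normedModType R).

Definition blinear_pred : {pred V -> W} :=
  [pred f | `[< linear f /\ continuous f >]].

Record blin := Blin { blin_val :> V -> W ; blin_valP : blin_val \in blinear_pred }.

HB.instance Definition _ := [isSub for blin_val].
HB.instance Definition _ := [Choice of blin by <:].

Lemma blinear_pred_closed : submod_closed blinear_pred.
Proof.
split.
- apply/asboolP; split => [a x y|]; last exact: cst_continuous.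
  by rewrite scaler0 addr0.
- move=> a f g /asboolP[lf cf] /asboolP[lg cg]; apply/asboolP; split.
  + move=> b x y; rewrite !fctE lf lg !scalerDr !scalerA -!addrA; congr (_ + _).
      by rewrite mulrC.
    by rewrite addrCA.
  + move=> x; rewrite /continuous_at.
    apply: (@cvgD _ _ _ _ _ (a *: f) g); last exact: cg.
    by apply: cvgZl_tmp; exact: cf.
Qed.

HB.instance Definition _ :=
  GRing.isSubmodClosed.Build R (V -> W) blinear_pred blinear_pred_closed.
HB.instance Definition _ := [SubChoice_isSubLmodule of blin by <:].


Lemma blin_linear (f : blin) : linear f.
Proof. by case: f => f /= /asboolP[]. Qed.

Lemma blin_continuous (f : blin) : continuous f.
Proof. by case: f => f /= /asboolP[]. Qed.

Definition opnorm (f : blin) : R := sup [set `|f x| | x in [set x | `|x| <= 1]].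

Lemma blin_linfun (f : blin) : exists g : {linear V -> W}, g = f :> (V -> W).
Proof.
pose m := GRing.isLinear.Build R V W *:%R f (@blin_linear f).
by exists (HB.pack_for {linear V -> W} (f : V -> W) m).
Qed.

Lemma opnorm_has_sup (f : blin) :
  has_sup [set `|f x| | x in [set x | `|x| <= 1]].
Proof.
split; first by exists `|f 0|, 0 => //=; rewrite normr0.
have [g gf] := blin_linfun f.
have cg : continuous g by rewrite gf; exact: blin_continuous.
have /bounded_funP/(_ 1)[M hM] : bounded_near g (nbhs (0 : V)).
  by apply: continuous_linear_bounded; exact: cg.
by exists M => _ [x /= x1 <-]; rewrite -gf; exact: hM.
Qed.

Lemma opnorm_ub (f : blin) x : `|x| <= 1 -> `|f x| <= opnorm f.
Proof. by move=> x1; apply: ub_le_sup; [case: (opnorm_has_sup f)|exists x]. Qed.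

Lemma opnorm_le (f : blin) (M : R) :
  (forall x, `|x| <= 1 -> `|f x| <= M) -> opnorm f <= M.
Proof.
move=> h; apply: ge_sup; first by case: (opnorm_has_sup f).
by move=> _ [x /= x1 <-]; exact: h.
Qed.

Lemma opnorm_leP (f : blin) x : `|f x| <= opnorm f * `|x|.
Proof.
have [g gf] := blin_linfun f.
have [->|x0] := eqVneq x 0; first by rewrite -gf linear0 !normr0 mulr0.
have nx0 : 0 < `|x| by rewrite normr_gt0.
rewrite -ler_pdivrMr// mulrC.
have -> : `|x|^-1 * `|f x| = `|f (`|x|^-1 *: x)|.
  by rewrite -gf linearZ/= normrZ gtr0_norm ?invr_gt0.
by apply: opnorm_ub; rewrite normrZ gtr0_norm ?invr_gt0// mulVf// gt_eqF.
Qed.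

Lemma opnormD (f g : blin) : opnorm (f + g) <= opnorm f + opnorm g.
Proof.
apply: opnorm_le => x x1; rewrite (le_trans (ler_normD _ _))//.
by rewrite lerD// opnorm_ub.
Qed.

Lemma opnormZ (a : R) (f : blin) : opnorm (a *: f) = `|a| * opnorm f.
Proof.
have le b h : opnorm (b *: h) <= `|b| * opnorm h.
  apply: opnorm_le => x x1.
  have -> : (b *: h) x = b *: h x by [].
  by rewrite normrZ ler_wpM2l// opnorm_ub.
apply/eqP; rewrite eq_le le/=.
have [->|a0] := eqVneq a 0.
  rewrite normr0 mul0r (le_trans _ (opnorm_ub _ (x := 0) _)) ?normr_ge0//.
  by rewrite normr0.
rewrite -ler_pdivlMl ?normr_gt0// -normfV.
by rewrite -[f in opnorm f <= _](scalerK a0) le.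
Qed.

Lemma opnorm_eq0 (f : blin) : opnorm f = 0 -> f = 0.
Proof.
move=> f0; apply: val_inj; apply/funext => x /=.
by apply/eqP; rewrite -normr_le0 (le_trans (opnorm_leP f x))// f0 mul0r.
Qed.

HB.instance Definition _ :=
  Lmodule_isNormed.Build R blin opnormD opnormZ opnorm_eq0.

End BoundedOperators.

Notation "''L' ( V , W )" := (blin V W) (at level 8, format "''L' ( V ,  W )").

Section Riesz.
Context {R : realType} {K : hilbertType R}.

Lemma dot_linear (k : K) : linear (dot k : K -> R^o).
Proof. by move=> a x y; rewrite dotC dotPl (dotC x) (dotC y). Qed.

Lemma dot_CauchySchwarz (x y : K) : `|dot x y| <= `|x| * `|y|.
Proof.
have dot0 z : dot z (0 : K) = 0.
  have /eqP := @dotPl R K 1 0 0 z.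
  by rewrite scaler0 addr0 mul1r addrC -subr_eq subrr dotC => /eqP.
have [->|y0] := eqVneq y 0; first by rewrite dot0 !normr0 mulr0.
have dl a u v w : dot (a *: u + v) w = a * dot u w + dot v w :> R.
  exact: dotPl.
have dr a u v w : dot w (a *: u + v) = a * dot w u + dot w v :> R.
  by rewrite dotC dl (dotC u) (dotC v).
have n2 : 0 < `|y| ^+ 2 by rewrite exprn_gt0// normr_gt0.
pose v := `|y| ^+ 2 *: x + (- dot x y *: y + 0).
have : 0 <= dot v v by rewrite dotE sqr_ge0.
have -> : dot v v = `|y| ^+ 2 * (`|x| ^+ 2 * `|y| ^+ 2 - dot x y ^+ 2).
  have d0 z : dot (0 : K) z = 0 :> R by rewrite dotC dot0.
  rewrite /v !(dl, dr) !(dot0, d0) (dotC y x) !dotE.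
  by move: (dot x y) (`|x|) (`|y|) => /= a b e; ring.
rewrite pmulr_rge0// subr_ge0 -exprMn => h.
by rewrite -ler_sqr ?nnegrE ?mulr_ge0// real_normK ?num_real.
Qed.

Lemma dot_continuous (k : K) : continuous (dot k : K -> R^o).
Proof.
pose m := GRing.isLinear.Build R K R^o *:%R (dot k) (@dot_linear k).
pose g := HB.pack_for {linear K -> R^o} (dot k : K -> R^o) m.
rewrite -[dot k]/(g : K -> R^o); apply: bounded_linear_continuous.
apply/bounded_funP => r; exists (`|k| * r) => x xr /=.
by rewrite (le_trans (dot_CauchySchwarz k x))// ler_wpM2l.
Qed.

Fact riesz_subproof (k : K) : (dot k : K -> R^o) \in @blinear_pred R K R^o.
Proof. by apply/asboolP; split; [exact: dot_linear|exact: dot_continuous]. Qed.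

Definition riesz (k : K) : 'L(K, R^o) := Blin (riesz_subproof k).

End Riesz.

Section UpperIntegral.
Context {R : realType}.
Local Open Scope ereal_scope.
Local Notation mu := (@lebesgue_measure R).

Definition upper_integral (D : set R) (f : R -> \bar R) : \bar R :=
  ereal_inf [set \int[mu]_(x in D) g x |
    g in [set g : R -> \bar R | measurable_fun D g /\ forall x, D x -> f x <= g x]].

Lemma upper_integralE (D : set R) (f : R -> \bar R) :
  measurable D -> measurable_fun D f -> (forall x, D x -> 0 <= f x) ->
  upper_integral D f = \int[mu]_(x in D) f x.
Proof.
move=> mD mf f0; apply/eqP; rewrite eq_le; apply/andP; split.
  by apply: ereal_inf_lbound; exists f.
apply: le_ereal_inf_tmp => _ [g [mg fg] <-].
by apply: ge0_le_integral => // x Dx; rewrite (le_trans (f0 _ Dx)) ?fg.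
Qed.

End UpperIntegral.

Section PathSpace.
Context {R : realType} (T : R).

Section ContinuousPaths.
Context (V : normedModType R).

(* A function on [0, T] is encoded by its extension by 0 to the real line, so
   that two paths are equal as soon as they agree on [0, T]. *)
Definition cpath_set : set {uniform` `[0, T] -> V} :=
  [set f : R -> V | {within `[0, T], continuous f} /\
                    forall t, ~ `[0, T]%classic t -> f t = 0].

Definition cpath : Type := set_type cpath_set.

(* Topology of uniform convergence on [0, T]. *)
HB.instance Definition _ := Uniform.copy cpath (set_type cpath_set).

Definition cpath_fun (f : cpath) : R -> V := set_val f.

End ContinuousPaths.

Coercion cpath_fun : cpath >-> Funclass.

Context (H : normedModType R).

(* The point T is added so that the infimum over the empty set is T. *)
Fixpoint qv_time (m : nat) (w : R -> H) (k : nat) : R :=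
  if k is k'.+1 then
    let s := qv_time m w k' in
    inf ([set t | s <= t <= T /\ 2 ^- m <= `|w t - w s|] `|` [set T])
  else 0.

Definition qv_sum (w : R -> H) (m : nat) (t : R) : R :=
  limn (series (fun k =>
    `|w (Num.min (qv_time m w k.+1) t) - w (Num.min (qv_time m w k) t)| ^+ 2)).

Definition Omega_set : set (cpath H) :=
  [set w | exists q : cpath R^o,
    {uniform `[0, T], qv_sum w @ \oo --> (q : R -> R)}].

Definition Omega : Type := set_type Omega_set.

HB.instance Definition _ := Uniform.copy Omega (set_type Omega_set).

Definition Omega_path (w : Omega) : cpath H := set_val w.

Coercion Omega_path : Omega >-> cpath.

Definition qv (w : Omega) (t : R) : R := limn (fun m => qv_sum w m t).

Definition procS (t : R) (w : Omega) : H := w t.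

Definition procSS (t : R) (w : Omega) : R^o := `|w t| ^+ 2 - qv w t.

Definition filt (t : R) : set (set Omega) :=
  <<s [set procS s @^-1` U | s in `[0, Num.min t T] & U in open] >>.

(* As filt s = filt T for s >= T, this gives filt_plus T = filt T. *)
Definition filt_plus (t : R) : set (set Omega) :=
  \bigcap_(s in `]t, +oo[) filt s.

Definition stopping_time (tau : Omega -> R) : Prop :=
  forall t, 0 <= t <= T -> filt_plus t [set w | tau w <= t].

Definition filt_stopped (tau : Omega -> R) : set (set Omega) :=
  [set B | filt T B /\
    forall t, 0 <= t <= T -> filt_plus t (B `&` [set w | tau w <= t])].

Definition borel_measurable_for {Y : topologicalType} (G : set (set Omega))
    (f : Omega -> Y) : Prop :=
  forall B : set Y, <<s open>> B -> G (f @^-1` B).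

Definition adapted {Y : topologicalType} (N : R -> Omega -> Y) : Prop :=
  forall t, 0 <= t <= T -> borel_measurable_for (filt_plus t) (N t).

Section SimpleIntegrands.
Context {V W : normedModType R}.

(* The representation of a simple integrand; simple_proc is the process. *)
Record simple := Simple {
  stime : nat -> Omega -> R ;
  scoef : nat -> Omega -> 'L(V, W)
}.

Definition in_Hs (F : simple) : Prop :=
  [/\ forall w, stime F 0 w = 0,
      forall n w, stime F n w <= stime F n.+1 w <= T,
      forall n, stopping_time (stime F n),
      forall w, exists n, stime F n w = T &
      forall n, borel_measurable_for (filt_stopped (stime F n)) (scoef F n)].

Definition in_Hsc (F : simple) : Prop :=
  [/\ in_Hs F,
      forall n, exists t, forall w, stime F n w = t &
      forall n, continuous (scoef F n)].

Definition simple_proc (F : simple) (t : R) (w : Omega) : 'L(V, W) :=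
  limn (series (fun n =>
    \1_`]stime F n w, stime F n.+1 w] t *: scoef F n w)).

Definition simple_int (F : simple) (N : R -> Omega -> V) (t : R) (w : Omega)
    : W :=
  limn (series (fun n => scoef F n w
    (N (Num.min (stime F n.+1 w) t) w - N (Num.min (stime F n w) t) w))).

End SimpleIntegrands.

Definition holder (f : R -> H) : Prop :=
  exists alpha C : R, 0 < alpha <= 1 /\
    forall s t, 0 <= s <= T -> 0 <= t <= T ->
      `|f t - f s| <= C * `|t - s| `^ alpha.

(* f is absolutely continuous on [0, T], i.e. it has an integrable Lebesgue density
   g = df/dt there, and g <= c almost everywhere. *)
Definition abs_cont_rate_le (c : R) (f : R -> R) : Prop :=
  exists g : R -> R,
    [/\ (@lebesgue_measure R).-integrable `[0, T] (EFin \o g),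
        forall t, 0 <= t <= T ->
          (\int[@lebesgue_measure R]_(s in `[0%R, t]) (g s)%:E =
           (f t - f 0)%:E)%E &
        {ae @lebesgue_measure R, forall s, 0 <= s <= T -> g s <= c}].

Definition Xi (c : R) : set Omega :=
  [set w : Omega | holder w /\ abs_cont_rate_le c (qv w)].

Section OuterMeasure.
Context (P : set Omega).

Definition outer_E (X : Omega -> \bar R) : \bar R :=
  ereal_inf [set l%:E | l in [set l : R | 0 <= l /\
    exists (F : nat -> @simple H R^o) (G : nat -> @simple R^o R^o),
      [/\ forall n, in_Hs (F n),
          forall n, in_Hs (G n),
          forall w n t, P w -> 0 <= t <= T ->
            0 <= l + simple_int (F n) procS t w + simple_int (G n) procSS t w &
          forall w, P w ->
            (X w <= l%:E + limn_einf (fun n =>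
              (simple_int (F n) procS T w + simple_int (G n) procSS T w)%:E))%E]]].

Definition typical (Q : Omega -> Prop) : Prop :=
  outer_E (fun w => (\1_[set w' | ~ Q w'] w)%:E) = 0%E.

Section H2.
Context {V W : normedModType R}.

(* t |-> outer_E (|F_t|^2) need not be measurable for an arbitrary F, and the
   Lebesgue integral of the library is a lower integral (not subadditive) on
   nonmeasurable functions; upper_integral is subadditive, and it is the Lebesgue
   integral in the measurable case (upper_integralE). *)
Definition H2_norm (F : R -> Omega -> 'L(V, W)) : \bar R :=
  (upper_integral `[0%R, T]
     (fun t => outer_E (fun w => (`|F t w| ^+ 2)%:E)) `^ 2^-1)%E.

Definition H2_approx (F : R -> Omega -> 'L(V, W)) (Fn : nat -> @simple V W)
    : Prop :=
  (forall n, in_Hsc (Fn n)) /\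
  H2_norm (fun t w => F t w - simple_proc (Fn n) t w) @[n --> \oo] --> 0%E.

Definition in_H2 (F : R -> Omega -> 'L(V, W)) : Prop :=
  (H2_norm F < +oo)%E /\ exists Fn, H2_approx F Fn.

(* Y is a version of the integral (F . N), which is only determined up to equality
   for typical paths. *)
Definition is_integral (F : R -> Omega -> 'L(V, W)) (N : R -> Omega -> V)
    (Y : Omega -> cpath W) : Prop :=
  in_H2 F /\ forall Fn, H2_approx F Fn ->
    outer_E (fun w => ereal_sup
      [set (`|Y w t - simple_int (Fn n) N t w| ^+ 2)%:E | t in `[0, T]])
      @[n --> \oo] --> 0%E.

End H2.
End OuterMeasure.
End PathSpace.

Section SDE.
Context {R : realType} (T : R) {H K : hilbertType R} (P : set (Omega T H)).

(* K-valued processes are seen as L(K, R)-valued through the Riesz isometry. *)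
Definition in_H2_vector (X : Omega T H -> cpath T K) : Prop :=
  in_H2 P (fun t w => riesz (X w t)).

Definition solves_SDE (mu : R -> K -> 'L(R^o, K)) (sigma : R -> K -> 'L(H, K))
    (A : R -> Omega T H -> R^o) (x0 : K) (X : Omega T H -> cpath T K) : Prop :=
  exists Y Z : Omega T H -> cpath T K,
    [/\ is_integral P (fun t w => mu t (X w t)) A Y,
        is_integral P (fun t w => sigma t (X w t)) (@procS R T H) Z &
        typical P (fun w => forall t, 0 <= t <= T -> X w t = x0 + Y w t + Z w t)].

End SDE.

(* Main.v *)
(* All moment estimates are superhedging arguments.  A discrete pathwise form of Doob's L^2 maximal
   inequality bounds sup |F . S|^2 along a grid by a gain plus the sum of 4 |f|^2 |dS|^2.  Writing
   |dS|^2 = d(|S|^2 - <S>) - 2 <S, dS> + d<S>, with d<S> <= c dt on Xi c, and letting the mesh of the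
   grid tend to 0, one superhedges sup |F . S|^2 at the cost of the integral of 4 c |F|^2.  The steps
   of F are paid for one after the other: a strategy is stopped when the capital set aside for the
   current step is exhausted, and since Xi c is stable under stopping this replaces |f_n|^2 by its
   outer expectation.  For continuous simple F this gives E(sup |F . S|^2) <= 4 c int E |F_t|^2 dt;
   for A the analogous bound is the Cauchy-Schwarz inequality.

   With these two bounds the Euler schemes along grids of mesh T / 8^m are Cauchy by Gronwall's
   inequality.  Their stochastic integrals converge uniformly, the limits are the integrals of the
   limit process, and the equation passes to the limit for every path.  Uniqueness is Gronwall's
   inequality once more. *)
Require Import Defs.
From HB Require Import structures.
From mathcomp Require Import all_boot all_order all_algebra.
From mathcomp Require Import all_classical all_reals all_analysis.
From mathcomp Require Import measurable_realfun ring lra.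
Set Implicit Arguments.
Unset Strict Implicit.
Unset Printing Implicit Defensive.
Import Order.TTheory GRing.Theory Num.Theory numFieldNormedType.Exports.
Local Open Scope classical_set_scope.
Local Open Scope ring_scope.

(** * Hilbert spaces, bounded operators and the pathwise maximal inequality *)

(** There is no reference measure, hence neither conditional expectation nor dominated convergence:
    [outer_E] is only monotone and countably subadditive. Conditioning at time u is replaced by the
    map [stop u]: a gain at time u is the terminal gain of the stopped path, so a hedge that works
    at T on all paths also works at u for a quantity that depends on the path up to u only.
    Coefficients are merely measurable for the right-continuous filtration and might look past u;
    continuity excludes this, which is why the estimates are made for [in_Hsc] integrands.
    Strategies are real-valued, so a K-valued integral M enters the hedge through functionals y |->
    <M, f y>, whose measurability rests on separability of H and Riesz representation. Euler schemes
    are preferred to Picard iteration because their coefficients already are simple, with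
    deterministic times and continuous in the path; membership of the limit coefficients in H^2 thus
    comes with explicit approximants. Constants are crude: each triangle inequality for squares
    costs a factor 2. *)

Lemma cauchy_cvgn {R : realType} {V : completeNormedModType R} (u : nat -> V) :
  (forall e : R, 0 < e -> exists N, forall m n, (N <= m)%N -> (N <= n)%N ->
    `|u m - u n| <= e) ->
  cvgn u.
Proof.
move=> h; apply: cauchy_cvg; apply/cauchy_ballP => e e0.
have [N hN] := h (e / 2) (divr_gt0 e0 (ltr0Sn _ 1)).
pose A := [set u n | n in [set n | (N <= n)%N]].
exists (A, A) => /=; first by split; exists N => // n /= Nn; exists n.
move=> [x y] /= [[n /= Nn <-] [k /= Nk <-]]; rewrite -ball_normE /=.
by apply: le_lt_trans (hN _ _ Nn Nk) _; rewrite ltr_pdivrMr// ltr_pMr// ltr1n.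
Qed.

Lemma regular_dotPl {R : realType} (a x y z : R^o) :
  (a *: x + y) * z = a * (x * z) + y * z.
Proof. by rewrite mulrDl -mulrA. Qed.

Lemma regular_dotE {R : realType} (x : R^o) : x * x = `|x| ^+ 2.
Proof. by rewrite real_normK ?num_real// expr2. Qed.

(** The real line is made a Hilbert space so that statements on Hilbert-valued processes also cover
    [procSS] and its scalar integrands. *)
HB.instance Definition _ (R : realType) :=
  @CompleteNormedModule_isHilbert.Build R R^o *%R (@mulrC R)
    regular_dotPl regular_dotE.

Section HilbertTheory.
Context {R : realType} {V : hilbertType R}.
Implicit Types (x y z : V) (a : R).

Lemma dotDl x y z : dot (x + y) z = dot x z + dot y z :> R.
Proof. by have := @dotPl R V 1 x y z; rewrite scale1r mul1r. Qed.

Lemma dot0l x : dot 0 x = 0 :> R.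
Proof. by apply: (addrI (dot 0 x)); rewrite -dotDl !addr0. Qed.

Lemma dotZl a x y : dot (a *: x) y = a * dot x y :> R.
Proof. by have := @dotPl R V a x 0 y; rewrite addr0 dot0l addr0. Qed.

Lemma dotNl x y : dot (- x) y = - dot x y :> R.
Proof. by rewrite -scaleN1r dotZl mulN1r. Qed.

Lemma dotBl x y z : dot (x - y) z = dot x z - dot y z :> R.
Proof. by rewrite dotDl dotNl. Qed.

Lemma dotDr x y z : dot z (x + y) = dot z x + dot z y :> R.
Proof. by rewrite dotC dotDl !(dotC z). Qed.

Lemma dotZr a x y : dot y (a *: x) = a * dot y x :> R.
Proof. by rewrite dotC dotZl (dotC y). Qed.

Lemma dotNr x y : dot y (- x) = - dot y x :> R.
Proof. by rewrite dotC dotNl (dotC y). Qed.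

Lemma dotBr x y z : dot z (x - y) = dot z x - dot z y :> R.
Proof. by rewrite dotDr dotNr. Qed.

Lemma normD_sqr x y : `|x + y| ^+ 2 = `|x| ^+ 2 + 2 * dot x y + `|y| ^+ 2 :> R.
Proof. by rewrite -!dotE dotDl !dotDr (dotC y x); ring. Qed.

Lemma normB_sqr x y : `|x - y| ^+ 2 = `|x| ^+ 2 - 2 * dot x y + `|y| ^+ 2 :> R.
Proof. by rewrite normD_sqr dotNr normrN mulrN. Qed.

Lemma dot_polarization x y : dot x y = (`|x + y| ^+ 2 - `|x - y| ^+ 2) / 4 :> R.
Proof. by rewrite normD_sqr normB_sqr; field. Qed.

End HilbertTheory.

Section BlinTheory.
Context {R : realType} {V W : normedModType R}.
Implicit Types (f g : 'L(V, W)) (x y : V).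

Lemma blinD f x y : f (x + y) = f x + f y.
Proof. by have := blin_linear f 1 x y; rewrite !scale1r. Qed.

Lemma blin0 f : f 0 = 0.
Proof. by apply: (addrI (f 0)); rewrite -blinD !addr0. Qed.

Lemma blinZ f (a : R) x : f (a *: x) = a *: f x.
Proof. by have := blin_linear f a x 0; rewrite !addr0 blin0 addr0. Qed.

Lemma blinN f x : f (- x) = - f x.
Proof. by rewrite -scaleN1r blinZ scaleN1r. Qed.

Lemma blinB f x y : f (x - y) = f x - f y.
Proof. by rewrite blinD blinN. Qed.

Lemma blin_zeroE x : (0 : 'L(V, W)) x = 0.
Proof. by []. Qed.

Lemma blin_subE f g x : (f - g) x = f x - g x.
Proof. by []. Qed.

Lemma blin_norm_le f x : `|f x| <= `|f| * `|x|.
Proof. exact: opnorm_leP. Qed.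

Lemma blin_normP f (M : R) : 0 <= M -> (forall x, `|f x| <= M * `|x|) -> `|f| <= M.
Proof.
move=> M0 h; apply: opnorm_le => x x1; apply: le_trans (h x) _.
by rewrite -[leRHS]mulr1 ler_wpM2l.
Qed.

Lemma blin_ext f g : (forall x, f x = g x) -> f = g.
Proof. by move=> h; apply: val_inj; apply/funext. Qed.

Lemma blin_pack (h : V -> W) (M : R) : linear h ->
  (forall x, `|h x| <= M * `|x|) -> exists f, forall x, f x = h x.
Proof.
move=> lh hM.
pose m := GRing.isLinear.Build R V W *:%R h lh.
pose g := HB.pack_for {linear V -> W} h m.
have cg : continuous h.
  rewrite -[h]/(g : V -> W); apply: bounded_linear_continuous.
  apply/bounded_funP => r; exists (`|M| * r) => x xr /=.
  have [hM0|M0] := leP 0 M.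
    by rewrite (le_trans (hM x))// ger0_norm// ler_wpM2l.
  rewrite (le_trans (le_trans (hM x) _) (mulr_ge0 (normr_ge0 M) (le_trans _ xr)))//.
  by rewrite mulr_le0_ge0// ltW.
have hP : h \in @blinear_pred R V W by apply/asboolP.
by exists (Blin hP).
Qed.

End BlinTheory.

(** First-order condition at a maximum. With t = n b / (n^2 m + 1) the inequality becomes 2 (n^2 m +
    1) <= n^2 m once (n b)^2 is cancelled; the summand 1 covers m = 0. *)
Lemma linear_le_quadratic_eq0 {R : realType} (n b m : R) : 0 < n -> 0 <= m ->
  (forall t, 2 * t * n * b <= n ^+ 2 * t ^+ 2 * m) -> b = 0.
Proof.
move=> n0 m0 h; have [//|b0] := eqVneq b 0.
have nm : 0 <= n ^+ 2 * m by rewrite mulr_ge0// sqr_ge0.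
have q0 : 0 < n ^+ 2 * m + 1 by rewrite ltr_wpDl.
have := h (n * b / (n ^+ 2 * m + 1)).
have nb2 : 0 < (n * b) ^+ 2 by rewrite exprn_even_gt0//= mulf_neq0// gt_eqF.
have -> : n ^+ 2 * (n * b / (n ^+ 2 * m + 1)) ^+ 2 * m =
    (n * b) ^+ 2 * (n ^+ 2 * m / (n ^+ 2 * m + 1) ^+ 2).
  by field; rewrite gt_eqF.
have -> : 2 * (n * b / (n ^+ 2 * m + 1)) * n * b =
    (n * b) ^+ 2 * (2 / (n ^+ 2 * m + 1)).
  by field; rewrite gt_eqF.
rewrite ler_pM2l// ler_pdivlMr ?exprn_gt0//.
have -> : 2 / (n ^+ 2 * m + 1) * (n ^+ 2 * m + 1) ^+ 2 = 2 * (n ^+ 2 * m + 1).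
  by field; rewrite gt_eqF.
lra.
Qed.

Section RieszTheory.
Context {R : realType} {V : hilbertType R}.

Lemma riesz_norm (k : V) : `|riesz k| = `|k| :> R.
Proof.
apply/eqP; rewrite eq_le; apply/andP; split.
  by apply: blin_normP => // x; exact: dot_CauchySchwarz.
have [->|k0] := eqVneq k 0; first by rewrite normr0.
have := blin_norm_le (riesz k) k.
rewrite /= dotE ger0_norm ?sqr_ge0// expr2 ler_pM2r ?normr_gt0//.
Qed.

Lemma rieszB (k l : V) : riesz (k - l) = riesz k - riesz l.
Proof. by apply: blin_ext => x; rewrite blin_subE /= dotBl. Qed.

(** A maximizing sequence of [phi] on the unit ball converges to some v with phi v = |phi| = n, and
    the first-order condition at v gives phi y = n <v, y>. The result turns measurability of
    functional-valued maps into measurability of V-valued ones. *)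
Lemma riesz_representation (phi : 'L(V, R^o)) : exists v, phi = riesz v.
Proof.
pose n : R := `|phi|.
have [n0|n0] := eqVneq n 0.
  exists 0; apply: blin_ext => x; rewrite /= dot0l; apply/eqP.
  by rewrite -normr_le0 (le_trans (blin_norm_le _ _))// -/n n0 mul0r.
have n_gt0 : 0 < n by rewrite lt_def n0 /n normr_ge0.
have ex k : exists x : V, `|x| <= 1 /\ n - k.+1%:R^-1 <= phi x.
  have := sup_adherent (eps := k.+1%:R^-1) _ (opnorm_has_sup phi).
  rewrite -/(opnorm phi) invr_gt0 ltr0n => /(_ isT)[_ [x /= x1 <-] /ltW hx].
  have [px|px] := leP 0 (phi x : R).
    by exists x; split => //; rewrite (le_trans hx)// ger0_norm.
  exists (- x); split; first by rewrite normrN.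
  by rewrite blinN (le_trans hx)// ltr0_norm.
have [x hx] := choice ex.
(* the maximizing sequence is Cauchy by the parallelogram identity *)
have cx : cvgn x.
  apply: cauchy_cvgn => e e0.
  (* Chosen so that phi (x_k + x_l) >= 2 n - 2 d, divided by n, reads |x_k + x_l| >= 2 - e^2 / 4;
     then |x_k - x_l|^2 <= 4 - (2 - e^2 / 4)^2 <= e^2. *)
  pose d : R := n * (e ^+ 2) / 8.
  have d0 : 0 < d by rewrite /d divr_gt0// mulr_gt0// exprn_gt0.
  have [N hN] : exists N, forall k, (N <= k)%N -> k.+1%:R^-1 <= d.
    have [N _ hN] := near_infty_natSinv_lt (PosNum d0).
    by exists N => k Nk; exact/ltW/(hN k).
  exists N => k l Nk Nl.
  have [k1 hk] := hx k; have [l1 hl] := hx l.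
  have pkl : 2 * n - 2 * d <= phi (x k + x l).
    have -> : phi (x k + x l) = (phi (x k) : R) + (phi (x l) : R) :> R.
      exact: blinD.
    have := hN _ Nk; have := hN _ Nl; move: hk hl.
    move: (phi (x k) : R) (phi (x l) : R) (k.+1%:R^-1 : R) (l.+1%:R^-1 : R) => p q a b.
    clearbody d; clearbody n.
    lra.
  have pkl' : phi (x k + x l) <= n * `|x k + x l|.
    exact: le_trans (ler_norm _) (blin_norm_le _ _).
  have key : 2 - e ^+ 2 / 4 <= `|x k + x l|.
    rewrite -(ler_pM2l n_gt0); apply: le_trans pkl'; apply: le_trans pkl.
    by rewrite /d; lra.
  have sum_sqr : `|x k + x l| ^+ 2 + `|x k - x l| ^+ 2 <= 4.
    rewrite normD_sqr normB_sqr.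
    have : `|x k| ^+ 2 <= 1 by rewrite expr_le1.
    have : `|x l| ^+ 2 <= 1 by rewrite expr_le1.
    lra.
  rewrite -(@ler_pXn2r _ 2)// ?nnegrE ?(ltW e0)//.
  have [e2|e2] := leP (e ^+ 2) 4; last by have := sqr_ge0 `|x k + x l|; lra.
  have : (2 - e ^+ 2 / 4) ^+ 2 <= `|x k + x l| ^+ 2.
    by rewrite ler_pXn2r ?nnegrE//; lra.
  by have := sqr_ge0 (e ^+ 2 : R); nra.
pose v := limn x.
have xv : x @ \oo --> v by [].
have nv : `|v| <= 1.
  rewrite -(cvg_lim (@Rhausdorff R) (cvg_norm xv)); apply: limr_le.
    by apply/cvg_ex; exists `|v|; exact: cvg_norm.
  by near=> k; exact: (hx k).1.
have pv : phi v = n.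
  have cpx : phi \o x @ \oo --> phi v.
    by apply: continuous_cvg => //; exact: blin_continuous.
  apply/eqP; rewrite eq_le; apply/andP; split.
    by rewrite (le_trans (ler_norm _))// (le_trans (blin_norm_le _ _))// ler_piMr.
  rewrite -(cvg_lim (@Rhausdorff R) cpx).
  have -> : n = limn (fun k => n - k.+1%:R^-1 : R).
    symmetry; apply: cvg_lim => //; rewrite -[X in _ --> X]subr0.
    by apply: cvgB; [exact: cvg_cst|exact: cvg_harmonic].
  apply: ler_lim.
  - apply/cvg_ex; exists (n - 0).
    by apply: cvgB; [exact: cvg_cst|exact: cvg_harmonic].
  - by apply/cvg_ex; exists (phi v).
  - by near=> k; exact: (hx k).2.
exists (n *: v); apply: blin_ext => y; rewrite /= dotZl.
apply/eqP; rewrite -subr_eq0; set b := _ - _; apply/eqP.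
have nv2 : `|v| ^+ 2 <= 1 by rewrite expr_le1.
(* Expands |phi (v + t y)|^2 <= n^2 |v + t y|^2 with phi v = n; the terms of order 0 are compared by
   |v| <= 1, and the square of t phi y is dropped. *)
have ineq t : 2 * t * n * b <= n ^+ 2 * t ^+ 2 * `|y| ^+ 2.
  have h : phi (v + t *: y) ^+ 2 <= n ^+ 2 * `|v + t *: y| ^+ 2.
    rewrite -exprMn -[leLHS]real_normK ?num_real//.
    by rewrite ler_pXn2r ?nnegrE// ?mulr_ge0// ?normr_ge0// ?blin_norm_le// ltW.
  move: h; rewrite blinD blinZ pv normD_sqr dotZr normrZ exprMn real_normK ?num_real//.
  rewrite -[t *: phi y]/(t * phi y) /b.
  move: (phi y : R) (dot v y : R) => p q.
  have : n ^+ 2 * `|v| ^+ 2 <= n ^+ 2 by rewrite ler_piMr// sqr_ge0.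
  move=> h1 h2; have := sqr_ge0 (t * p).
  nra.
exact: (linear_le_quadratic_eq0 n_gt0 (sqr_ge0 `|y|)).
Unshelve. all: end_near. Qed.

End RieszTheory.

Fixpoint running_max {R : realType} (s : nat -> R) (q : nat) : R :=
  if q is q'.+1 then Num.max (running_max s q') (s q) else s 0.

Lemma running_max_ge {R : realType} (s : nat -> R) q i :
  (i <= q)%N -> s i <= running_max s q.
Proof.
elim: q => [|q ih] /=; first by rewrite leqn0 => /eqP ->.
by rewrite leq_eqVlt ltnS le_max => /orP[/eqP ->|/ih ->//]; rewrite lexx orbT.
Qed.

(** * Pathwise maximal inequality in discrete time *)

Section PathwiseDoob.
Context {R : realType}.

(** With M the running maximum, 2 M^2 - 4 M s + 4 sum M ds <= 0 propagates by induction: a step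
    staying below the maximum b leaves the left-hand side unchanged, a new maximum u changes it by
    -2 (u - b)^2. Subtracting (2 s - M)^2 from it gives the claim. *)
Lemma pathwise_doob (s : nat -> R) Q : s 0 = 0 ->
  running_max s Q ^+ 2 <= 4 * s Q ^+ 2 -
    4 * \sum_(q < Q) running_max s q * (s q.+1 - s q).
Proof.
move=> s0.
suff h : 2 * running_max s Q ^+ 2 - 4 * running_max s Q * s Q +
    4 * \sum_(q < Q) running_max s q * (s q.+1 - s q) <= 0.
  by have := sqr_ge0 (2 * s Q - running_max s Q); nra.
elim: Q => [|Q ih]; first by rewrite big_ord0 /= s0 expr0n /= !mulr0 subr0 addr0.
rewrite big_ord_recr /=; move: ih; move: (\sum_(q < Q) _) => S.
set b := running_max s Q; set t := s Q; set u := s Q.+1 => ih.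
have [ub|bu] := leP u b; first by lra.
by have := sqr_ge0 (u - b); nra.
Qed.

Context {H K : hilbertType R}.

(** Convexity of the norm: a / |a| is a subgradient at a. Increments of |a| in Doob's inequality are
    thereby replaced by an expression linear in d, which can be hedged. *)
Lemma dot_div_norm_le (a d : K) : dot a d / `|a| <= `|a + d| - `|a| :> R.
Proof.
have [->|a0] := eqVneq a 0; first by rewrite dot0l mul0r add0r normr0 subr0.
have na : 0 < `|a| by rewrite normr_gt0.
rewrite ler_pdivrMr// mulrBl.
have : dot a (a + d) <= `|a| * `|a + d| :> R.
  exact: le_trans (ler_norm _) (dot_CauchySchwarz _ _).
rewrite dotDr dotE; lra.
Qed.

(** Doob's inequality for |a| together with |a + f dx|^2 = |a|^2 + 2 <a, f dx> + |f dx|^2, which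
    turns 4 |a_Q|^2 into the terms with factors 8 and 4. The increments of |a| are bounded below by
    the subgradient, whence the weight 4 max / |a|. *)
Lemma pathwise_doob_ito (a : nat -> K) (x : nat -> H) (f : nat -> 'L(H, K)) Q :
  a 0 = 0 ->
  (forall q, (q < Q)%N -> a q.+1 = a q + f q (x q.+1 - x q)) ->
  forall q, (q <= Q)%N -> `|a q| ^+ 2 <= \sum_(q < Q)
    ((8 - 4 * (running_max (fun q => `|a q|) q / `|a q|)) *
      dot (a q) (f q (x q.+1 - x q)) + 4 * (`|f q| ^+ 2 * `|x q.+1 - x q| ^+ 2)).
Proof.
move=> a0 ha q qQ; set s := fun q => `|a q|.
have sM i : 0 <= running_max s i.
  exact: le_trans (normr_ge0 _) (running_max_ge s (leq0n i)).
apply: (@le_trans _ _ (running_max s Q ^+ 2)).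
  by rewrite ler_pXn2r ?nnegrE// (running_max_ge s qQ).
have s0 : s 0 = 0 by rewrite /s a0 normr0.
apply: le_trans (pathwise_doob Q s0) _.
have sq : s Q ^+ 2 <= \sum_(q < Q) (2 * dot (a q) (f q (x q.+1 - x q)) +
    `|f q| ^+ 2 * `|x q.+1 - x q| ^+ 2).
  have : forall N, (N <= Q)%N -> s N ^+ 2 <= \sum_(q < N) (2 * dot (a q) (f q (x q.+1 - x q)) +
      `|f q| ^+ 2 * `|x q.+1 - x q| ^+ 2).
    elim=> [_|N ih NQ]; first by rewrite big_ord0 s0 expr0n.
    rewrite big_ord_recr /= {1}/s ha// normD_sqr -addrA lerD ?ih ?(ltnW NQ)//.
    by rewrite lerD2l -exprMn ler_pXn2r ?nnegrE ?mulr_ge0// blin_norm_le.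
  exact.
have dm : \sum_(q < Q) running_max s q / `|a q| * dot (a q) (f q (x q.+1 - x q)) <=
    \sum_(q < Q) running_max s q * (s q.+1 - s q).
  apply: ler_sum => i _; rewrite -mulrA ler_wpM2l// mulrC /s ha//.
  exact: dot_div_norm_le.
rewrite big_split /= -mulr_sumr.
have -> : \sum_(q < Q) (8 - 4 * (running_max s q / `|a q|)) * dot (a q) (f q (x q.+1 - x q)) =
    4 * (\sum_(q < Q) 2 * dot (a q) (f q (x q.+1 - x q))) -
    4 * \sum_(q < Q) running_max s q / `|a q| * dot (a q) (f q (x q.+1 - x q)) :> R.
  rewrite !mulr_sumr -sumrB; apply: eq_bigr => i _; ring.
rewrite big_split /= in sq; move: sq dm.
move: (\sum_(q < Q) _) (\sum_(q < Q) _) (\sum_(q < Q) _) (\sum_(q < Q) _) (s Q ^+ 2).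
move=> p1 p2 p3 p4 p5; lra.
Qed.

End PathwiseDoob.

(** * Paths and stopping *)

Lemma ler_dist_min {R : realDomainType} (u s t : R) :
  `|Num.min s u - Num.min t u| <= `|s - t|.
Proof.
wlog st : s t / s <= t => [h|].
  have [/h//|/ltW/h] := leP s t; by rewrite distrC (distrC t).
rewrite distrC (distrC s) !ger0_norm ?subr_ge0//; last by rewrite le_min !ge_min st lexx orbT.
have [tu|/ltW ut] := leP t u; have [su|/ltW us] := leP s u => //; lra.
Qed.

Section Paths.
Context {R : realType} {T : R} {V : normedModType R}.

Lemma nbhs_cpathP (w : cpath T V) (U : set (cpath T V)) :
  nbhs w U <-> exists2 e : R, 0 < e &
    forall w' : cpath T V, (forall t, 0 <= t <= T -> `|w t - w' t| < e) -> U w'.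
Proof.
split.
  case=> _ [[W oW <-] Ww sub].
  have : nbhs (set_val w) W by apply: open_nbhs_nbhs.
  move=> /uniform_nbhs[E [entE EW]].
  move: entE; rewrite -entourage_ballE => -[e /= e0 eE]; exists e => // w' h.
  apply: sub; apply: EW => t /=; rewrite in_itv /= => tT.
  by apply: eE; rewrite /= -ball_normE /=; exact: h.
case=> e e0 h.
have /uniform_nbhs hn : exists E : set (V * V), entourage E /\
    [set g : {uniform` `[0, T] -> V} | forall t, `[0, T]%classic t ->
      E (set_val w t, g t)] `<=` [set g | forall t, `[0, T]%classic t ->
      `|set_val w t - g t| < e].
  exists [set xy | `|xy.1 - xy.2| < e]; split; last by [].
  rewrite -entourage_ballE; exists e => //= -[x y] /=.
  by rewrite -ball_normE.
have : nbhs w (set_val @^-1` [set g : {uniform` `[0, T] -> V} |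
    forall t, `[0, T]%classic t -> `|set_val w t - g t| < e]).
  exact: (@initial_continuous _ _ (set_val : cpath T V -> {uniform` `[0, T] -> V}) w).
by apply: filterS => w' /= hw; apply: h => t tT; apply: hw; rewrite /= in_itv.
Qed.

Lemma cpath_unif (w : cpath T V) (e : R) : 0 < e -> exists2 d : R, 0 < d &
  forall s t, 0 <= s <= T -> 0 <= t <= T -> `|s - t| < d -> `|w s - w t| < e.
Proof.
move=> e0; have [cw _] := set_mem (valP w).
move/subspace_continuousP : cw => cw.
have := @segment_compact R 0 T => /compact_near_coveringP cov.
pose P (d x : R) := 0 <= x <= T ->
  forall t, 0 <= t <= T -> `|x - t| < d -> `|w x - w t| < e.
have : \forall d \near 0^'+, `[0, T]%classic `<=` P d.
  apply: cov => x xT.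
  have /cvgrPdist_lt/(_ (e / 2) (divr_gt0 e0 (ltr0Sn _ 1))) := cw x xT.
  rewrite near_withinE => -[r /= r0 hr].
  have {}hr y : 0 <= y <= T -> `|x - y| < r -> `|w x - w y| < e / 2.
    by move=> yT xy; exact: (hr y xy).
  exists (ball x (r / 2), [set d | 0 < d < r / 2]) => /=.
    split; first by apply: nbhsx_ballx; rewrite divr_gt0.
    near=> d; apply/andP; split; near: d; first exact: nbhs_right_gt.
    by apply: nbhs_right_lt; rewrite divr_gt0.
  move=> [y d] [/= + /andP[d0 dr]] yT t tT ytd; rewrite -ball_normE /= => xy.
  have h1 : `|w x - w y| < e / 2 by apply: hr => //; lra.
  have h2 : `|w x - w t| < e / 2.
    by apply: hr => //; have := ler_distD y x t; lra.
  have := ler_distD (w x) (w y) (w t); rewrite (distrC (w y) (w x)).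
  by move: h1 h2; lra.
move=> nP; near (0 : R)^'+ => d; exists d; first by near: d; exact: nbhs_right_gt.
move=> s t sT tT std; have : `[0, T]%classic `<=` P d by near: d.
by move=> /(_ s); rewrite /= in_itv /=; apply.
Unshelve. all: end_near. Qed.

Lemma cpath_out (w : cpath T V) t : ~ (0 <= t <= T) -> w t = 0.
Proof.
by move=> tT; apply: (set_mem (valP w)).2; rewrite /= in_itv.
Qed.

Lemma cpath_ext (w w' : cpath T V) :
  (forall t, 0 <= t <= T -> w t = w' t) -> w = w'.
Proof.
move=> h; apply: val_inj; apply/funext => t.
have [tT|tT] := pselect (0 <= t <= T); first exact: h.
by rewrite -[LHS]/(w t) -[RHS]/(w' t) !cpath_out.
Qed.

Lemma cpath_of (f : R -> V) :
  (forall e : R, 0 < e -> exists2 d : R, 0 < d &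
    forall s t, 0 <= s <= T -> 0 <= t <= T -> `|s - t| < d -> `|f s - f t| <= e) ->
  exists w : cpath T V, forall t, 0 <= t <= T -> w t = f t.
Proof.
move=> hf; pose g t := if 0 <= t <= T then f t else 0.
have gP : g \in @cpath_set R T V.
  rewrite inE; split; last by move=> t; rewrite /= in_itv /g /= => /negP/negbTE ->.
  apply/subspace_continuousP => x; rewrite /= in_itv /= => xT.
  apply/cvgrPdist_le => e e0; have [d d0 hd] := hf e e0.
  rewrite near_withinE; near=> t; rewrite /= in_itv /= => tT.
  rewrite /from_subspace /g xT tT; apply: hd => //.
  Unshelve. all: end_near.
exists (exist _ g gP) => t tT.
by rewrite -[LHS]/(g t) /g tT.
Qed.

Lemma cpath_stop_subproof (w : cpath T V) (u : R) : 0 <= u ->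
  exists w' : cpath T V, forall t, 0 <= t <= T -> w' t = w (Num.min t u).
Proof.
move=> u0; apply: cpath_of => e e0; have [d d0 hd] := cpath_unif w e0.
exists d => // s t sT tT std.
have mT r : 0 <= r <= T -> 0 <= Num.min r u <= T.
  by rewrite le_min u0 andbT => /andP[-> rT] /=; rewrite ge_min rT.
by apply/ltW/hd; rewrite ?mT//; apply: le_lt_trans (ler_dist_min _ _ _) std.
Qed.

Lemma cpath0_ex : exists w : cpath T V, forall t, w t = 0.
Proof.
have [|w h] := @cpath_of (fun=> 0).
  by move=> e e0; exists 1 => // *; rewrite subrr normr0 ltW.
exists w => t; have [/h//|tT] := pselect (0 <= t <= T).
by rewrite cpath_out.
Qed.

End Paths.

Section PathSpaceTheory.
Context {R : realType} {T : R} {H : normedModType R}.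
Local Notation Omega := (Omega T H).

Lemma Omega_ext (w w' : Omega) :
  (forall t, 0 <= t <= T -> w t = w' t) -> w = w'.
Proof. by move=> h; apply: val_inj; apply: cpath_ext. Qed.

Lemma nbhs_OmegaP (w : Omega) (U : set Omega) :
  nbhs w U <-> exists2 e : R, 0 < e &
    forall w' : Omega, (forall t, 0 <= t <= T -> `|w t - w' t| < e) -> U w'.
Proof.
split.
  case=> _ [[W oW <-] Ww sub].
  have : nbhs (set_val w) W by apply: open_nbhs_nbhs.
  move=> /nbhs_cpathP[e e0 h]; exists e => // w' hw; apply: sub; exact: h.
case=> e e0 h.
have /nbhs_cpathP hn : exists2 e' : R, 0 < e' & forall w' : cpath T H,
    (forall t, 0 <= t <= T -> `|set_val w t - w' t| < e') ->
    [set w' : cpath T H | forall t, 0 <= t <= T -> `|set_val w t - w' t| < e] w'.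
  by exists e.
have : nbhs w (set_val @^-1` [set w' : cpath T H |
    forall t, 0 <= t <= T -> `|set_val w t - w' t| < e]).
  exact: (@initial_continuous _ _ (set_val : Omega -> cpath T H) w).
by apply: filterS => w' /= hw; exact: h.
Qed.

Lemma zero_path_Omega : exists w : Omega, forall t, w t = 0.
Proof.
have [w w0] := @cpath0_ex R T H; have [q q0] := @cpath0_ex R T R^o.
have wO : w \in @Omega_set R T H.
  rewrite inE; exists q => A /uniform_nbhs[E [entE EA]].
  exists 0 => // m _; apply: EA => t tT /=; rewrite q0.
  have -> : qv_sum T w m t = 0; last exact: entourage_refl.
  rewrite /qv_sum (_ : series _ = cst 0) ?lim_cst//.
  by apply/funext => n; rewrite /series /= big1// => i _; rewrite !w0 subrr normr0 expr0n.
by exists (exist _ w wO).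
Qed.

HB.instance Definition _ := isPointed.Build Omega (sval (cid zero_path_Omega)).

Lemma Omega_continuousP {W : normedModType R} (f : Omega -> W) :
  continuous f <-> forall (w : Omega) (e : R), 0 < e -> exists2 d : R, 0 < d &
    forall w' : Omega, (forall t, 0 <= t <= T -> `|w t - w' t| < d) ->
      `|f w - f w'| < e.
Proof.
split=> hf w.
  move=> e e0; have := hf w; rewrite /continuous_at.
  by move=> /(@cvgrPdist_lt _ _ _ _ (nbhs_filter w))/(_ e e0)/nbhs_OmegaP.
apply/(@cvgrPdist_lt _ _ _ _ (nbhs_filter w)) => e e0.
exact/nbhs_OmegaP/hf.
Qed.

Lemma procS_near (w : Omega) (e : R) : 0 < e -> exists2 d : R, 0 < d &
  forall s t (w' : Omega), 0 <= s <= T -> 0 <= t <= T -> `|s - t| < d ->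
    (forall r, 0 <= r <= T -> `|w r - w' r| < d) -> `|w s - w' t| < e.
Proof.
move=> e0; have [d d0 hd] := cpath_unif w (divr_gt0 e0 (ltr0Sn _ 1)).
exists (Num.min d (e / 2)); first by rewrite lt_min d0 divr_gt0.
move=> s t w' sT tT; rewrite lt_min => /andP[std _] hw.
have := hw t tT; rewrite lt_min => /andP[_ h2].
have h1 := hd s t sT tT std.
by have := ler_distD (w t) (w s) (w' t); move: h1 h2; lra.
Qed.

Lemma procS_continuous t : 0 <= t <= T -> continuous (@procS R T H t).
Proof.
move=> tT; apply/Omega_continuousP => w e e0; have [d d0 hd] := procS_near w e0.
by exists d => // w' hw; apply: hd; rewrite ?subrr ?normr0.
Qed.

Lemma OmegaP (w : cpath T H) : Omega_set w <-> exists q : cpath T R^o,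
  forall e : R, 0 < e -> exists N, forall m, (N <= m)%N ->
    forall t, 0 <= t <= T -> `|q t - qv_sum T w m t| < e.
Proof.
split=> -[q hq]; exists q.
  move=> e e0.
  have /hq[N _ hN] : nbhs (cpath_fun q : {uniform` `[0, T] -> R^o})
      [set g | forall t, `[0, T]%classic t -> `|q t - g t| < e].
    apply/uniform_nbhs; exists [set xy | `|xy.1 - xy.2| < e]; split; last by [].
    by rewrite -entourage_ballE; exists e => //= -[x y] /=; rewrite -ball_normE.
  by exists N => m Nm t tT; apply: (hN m Nm); rewrite /= in_itv.
move=> A /uniform_nbhs[E [+ EA]]; rewrite -entourage_ballE => -[e /= e0 eE].
have [N hN] := hq e e0; exists N => // m Nm; apply: EA => t /=.
rewrite in_itv /= => tT; apply: eE; rewrite /= -ball_normE /=; exact: hN.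
Qed.

Lemma Omega_qv (w : Omega) : exists q : cpath T R^o,
  (forall t, 0 <= t <= T -> qv w t = q t) /\
  forall e : R, 0 < e -> exists N, forall m, (N <= m)%N ->
    forall t, 0 <= t <= T -> `|q t - qv_sum T w m t| < e.
Proof.
have [q hq] := (OmegaP _).1 (set_mem (valP w)); exists q; split=> // t tT.
apply: cvg_lim; first exact: Rhausdorff.
apply/cvgrPdist_lt => e e0; have [N hN] := hq e e0.
by exists N => // m Nm; exact: hN.
Qed.

End PathSpaceTheory.

(** * Hitting times and approximate quadratic variation *)

Section HittingTimes.
Context {R : realType} {T : R} {H : normedModType R} (T0 : 0 <= T).
Implicit Types (w : R -> H).

Lemma qv_time_ge0_le m w k : 0 <= qv_time T m w k <= T.
Proof.
elim: k => [|k /andP[k0 kT]] /=; first by rewrite lexx.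
set A := [set t | _]; have AT : (A `|` [set T]) T by right.
apply/andP; split; last by apply: ge_inf => //; exists 0 => t [[/andP[st _] _]|->//]; lra.
apply: lb_le_inf; first by exists T.
by move=> t [[/andP[st _] _]|->//]; lra.
Qed.

Lemma le_qv_timeS m w k x : x <= T -> (x <= qv_time T m w k.+1 <->
  forall t, qv_time T m w k <= t <= T ->
    2 ^- m <= `|w t - w (qv_time T m w k)| -> x <= t).
Proof.
move=> xT /=; set s := qv_time T m w k; set A := [set t | _].
have /andP[s0 _] : 0 <= s <= T by exact: qv_time_ge0_le.
have AT : (A `|` [set T]) T by right.
have lbA : has_lbound (A `|` [set T]).
  by exists 0 => t [[/andP[st _] _]|->//]; exact: le_trans st.
split=> [xi t sT h|h].
  by apply: le_trans xi _; apply: ge_inf => //; left.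
by apply: lb_le_inf; [exists T|move=> t [[tT ht]|->//]; exact: h].
Qed.

Lemma qv_time_leS m w k : qv_time T m w k <= qv_time T m w k.+1.
Proof.
apply/le_qv_timeS; first by case/andP: (qv_time_ge0_le m w k).
by move=> t /andP[].
Qed.

(** Hitting times before u see only the path up to u. Two times truncated at u agree as soon as the
    same x <= u lie below them, and [le_qv_timeS] turns this into a comparison of the two paths up
    to u. If the k-th time is not before u, neither is the next one. *)
Lemma qv_time_stop m w w' u k : 0 <= u <= T ->
  (forall t, 0 <= t <= T -> w' t = w (Num.min t u)) ->
  Num.min (qv_time T m w' k) u = Num.min (qv_time T m w k) u.
Proof.
move=> /andP[u0 uT] ww'; elim: k => [//|k ih].
suff h x : x <= u -> (x <= qv_time T m w' k.+1 <-> x <= qv_time T m w k.+1).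
  have mu (x y : R) : Num.min x y <= y by rewrite ge_min lexx orbT.
  have ml (x y : R) : Num.min x y <= x by rewrite ge_min lexx.
  by apply/eqP; rewrite eq_le !le_min !mu !andbT; apply/andP; split; apply/h.
move=> xu; rewrite !le_qv_timeS ?(le_trans xu)//.
have /andP[s0 sT] := qv_time_ge0_le m w k.
have /andP[s0' sT'] := qv_time_ge0_le m w' k.
move: ih s0 sT s0' sT'; set s := qv_time T m w k; set s' := qv_time T m w' k.
move=> ih s0 sT s0' sT'.
have [us|su] := leP u s.
  have us' : u <= s'.
    by move: ih; rewrite (min_r us) => <-; rewrite ge_min lexx.
  split=> _ t /andP[st _] _; [exact: le_trans (le_trans us st)|].
  exact: le_trans (le_trans us' st).
have ss' : s' = s.
  move: ih; rewrite (min_l (ltW su)); have [//|us'] := leP s' u.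
  by move=> us; move: su; rewrite -us ltxx.
have ws : w' s' = w s by rewrite ww' ?s0'// ss' (min_l (ltW su)).
rewrite ws ss'; split=> h t /andP[st tT] ht.
  have [tu|ut] := leP t u; last exact: le_trans (ltW ut).
  apply: h; rewrite ?st// ww' ?(le_trans s0)// (min_l tu)//.
have [tu|ut] := leP t u; last exact: le_trans (ltW ut).
apply: h; rewrite ?st//.
by move: ht; rewrite ww' ?(le_trans s0)// (min_l tu).
Qed.

(** By uniform continuity successive hitting times before T are at least d apart, so the k-th one is
    at least min (T, k d). Hence the sums defining the quadratic variation are finite. *)
Lemma qv_time_eventually m (w : cpath T H) : exists K, qv_time T m w K = T.
Proof.
have e0 : 0 < 2 ^- m :> R by rewrite invr_gt0 exprn_gt0.
have [d d0 hd] := cpath_unif w e0.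
suff h k : Num.min T (k%:R * d) <= qv_time T m w k.
  have [K hK] : exists K, T <= K%:R * d.
    exists (Num.truncn (T / d)).+1; rewrite -ler_pdivrMr//.
    by apply/ltW; rewrite truncnS_gt.
  exists K; apply/eqP; rewrite eq_le; apply/andP; split.
    by case/andP: (qv_time_ge0_le m w K).
  by apply: le_trans (h K); rewrite (min_l hK).
elim: k => [|k ih]; first by rewrite mul0r /= ge_min lexx orbT.
apply/le_qv_timeS; first by rewrite ge_min lexx.
move: ih; set s := qv_time T m w k => ih t /andP[st tT] ht.
rewrite leNgt; apply/negP; rewrite lt_min => /andP[tT' tk].
have sT : 0 <= s <= T by exact: qv_time_ge0_le.
have tT2 : 0 <= t <= T by rewrite tT (le_trans _ st)//; case/andP: sT.
have := hd t s tT2 sT.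
have -> : `|t - s| = t - s by rewrite ger0_norm// subr_ge0.
have : t - s < d.
  move: ih; rewrite ge_min => /orP[Ts|ks].
    by move: sT => /andP[]; lra.
  by move: tk; rewrite -natr1 mulrDl mul1r; lra.
by move=> tsd /(_ tsd); rewrite ltNge ht.
Qed.

Lemma lim_series_eventually0 {W : normedModType R} (f : nat -> W) n :
  (forall k, (n <= k)%N -> f k = 0) -> limn (series f) = \sum_(k < n) f k.
Proof.
move=> f0; apply: cvg_lim; first exact: (@norm_hausdorff _ W).
apply: cvg_near_cst; exists n => // k /= nk.
rewrite /series /= -(big_mkord xpredT f) (big_cat_nat (leq0n n) nk)//=.
rewrite [X in _ + X]big_nat_cond [X in _ + X]big1 ?addr0//.
by move=> i /andP[/andP[/f0]].
Qed.

Lemma qv_time_stays m w K i : qv_time T m w K = T -> (K <= i)%N -> qv_time T m w i = T.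
Proof.
move=> hK Ki; rewrite -(subnKC Ki); elim: (i - K)%N => [|j ih]; first by rewrite addn0.
rewrite addnS; apply/eqP; rewrite eq_le (andP (qv_time_ge0_le m w _)).2 /=.
by rewrite -{1}ih qv_time_leS.
Qed.

Lemma qv_sumE m w K t : qv_time T m w K = T -> t <= T -> qv_sum T w m t =
  \sum_(k < K) `|w (Num.min (qv_time T m w k.+1) t) -
     w (Num.min (qv_time T m w k) t)| ^+ 2.
Proof.
move=> hK tT; apply: lim_series_eventually0 => k Kk.
by rewrite !(qv_time_stays hK) ?(leqW Kk)// subrr normr0 expr0n.
Qed.

Lemma qv_sum_stop m w w' u t : 0 <= u <= T -> 0 <= t <= T ->
  (forall t, 0 <= t <= T -> w' t = w (Num.min t u)) ->
  qv_sum T w' m t = qv_sum T w m (Num.min t u).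
Proof.
move=> uT tT ww'; rewrite /qv_sum; congr (limn (series _)); apply/funext => k.
have h j : w' (Num.min (qv_time T m w' j) t) =
    w (Num.min (qv_time T m w j) (Num.min t u)).
  have /andP[s0 sT] := qv_time_ge0_le m w' j.
  case/andP: tT => t0 tT.
  rewrite ww'; last by rewrite le_min s0 t0 ge_min sT.
  by rewrite minAC (qv_time_stop _ _ uT ww') minAC minA.
by rewrite !h.
Qed.

End HittingTimes.

(** * Stopping of paths *)

Section Stopping.
Context {R : realType} {T : R} {H : normedModType R}.
Local Notation Omega := (Omega T H).

(** The approximating sums commute with stopping, so the stopped path has the stopped quadratic
    variation and stays in [Omega]. For u < 0 the path itself is taken as a default. *)
Lemma Omega_stop_ex (u : R) (w : Omega) : exists w' : Omega,
  0 <= u -> forall t, 0 <= t <= T -> w' t = w (Num.min t u).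
Proof.
have [u0|u0] := leP 0 u; last by exists w.
have [uT|Tu] := leP u T; last first.
  by exists w => _ t /andP[_ tT]; rewrite min_l// (le_trans tT)// ltW.
have [w' ww'] := cpath_stop_subproof w u0.
have T0 : 0 <= T by exact: le_trans uT.
have uI : 0 <= u <= T by rewrite u0.
have w'O : w' \in @Omega_set R T H.
  rewrite inE; apply/OmegaP; have [q [_ hq]] := Omega_qv w.
  have [q' qq'] := cpath_stop_subproof q u0; exists q' => e e0.
  have [N hN] := hq e e0; exists N => m Nm t tT.
  rewrite qq'// (qv_sum_stop T0 m uI tT ww').
  apply: hN => //; case/andP: tT => t0 tT.
  by rewrite le_min t0 u0 ge_min tT.
by exists (exist _ w' w'O) => _ t tT; rewrite -ww'.
Qed.

Definition stop (u : R) (w : Omega) : Omega := sval (cid (Omega_stop_ex u w)).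

Lemma stopE u w t : 0 <= u -> 0 <= t <= T -> stop u w t = w (Num.min t u).
Proof. by move=> u0; exact: (svalP (cid (Omega_stop_ex u w)) u0). Qed.

Lemma stop_id u (w : Omega) : 0 <= u -> T <= u -> stop u w = w.
Proof.
move=> u0 Tu; apply: Omega_ext => t tT; rewrite stopE// min_l//.
by case/andP: tT => _ tT; exact: le_trans Tu.
Qed.

Lemma stop_stop u v w : 0 <= u -> 0 <= v -> stop u (stop v w) = stop (Num.min u v) w.
Proof.
move=> u0 v0; apply: Omega_ext => t tT; rewrite !stopE// ?le_min ?u0 ?v0 ?minA//.
by case/andP: tT => t0 tT; rewrite t0 ge_min tT.
Qed.

Lemma qv_stop u (w : Omega) t : 0 <= u -> 0 <= t <= T ->
  qv (stop u w) t = qv w (Num.min t u).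
Proof.
move=> u0 tT; have [uT|Tu] := leP u T; last first.
  rewrite stop_id// ?ltW// min_l//; case/andP: tT => _ tT.
  by rewrite (le_trans tT)// ltW.
rewrite /qv (_ : (fun m => qv_sum T (stop u w) m t) =
  (fun m => qv_sum T w m (Num.min t u)))//; apply/funext => m.
apply: qv_sum_stop => //; first by case/andP: tT => t0; exact: le_trans.
  by rewrite u0.
by move=> s sT; rewrite stopE.
Qed.

End Stopping.

(** * Filtrations *)

Lemma dist_lt_of_common {R : realType} {V : normedModType R} (y x z : V) (a e : R) :
  `|x - y| <= a -> `|z - y| <= a -> a < e / 2 -> `|x - z| < e.
Proof.
move=> xy zy ae; apply: le_lt_trans (ler_distD y x z) _; rewrite (distrC y z).
by apply: le_lt_trans (lerD xy zy) _; lra.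
Qed.

Lemma separable_seq {R : realType} {X : normedModType R} : separable X ->
  exists h : nat -> X, forall x (e : R), 0 < e -> exists i, `|x - h i| < e.
Proof.
case=> D /countable_injP[f fI] dD.
exists (fun n => xget 0 [set x | D x /\ f x = n]) => x e e0.
have [||y [xy Dy]] := dD (ball x e).
- by exists x; exact: ballxx.
- exact: ball_open.
exists (f y); case: xgetP => [z zE [Dz fz]|/(_ y)/=]; last by case.
have zy : z = y by apply: fI => //; exact/mem_set.
by rewrite zy; move: xy; rewrite -ball_normE.
Qed.

Lemma separable_regular {R : realType} : separable R^o.
Proof.
exists (@ratr R @` setT); last exact: dense_rat.
exact/card_le_trans/(@countableP _ [set: rat])/card_image_le.
Qed.

Lemma norm_continuousP {R : realType} {V W : normedModType R} (f : V -> W) :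
  continuous f <-> forall x (e : R), 0 < e -> exists2 d : R, 0 < d &
    forall y, `|x - y| < d -> `|f x - f y| < e.
Proof.
split=> hf x.
  move=> e e0; have := hf x; rewrite /continuous_at.
  move=> /(@cvgrPdist_lt _ _ _ _ (nbhs_filter x))/(_ e e0)/nbhs_ballP[d /= d0 hd].
  by exists d => // y xy; apply: hd; rewrite -ball_normE.
apply/(@cvgrPdist_lt _ _ _ _ (nbhs_filter x)) => e e0.
have [d d0 hd] := hf x e e0; apply/nbhs_ballP; exists d => //= y.
by rewrite -ball_normE; exact: hd.
Qed.

Lemma sigma_setI_prop {X : Type} (G : set (set X)) (B : set X) (P : Prop) :
  sigma_algebra setT G -> G B -> G (B `&` [set _ | P]).
Proof.
move=> [G0 _ _] GB; have [p|np] := pselect P.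
  by rewrite (_ : [set _ | _] = setT) ?setIT//; apply/seteqP; split.
by rewrite (_ : [set _ | _] = set0) ?setI0//; apply/seteqP; split.
Qed.

(** * Measurability of real-valued and functional-valued maps *)

Section RealMeasurability.
Context {R : realType} {X : pointedType}.
Implicit Types (G : set (set X)) (f g : X -> R).

(** The sigma-algebra is a parameter because filtrations at many times live on the same space. *)
Definition rmeas G f : Prop :=
  @measurable_fun _ _ (g_sigma_algebraType G) R setT f.

Lemma rmeas_preimage G f (B : set R) : sigma_algebra setT G ->
  rmeas G f -> measurable B -> G (f @^-1` B).
Proof.
move=> hG mf mB; have := mf measurableT B mB; rewrite setTI.
by rewrite /measurable /= sigma_algebra_id.
Qed.

Lemma rmeas_of_le G f : sigma_algebra setT G ->
  (forall a : R, G [set w | f w <= a]) -> rmeas G f.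
Proof.
move=> hG h; rewrite /rmeas; apply: (measurability _ (RGenOInfty.measurableE R)).
move=> _ [_ [a ->] <-]; rewrite setTI /measurable /= sigma_algebra_id//.
have [_ GC _] := hG; rewrite (_ : _ @^-1` _ = setT `\` [set w | f w <= a]).
  exact: GC.
apply/seteqP; split=> w /=; rewrite in_itv /= andbT.
  by move=> fa; split=> //; apply/negP; rewrite -ltNge.
by move=> [_ /negP]; rewrite -ltNge.
Qed.

Lemma rmeas_sub G G' f : sigma_algebra setT G -> sigma_algebra setT G' ->
  G `<=` G' -> rmeas G f -> rmeas G' f.
Proof.
move=> hG hG' GG' mf; apply: rmeas_of_le => // a; apply: GG'.
apply: (rmeas_preimage hG mf (B := `]-oo, a]%classic) _ : G [set w | _]).
exact: measurable_itv.
Qed.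

End RealMeasurability.

Section BorelMeasurability.
Context {R : realType} {T : R} {H : normedModType R}.
Local Notation Omega := (Omega T H).
Implicit Types (G : set (set Omega)).

Lemma borel_of_open {Y : topologicalType} G (f : Omega -> Y) :
  sigma_algebra setT G -> (forall U, open U -> G (f @^-1` U)) ->
  borel_measurable_for G f.
Proof.
move=> [G0 GC GU] h B; apply: (smallest_sub (X := [set A | G (f @^-1` A)])) => //.
by split=> [//|A hA|A hA] /=; [exact: GC|rewrite preimage_bigcup; exact: GU].
Qed.

Lemma borel_open {Y : topologicalType} G (f : Omega -> Y) U :
  borel_measurable_for G f -> open U -> G (f @^-1` U).
Proof. by move=> h oU; apply: h; exact: sub_sigma_algebra. Qed.

Lemma borel_closed {Y : topologicalType} G (f : Omega -> Y) U :
  borel_measurable_for G f -> closed U -> G (f @^-1` U).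
Proof.
move=> h cU; apply: h; rewrite -[U]setCK -setTD; apply: sigma_algebraCD.
by apply: sub_sigma_algebra; exact: closed_openC.
Qed.

Lemma borel_sub {Y : topologicalType} G G' (f : Omega -> Y) :
  G `<=` G' -> borel_measurable_for G f -> borel_measurable_for G' f.
Proof. by move=> GG' h B hB; apply: GG'; exact: h. Qed.

Lemma borel_comp_continuous {Y Z : topologicalType} G (f : Omega -> Y) (g : Y -> Z) :
  sigma_algebra setT G -> borel_measurable_for G f -> continuous g ->
  borel_measurable_for G (g \o f).
Proof.
move=> hG mf cg; apply: borel_of_open => // U oU.
rewrite comp_preimage; apply: borel_open => //.
by apply: open_comp => // y _; exact: cg.
Qed.

Lemma borel_rmeas G (f : Omega -> R) : sigma_algebra setT G ->
  borel_measurable_for G (f : Omega -> R^o) -> rmeas G f.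
Proof.
move=> hG mf; apply: rmeas_of_le => // a.
apply: (borel_closed (U := [set x : R^o | x <= a]) mf); exact: closed_le.
Qed.

End BorelMeasurability.

Section BlinMeasurability.
Context {R : realType} {T : R} {H : normedModType R} {V : hilbertType R}.
Context (sepV : separable V).
Local Notation Omega := (Omega T H).
Implicit Types (G : set (set Omega)).

Lemma blin_app_rmeas G (f : Omega -> 'L(V, R^o)) x : sigma_algebra setT G ->
  borel_measurable_for G f -> rmeas G (fun w => f w x).
Proof.
move=> hG mf; apply: borel_rmeas => //.
apply: (@borel_comp_continuous _ _ _ _ _ _ f (fun g : 'L(V, R^o) => g x)) => //.
apply/norm_continuousP => g e e0; have x0 : 0 < `|x| + 1 by rewrite ltr_wpDl.
exists (e / (`|x| + 1)); first by rewrite divr_gt0.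
move=> g' gg'; apply: le_lt_trans (blin_norm_le (g - g') x) _.
apply: (@le_lt_trans _ _ (`|g - g'| * (`|x| + 1))); first by rewrite ler_wpM2l// lerDl.
by rewrite -ltr_pdivlMr.
Qed.

Lemma blin_norm_dense {W : normedModType R} (h : nat -> V) (g : 'L(V, W)) (r : R) :
  (forall x (e : R), 0 < e -> exists i, `|x - h i| < e) -> 0 <= r ->
  (forall j, `|g (h j)| <= r * `|h j|) -> `|g| <= r.
Proof.
move=> hh r0 hj; apply: blin_normP => // x; apply/ler_addgt0Pr => e e0.
have c0 : 0 < r + `|g| + 1 by rewrite ltr_wpDl// addr_ge0.
have [j xj] := hh x _ (divr_gt0 e0 c0).
have -> : g x = g (h j) + g (x - h j) by rewrite -blinD addrC subrK.
apply: le_trans (ler_normD _ _) _.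
have h1 : `|g (x - h j)| <= `|g| * `|x - h j| by exact: blin_norm_le.
have h2 : `|h j| <= `|x| + `|x - h j|.
  by rewrite -[h j in leLHS](subKr x) (le_trans (ler_normB _ _)).
have h3 := hj j; have h4 := ler_wpM2l r0 h2.
have h5 : (r + `|g| + 1) * `|x - h j| <= e.
  by rewrite mulrC -ler_pdivlMr// ltW.
have h6 : 0 <= `|x - h j| by [].
apply: le_trans (lerD (le_trans h3 h4) h1) _; rewrite mulrDr -addrA lerD2l.
by apply: le_trans h5; rewrite !mulrDl mul1r lerDl.
Qed.

(* A Pettis-type criterion: the dual of a separable Hilbert space is separable. *)
Lemma blin_borel G (f : Omega -> 'L(V, R^o)) : sigma_algebra setT G ->
  (forall x, rmeas G (fun w => f w x)) -> borel_measurable_for G f.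
Proof.
move=> hG mf; have [h hh] := separable_seq sepV.
apply: borel_of_open => // U oU.
pose B i k := [set w | `|f w - riesz (h i)| <= k.+1%:R^-1].
have mB i k : G (B i k).
  have -> : B i k = \bigcap_j
      [set w | `|f w (h j) - dot (h i) (h j)| <= k.+1%:R^-1 * `|h j|].
    apply/seteqP; split=> w /=.
      move=> fr j _ /=; apply: le_trans (blin_norm_le (f w - riesz (h i)) (h j)) _.
      by rewrite ler_wpM2r.
    move=> hj; apply: (blin_norm_dense hh) => // j; exact: hj.
  rewrite -(sigma_algebra_id hG).
  apply: (@bigcapT_measurable _ (g_sigma_algebraType G)) => j.
  rewrite /measurable /= sigma_algebra_id//.
  apply: (@rmeas_preimage _ _ _ (fun w => `|f w (h j) - dot (h i) (h j)|)
    `]-oo, (k.+1%:R^-1 * `|h j|)]%classic) => //.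
  apply: measurableT_comp; first exact: normr_measurable.
  exact: (measurable_funB (mf (h j)) (measurable_cst _)).
(* U is the union of those balls of radius 1 / (k+1) about functionals [riesz (h i)] that it
   contains. These are countably many, and they suffice because every functional is the Riesz image
   of a vector close to some [h i]. *)
have -> : f @^-1` U = \bigcup_i \bigcup_k (B i k `&` [set _ |
    forall g : 'L(V, R^o), `|g - riesz (h i)| <= k.+1%:R^-1 -> U g]).
  apply/seteqP; split=> w /=; last by move=> [i _ [k _ [/= + hk]]]; exact: hk.
  move=> Ufw; have /nbhs_ballP[e /= e0 he] : nbhs (f w) U by exact: open_nbhs_nbhs.
  have e20 : 0 < e / 2 by rewrite divr_gt0.
  have [k _ /(_ k (leqnn k))/= hk] := near_infty_natSinv_lt (PosNum e20).
  have [v fv] := riesz_representation (f w).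
  have [i hi] := hh v k.+1%:R^-1 (ltac:(by [])).
  have fi : `|f w - riesz (h i)| <= k.+1%:R^-1.
    by rewrite fv -rieszB riesz_norm ltW.
  exists i => //; exists k => //; split=> //= g gi; apply: he.
  by rewrite -ball_normE /=; exact: dist_lt_of_common fi gi hk.
have [G0 _ GU] := hG; apply: (GU) => i; apply: GU => k.
exact: sigma_setI_prop.
Qed.

End BlinMeasurability.

Section Filtrations.
Context {R : realType} {T : R} {H : normedModType R}.
Local Notation Omega := (Omega T H).
Implicit Types (w : Omega) (B : set Omega) (s t u v : R).

Lemma filt_sigma t : sigma_algebra setT (@filt R T H t).
Proof. exact: smallest_sigma_algebra. Qed.

Lemma filt_le s t : s <= t -> @filt R T H s `<=` filt t.
Proof.
move=> st; apply: sub_sigma_algebra2 => _ [r /= rs [U oU <-]].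
exists r; last by exists U.
move: rs; rewrite /= !in_itv /= => /andP[-> /le_trans]; apply.
by rewrite le_min !ge_min st lexx orbT.
Qed.

Lemma filt_leT t : @filt R T H t `<=` filt T.
Proof.
apply: sub_sigma_algebra2 => _ [r /= rs [U oU <-]]; exists r; last by exists U.
by move: rs; rewrite /= !in_itv /= minxx => /andP[-> /le_trans]; apply; rewrite ge_min lexx orbT.
Qed.

Lemma filt_plus_sigma t : sigma_algebra setT (@filt_plus R T H t).
Proof.
split=> [s _|A hA s ts|A hA s ts].
- by have [] := filt_sigma s.
- by have [_ GC _] := filt_sigma s; apply: GC; exact: hA.
- by have [_ _ GU] := filt_sigma s; apply: GU => n; exact: hA.
Qed.

Lemma filt_sub_plus t : @filt R T H t `<=` filt_plus t.
Proof. by move=> B hB s; rewrite /= in_itv /= andbT => ts; apply: filt_le hB; exact: ltW. Qed.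

Lemma filt_plus_sub s t : s < t -> @filt_plus R T H s `<=` filt t.
Proof. by move=> st B; apply; rewrite /= in_itv /= st. Qed.

Lemma filt_plus_subT t : @filt_plus R T H t `<=` filt T.
Proof. move=> B /(_ (t + 1)) hB; apply: (@filt_leT (t + 1)); apply: hB.
by rewrite /= in_itv /= ltrDl ltr01. Qed.

Lemma filt_plus_le s t : s <= t -> @filt_plus R T H s `<=` filt_plus t.
Proof.
move=> st B hB r; rewrite /= in_itv /= andbT => tr; apply: hB.
by rewrite /= in_itv /= andbT (le_lt_trans st).
Qed.

(** The events with this property form a sigma-algebra that contains the generators of the
    filtration at u. It is the pathwise form of adaptedness used throughout. *)
Lemma filt_agree u B w w' : filt u B ->
  (forall t, 0 <= t <= T -> t <= u -> w t = w' t) -> B w <-> B w'.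
Proof.
move=> hB ww'; suff: [set B : set Omega | B w <-> B w'] B by [].
move: B hB; apply: smallest_sub.
  split=> /= [//|A hA|A hA].
    by split=> -[_ nA]; split=> // /hA.
  by split=> -[n _ An]; exists n => //; apply/hA.
move=> _ [s /= + [U oU <-]] /=; rewrite in_itv /= le_min => /andP[s0 /andP[su sT]].
by rewrite /procS ww'// s0.
Qed.

Lemma filt_plus_agree u v B w w' : u < v -> filt_plus u B ->
  (forall t, 0 <= t <= T -> t <= v -> w t = w' t) -> B w <-> B w'.
Proof. by move=> uv /(filt_plus_sub uv); exact: filt_agree. Qed.

Lemma stop_cvg (W : normedModType R) (f : Omega -> W) u w : 0 <= u ->
  continuous f -> forall e : R, 0 < e -> exists2 v, u < v &
    `|f (stop u w) - f (stop v w)| < e.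
Proof.
move=> u0 /Omega_continuousP cf e e0; have [d d0 hd] := cf (stop u w) e e0.
have [r r0 hr] := cpath_unif w d0.
have uv : u < u + r / 2 by rewrite ltrDl divr_gt0.
exists (u + r / 2) => //; apply: hd => t tT.
have v0 : 0 <= u + r / 2 by rewrite (le_trans u0)// ltW.
rewrite !stopE//; case/andP: tT => t0 tT; apply: hr.
- by rewrite le_min t0 u0 ge_min tT.
- by rewrite le_min t0 v0 ge_min tT.
rewrite !(minC t); apply: le_lt_trans (ler_dist_min _ _ _) _.
by rewrite opprD addrA subrr add0r normrN gtr0_norm ?divr_gt0//; lra.
Qed.

(* Continuity upgrades measurability with respect to the right-continuous
   filtration to invariance under stopping. *)
Lemma filt_plus_continuous_stop (W : normedModType R) (f : Omega -> W) u w :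
  0 <= u -> continuous f -> borel_measurable_for (filt_plus u) f ->
  f (stop u w) = f w.
Proof.
move=> u0 cf mf.
have fv v : u < v -> f (stop v w) = f w.
  move=> uv; have hB : filt_plus u (f @^-1` [set f w]).
    apply: borel_closed => //; apply: accessible_closed_set1.
    exact/hausdorff_accessible/(@norm_hausdorff _ W).
  apply/(filt_plus_agree (w := stop v w) (w' := w) uv hB) => // t tT tv.
  by rewrite stopE ?min_l// (le_trans u0)// ltW.
apply/eqP; rewrite -subr_eq0 -normr_le0; apply/ler_addgt0Pr => e e0.
rewrite add0r; have [v uv] := stop_cvg w u0 cf e0.
by rewrite (fv v uv) => /ltW.
Qed.

Hypothesis (sepH : separable H) (T0 : 0 < T).

(** A code p = (N, indices, m) describes the cell of paths that stay within 1 / (m+1) of prescribed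
    points [h i] near the grid times T i / N. Choosing one element in each nonempty cell avoids
    building explicit paths and showing that they lie in [Omega]. Two members of a cell are closer
    than e once 1 / (m+1) < e / 2. *)
Lemma Omega_separable : exists d : nat -> Omega, forall w (e : R), 0 < e ->
  exists i, forall t, 0 <= t <= T -> `|w t - d i t| < e.
Proof.
have [h hh] := separable_seq sepH.
pose near_ (p : nat * seq nat * nat) : set Omega := [set w | forall i s,
  (i <= p.1.1)%N -> 0 <= s <= T -> `|s - T * i%:R / p.1.1%:R| <= T / p.1.1%:R ->
  `|w s - h (nth 0 p.1.2 i)| < p.2.+1%:R^-1].
exists (fun n => if unpickle n is Some p then xget point (near_ p) else point) => w e e0.
have e20 : 0 < e / 2 by rewrite divr_gt0.
have [m _ /(_ m (leqnn m))/= hm] := near_infty_natSinv_lt (PosNum e20).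
have m20 : 0 < m.+1%:R^-1 / 2 :> R by rewrite divr_gt0.
have [d d0 hd] := cpath_unif w m20.
pose N := (Num.truncn (T / d)).+1.
have N0 : (0 : R) < N%:R by rewrite ltr0n.
have TN : T / N%:R < d.
  by rewrite ltr_pdivrMr// mulrC -ltr_pdivrMr// truncnS_gt.
have [c hc] := choice (fun i : nat => hh (w (T * i%:R / N%:R)) _ m20).
pose p := (N, mkseq c N.+1, m).
have wp : near_ p w.
  move=> i s /= iN sT si; rewrite nth_mkseq//.
  have iT : 0 <= T * i%:R / N%:R <= T.
    rewrite divr_ge0 ?mulr_ge0 ?(ltW T0)//= ler_pdivrMr// ler_pM2l//.
    by rewrite ler_nat.
  have h1 : `|w s - w (T * i%:R / N%:R)| < m.+1%:R^-1 / 2.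
    by apply: hd => //; exact: le_lt_trans TN.
  have := ler_distD (w (T * i%:R / N%:R)) (w s) (h (c i)); have := hc i.
  move: h1; move: (m.+1%:R^-1 : R) => a; lra.
exists (pickle p) => t tT; rewrite pickleK.
have hw' : near_ p (xget point (near_ p)) by apply: xgetPex; exists w.
set w' := xget _ _ in hw' *.
pose i := Num.truncn (t * N%:R / T); case/andP: (tT) => t0 tT'.
have /andP[i1 i2] : i%:R <= t * N%:R / T < i.+1%:R.
  by apply: truncn_itv; rewrite divr_ge0 ?mulr_ge0 ?(ltW T0)//.
have iN : (i <= N)%N.
  rewrite -(ler_nat R); apply: le_trans i1 _.
  by rewrite ler_pdivrMr// mulrC ler_pM2l.
have ti : `|t - T * i%:R / N%:R| <= T / N%:R.
  move: i1 i2; rewrite ler_pdivlMr// ltr_pdivrMr// -natr1 => i1 i2.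
  have -> : t - T * i%:R / N%:R = (t * N%:R - T * i%:R) / N%:R.
    by field; rewrite gt_eqF.
  rewrite ger0_norm ?divr_ge0 ?ler_pM2r ?invr_gt0 ?subr_ge0//; last by rewrite mulrC.
  by move: i1 i2; lra.
apply: (dist_lt_of_common (y := h (nth 0 p.1.2 i)) _ _ hm).
  exact/ltW/(wp i t iN tT ti).
exact/ltW/(hw' i t iN tT ti).
Qed.

Lemma filt_procS s u : 0 <= s <= T -> s <= u ->
  borel_measurable_for (filt u) (@procS R T H s).
Proof.
move=> /andP[s0 sT] su; apply: borel_of_open => [|U oU]; first exact: filt_sigma.
apply: sub_sigma_algebra; exists s; last by exists U.
by rewrite /= in_itv /= s0 le_min su.
Qed.

(** By separability an open set is a countable union of closed balls in the supremum norm, and by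
    continuity of paths a closed ball is a countable intersection of conditions at the clamped
    rational times [cl q]. After stopping, each condition involves the path at min ([cl q], u)
    only. *)
Lemma filt_open_stop u (O : set Omega) : 0 <= u -> open O -> filt u (stop u @^-1` O).
Proof.
move=> u0 oO; have [d hd] := Omega_separable.
pose cl (q : rat) : R := Num.max 0 (Num.min T (ratr q)).
have clT q : 0 <= cl q <= T by rewrite le_max lexx ge_max (ltW T0) ge_min lexx.
have cl_near t (e : R) : 0 <= t <= T -> 0 < e -> exists q, `|t - cl q| < e.
  move=> /andP[t0 tT] e0.
  have [|q] := @rat_in_itvoo R t (t + e); first by rewrite ltrDl.
  rewrite in_itv /= => /andP[tq qe]; exists q.
  have h1 : t <= cl q by rewrite /cl le_max le_min tT (ltW tq) orbT.
  have h2 : cl q < t + e by rewrite /cl gt_max gt_min qe orbT andbT ltr_wpDl.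
  by rewrite ler0_norm ?subr_le0// opprB; lra.
pose C i k q := [set w : Omega | `|d i (cl q) - w (Num.min (cl q) u)| <= k.+1%:R^-1].
have mC i k q : filt u (C i k q).
  have hm : borel_measurable_for (filt u) (@procS R T H (Num.min (cl q) u)).
    have /andP[q0 qT] := clT q; apply: filt_procS; last by rewrite ge_min lexx orbT.
    by rewrite le_min q0 u0 ge_min qT.
  apply: (borel_closed (U := closed_ball_ Num.Def.normr (d i (cl q)) k.+1%:R^-1) hm).
  exact: closed_closed_ball_.
have -> : stop u @^-1` O = \bigcup_i \bigcup_k ((\bigcap_q C i k q) `&` [set _ |
    forall w', (forall t, 0 <= t <= T -> `|d i t - w' t| <= k.+1%:R^-1) -> O w']).
  apply/seteqP; split=> w /=.
    move=> Ow; have /nbhs_OmegaP[e /= e0 he] : nbhs (stop u w) O by exact: open_nbhs_nbhs.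
    have e20 : 0 < e / 2 by rewrite divr_gt0.
    have [k _ /(_ k (leqnn k))/= hk] := near_infty_natSinv_lt (PosNum e20).
    have [i hi] := hd (stop u w) k.+1%:R^-1 (ltac:(by [])).
    exists i => //; exists k => //; split=> /= [q _ /=|w' hw'].
      by rewrite /C /= distrC -stopE//; apply/ltW/hi.
    apply: he => t tT; apply: (dist_lt_of_common (y := d i t) _ _ hk).
      exact/ltW/hi.
    by rewrite distrC; exact: hw'.
  move=> [i _ [k _ [/= hq]]]; apply => t tT; apply/ler_addgt0Pr => e e0.
  have e20 : 0 < e / 2 by rewrite divr_gt0.
  have [r1 r10 h1] := cpath_unif (d i) e20.
  have [r2 r20 h2] := cpath_unif (stop u w) e20.
  have [q] := cl_near t (Num.min r1 r2) tT (ltac:(by rewrite lt_min r10)).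
  rewrite lt_min => /andP[tq1 tq2].
  have a1 := h1 t (cl q) tT (clT q) tq1; have a2 := h2 t (cl q) tT (clT q) tq2.
  have a3 : `|d i (cl q) - stop u w (cl q)| <= k.+1%:R^-1 by rewrite stopE//; exact: hq.
  have := ler_distD (d i (cl q)) (d i t) (stop u w t).
  have := ler_distD (stop u w (cl q)) (d i (cl q)) (stop u w t).
  rewrite (distrC (stop u w (cl q))).
  move: a1 a2 a3; move: (k.+1%:R^-1 : R) => a; lra.
have [G0 _ GU] := filt_sigma u; apply: (GU) => i; apply: GU => k.
apply: (sigma_setI_prop _ (filt_sigma u)).
rewrite -[X in X _](sigma_algebra_id (filt_sigma u)) -[X in _ X]setCK setC_bigcap.
apply: (@measurableC _ (g_sigma_algebraType (filt u))).
apply: (@bigcupT_measurable_rat _ (g_sigma_algebraType (filt u))) => q.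
apply: (@measurableC _ (g_sigma_algebraType (filt u))).
by rewrite /measurable /= sigma_algebra_id//; exact: filt_sigma.
Qed.

(** Converse of [filt_plus_continuous_stop]: as f = f o stop u, preimages of open sets are preimages
    under [stop u]. Hence for continuous maps the raw and the right-continuous filtration give the
    same notion. *)
Lemma continuous_stop_borel {Y : topologicalType} (f : Omega -> Y) u : 0 <= u ->
  continuous f -> (forall w, f (stop u w) = f w) -> borel_measurable_for (filt u) f.
Proof.
move=> u0 cf fu; apply: borel_of_open => [|U oU]; first exact: filt_sigma.
rewrite (_ : f @^-1` U = stop u @^-1` (f @^-1` U)).
  by apply: filt_open_stop => //; apply: open_comp => // w _; exact: cf.
by apply/seteqP; split=> w /=; rewrite fu.
Qed.

End Filtrations.

(** Formulated for any process on any space, so as to serve [procS], [procSS], [A] and simple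
    integrals alike. *)
Definition unif_paths {R : realType} (T : R) {X : Type} {V : normedModType R}
    (N : R -> X -> V) : Prop :=
  forall (w : X) (e : R), 0 < e -> exists2 d : R, 0 < d &
    forall s t, 0 <= s <= T -> 0 <= t <= T -> `|s - t| < d -> `|N s w - N t w| < e.

Section MeasurableProcesses.
Context {R : realType} {X : pointedType} (G : set (set X)).
Hypothesis hG : sigma_algebra setT G.

Lemma rmeas_of_ge (f : X -> R) : (forall a : R, G [set w | a <= f w]) -> rmeas G f.
Proof.
move=> h; rewrite /rmeas; apply: (measurability _ (RGenCInfty.measurableE R)).
move=> _ [_ [a ->] <-]; rewrite setTI /measurable /= sigma_algebra_id//.
rewrite (_ : _ @^-1` _ = [set w | a <= f w]); first exact: h.
by apply/seteqP; split=> w /=; rewrite in_itv /= andbT.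
Qed.

Lemma sigma_bigcapT (A : nat -> set X) : (forall n, G (A n)) -> G (\bigcap_n A n).
Proof.
move=> hA; rewrite -(sigma_algebra_id hG).
apply: (@bigcapT_measurable _ (g_sigma_algebraType G)) => n.
by rewrite /measurable /= sigma_algebra_id.
Qed.

Lemma sigma_bigcupT_rat (A : rat -> set X) : (forall q, G (A q)) -> G (\bigcup_q A q).
Proof.
move=> hA; rewrite -(sigma_algebra_id hG).
apply: (@bigcupT_measurable_rat _ (g_sigma_algebraType G)) => n.
by rewrite /measurable /= sigma_algebra_id.
Qed.

Lemma sigma_setI (A B : set X) : G A -> G B -> G (A `&` B).
Proof.
move=> hA hB; rewrite -(sigma_algebra_id hG).
by apply: (@measurableI _ (g_sigma_algebraType G)); rewrite /measurable /= sigma_algebra_id.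
Qed.

Lemma sigma_setU (A B : set X) : G A -> G B -> G (A `|` B).
Proof.
move=> hA hB; rewrite -(sigma_algebra_id hG).
by apply: (@measurableU _ (g_sigma_algebraType G)); rewrite /measurable /= sigma_algebra_id.
Qed.

Lemma sigma_setC (A : set X) : G A -> G (~` A).
Proof. by move=> hA; have [_ GC _] := hG; rewrite -setTD; exact: GC. Qed.

Lemma sigma_setT : G setT.
Proof. by rewrite -setC0; apply: sigma_setC; case: hG. Qed.

Lemma rmeas_le_set (f g : X -> R) : rmeas G f -> rmeas G g -> G [set w | f w <= g w].
Proof.
move=> mf mg; have mB := measurable_funB mf mg.
have := rmeas_preimage hG mB (@measurable_itv R `]-oo, 0]); congr G.
by apply/seteqP; split=> w /=; rewrite in_itv /= subr_le0.
Qed.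

Lemma rmeas_lt_set (f g : X -> R) : rmeas G f -> rmeas G g -> G [set w | f w < g w].
Proof.
move=> mf mg; have := sigma_setC (rmeas_le_set mg mf); congr G.
by apply/seteqP; split=> w /=; rewrite ltNge; move/negP.
Qed.

Lemma rmeasD (f g : X -> R) : rmeas G f -> rmeas G g -> rmeas G (fun w => f w + g w).
Proof. exact: measurable_funD. Qed.

Lemma rmeasB (f g : X -> R) : rmeas G f -> rmeas G g -> rmeas G (fun w => f w - g w).
Proof. exact: measurable_funB. Qed.

Lemma rmeasM (f g : X -> R) : rmeas G f -> rmeas G g -> rmeas G (fun w => f w * g w).
Proof. exact: measurable_funM. Qed.

Lemma rmeas_cst (a : R) : rmeas G (fun=> a).
Proof. exact: measurable_cst. Qed.

Lemma rmeas_max (f g : X -> R) :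
  rmeas G f -> rmeas G g -> rmeas G (fun w => Num.max (f w) (g w)).
Proof. exact: measurable_maxr. Qed.

Lemma rmeas_min (f g : X -> R) :
  rmeas G f -> rmeas G g -> rmeas G (fun w => Num.min (f w) (g w)).
Proof. exact: measurable_minr. Qed.

Lemma rmeas_sum (f : nat -> X -> R) n : (forall i, rmeas G (f i)) ->
  rmeas G (fun w => \sum_(i < n) f i w).
Proof.
move=> mf; elim: n => [|n ih].
  by under eq_fun do rewrite big_ord0; exact: rmeas_cst.
by under eq_fun do rewrite big_ord_recr; exact: rmeasD.
Qed.

Lemma rmeas_cvg (h : nat -> X -> R) (f : X -> R) : (forall n, rmeas G (h n)) ->
  (forall w, h n w @[n --> \oo] --> f w) -> rmeas G f.
Proof. by move=> mh hf; exact: (measurable_fun_cvg mh). Qed.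

(** The random time is approximated from below by lattice points T k / (n+1). On each event where k
    is fixed the process is evaluated at a deterministic time, and uniform continuity of its paths
    gives convergence. *)
Lemma rmeas_eval_time (T : R) (Z : R -> X -> R) (a : X -> R) : 0 < T ->
  unif_paths T (Z : R -> X -> R^o) ->
  (forall t, 0 <= t <= T -> rmeas G (Z t)) -> rmeas G a ->
  (forall w, 0 <= a w <= T) -> rmeas G (fun w => Z (a w) w).
Proof.
move=> T0 uZ mZ ma aT.
pose k n w := Num.truncn (a w * n.+1%:R / T).
pose tm n i : R := T * i%:R / n.+1%:R.
have n0 n : 0 < n.+1%:R :> R by rewrite ltr0n.
have kP n w : (k n w)%:R <= a w * n.+1%:R / T < (k n w).+1%:R.
  apply: truncn_itv; have /andP[a0 _] := aT w.
  by rewrite divr_ge0 ?mulr_ge0 ?(ltW T0).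
have kn n w : (k n w <= n.+1)%N.
  rewrite -(ler_nat R); have /andP[k1 _] := kP n w; apply: le_trans k1 _.
  rewrite ler_pdivrMr// mulrC ler_pM2l//; by case/andP: (aT w).
have tmT n i : (i <= n.+1)%N -> 0 <= tm n i <= T.
  move=> iN; rewrite /tm divr_ge0 ?mulr_ge0 ?(ltW T0)//=.
  by rewrite ler_pdivrMr// ler_pM2l// ler_nat.
apply: (@rmeas_cvg (fun n w => Z (tm n (k n w)) w)) => [n|w].
  apply: rmeas_of_le => // c.
  have -> : [set w | Z (tm n (k n w)) w <= c] =
      \bigcup_i ([set w | Z (tm n i) w <= c] `&` [set w | k n w = i]).
    apply/seteqP; split=> w /=; first by exists (k n w).
    by move=> [i _ [/= + ki]]; rewrite ki.
  have [G0 _ GU] := hG; apply: GU => i.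
  have [iN|iN] := leqP i n.+1; last first.
    rewrite (_ : [set w | k n w = i] = set0) ?setI0//; apply/seteqP; split=> // w /= ki.
    by move: (kn n w); rewrite ki leqNgt iN.
  apply: sigma_setI.
    exact: (rmeas_le_set (mZ _ (tmT n i iN)) (measurable_cst c)).
  have -> : [set w | k n w = i] = a @^-1` `[(i%:R * T / n.+1%:R), (i.+1%:R * T / n.+1%:R)[%classic.
    apply/seteqP; split=> w /=; rewrite in_itv /= ler_pdivrMr// ltr_pdivlMr//.
      by move=> <-; have := kP n w; rewrite ler_pdivlMr// ltr_pdivrMr.
    by rewrite -ler_pdivlMr// -ltr_pdivrMr// => /truncn_def.
  by apply: rmeas_preimage => //; exact: measurable_itv.
apply/cvgrPdist_lt => e e0; have [d d0 hd] := uZ w e e0.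
have [N hN] : exists N : nat, T / d < N%:R.
  by exists (Num.truncn (T / d)).+1; rewrite truncnS_gt.
exists N => // n /= Nn; apply: hd; [exact: aT|exact: tmT|].
have /andP[k1 k2] := kP n w; move: k1 k2; rewrite ler_pdivlMr// ltr_pdivrMr// => k1 k2.
have -> : a w - tm n (k n w) = (a w * n.+1%:R - (k n w)%:R * T) / n.+1%:R.
  by rewrite /tm; field; rewrite gt_eqF.
rewrite ger0_norm ?divr_ge0 ?subr_ge0// ltr_pdivrMr//.
have : T < d * n.+1%:R.
  rewrite mulrC -ltr_pdivrMr//; apply: lt_le_trans hN _.
  by rewrite ler_nat (leq_trans Nn).
by move: k1 k2; rewrite -(natr1 (k n w)); move: ((k n w)%:R : R) (n.+1%:R : R) => u v; lra.
Qed.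

Context {V : hilbertType R} (sepV : separable V).

(** Weak measurability; on a separable Hilbert space it yields measurable norms and inner
    products. *)
Definition vmeas (Y : X -> V) : Prop := forall x, rmeas G (fun w => dot x (Y w)).

Lemma vmeasB (Y Z : X -> V) : vmeas Y -> vmeas Z -> vmeas (fun w => Y w - Z w).
Proof.
move=> mY mZ x; rewrite (_ : (fun w => _) = (fun w => dot x (Y w) - dot x (Z w))).
  exact: rmeasB.
by apply/funext => w; rewrite dotBr.
Qed.

Lemma vmeasD (Y Z : X -> V) : vmeas Y -> vmeas Z -> vmeas (fun w => Y w + Z w).
Proof.
move=> mY mZ x; rewrite (_ : (fun w => _) = (fun w => dot x (Y w) + dot x (Z w))).
  exact: rmeasD.
by apply/funext => w; rewrite dotDr.
Qed.

Lemma vmeas_norm (Y : X -> V) : vmeas Y -> rmeas G (fun w => `|Y w|).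
Proof.
move=> mY; have [h hh] := separable_seq sepV; apply: rmeas_of_le => // a.
have [a0|a0] := ltP a 0.
  rewrite (_ : [set w | _] = set0); first by case: hG.
  by apply/seteqP; split=> // w /=; rewrite leNgt (lt_le_trans a0).
have -> : [set w | `|Y w| <= a] = \bigcap_j [set w | `|dot (h j) (Y w)| <= a * `|h j|].
  apply/seteqP; split=> w /=.
    move=> ha j _ /=; apply: le_trans (dot_CauchySchwarz _ _) _.
    by rewrite mulrC ler_wpM2r.
  move=> hj; rewrite -riesz_norm; apply: (blin_norm_dense hh) => // j.
  by rewrite /= dotC; exact: hj.
apply: sigma_bigcapT => j; apply: rmeas_le_set; last exact: measurable_cst.
by apply: measurableT_comp; [exact: normr_measurable|exact: mY].
Qed.

Lemma vmeas_dot (Y Z : X -> V) : vmeas Y -> vmeas Z -> rmeas G (fun w => dot (Y w) (Z w)).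
Proof.
move=> mY mZ; rewrite (_ : (fun w => _) =
  (fun w => (`|Y w + Z w| ^+ 2 - `|Y w - Z w| ^+ 2) / 4)); last first.
  by apply/funext => w; rewrite dot_polarization.
apply: rmeasM; last exact: rmeas_cst.
by apply: rmeasB; apply: measurable_funX; apply: vmeas_norm;
  [exact: vmeasD|exact: vmeasB].
Qed.

(** The Riesz vectors of f are chosen without any care for measurability: tested against x they give
    [f w x], so they are weakly measurable by hypothesis. *)
Lemma vmeas_blin (f : X -> 'L(V, R^o)) (Y : X -> V) :
  (forall x, rmeas G (fun w => f w x)) -> vmeas Y -> rmeas G (fun w => f w (Y w)).
Proof.
move=> mf mY; have [v hv] := choice (fun w => riesz_representation (f w)).
rewrite (_ : (fun w => _) = (fun w => dot (v w) (Y w))).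
  apply: vmeas_dot => // x; have := mf x; congr rmeas; apply/funext => w.
  by rewrite hv /= dotC.
by apply/funext => w; rewrite hv.
Qed.

Lemma vmeas_eval_time (T : R) (Z : R -> X -> V) (a : X -> R) : 0 < T ->
  unif_paths T Z -> (forall t, 0 <= t <= T -> vmeas (Z t)) -> rmeas G a ->
  (forall w, 0 <= a w <= T) -> vmeas (fun w => Z (a w) w).
Proof.
move=> T0 uZ mZ ma aT x; apply: (@rmeas_eval_time T (fun t w => dot x (Z t w))) => //.
  move=> w e e0; have x0 : 0 < `|x| + 1 by rewrite ltr_wpDl.
  have [d d0 hd] := uZ w _ (divr_gt0 e0 x0); exists d => // s t sT tT st.
  rewrite -dotBr; apply: le_lt_trans (dot_CauchySchwarz _ _) _.
  apply: (@le_lt_trans _ _ ((`|x| + 1) * `|Z s w - Z t w|)).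
    by rewrite ler_wpM2r// lerDl.
  by rewrite mulrC -ltr_pdivlMr// hd.
by move=> t tT; exact: mZ.
Qed.

End MeasurableProcesses.

(** * Measurability of hitting times and of the quadratic variation *)

Section PathMeasurability.
Context {R : realType} {T : R} {H : hilbertType R}.
Hypotheses (sepH : separable H) (T0 : 0 < T).
Local Notation Omega := (Omega T H).
Local Notation FT := (@filt R T H T).

Let hFT : sigma_algebra setT FT := filt_sigma T.

Lemma procS_unif : unif_paths T (@procS R T H).
Proof. by move=> w e e0; have [d d0 hd] := cpath_unif w e0; exists d. Qed.

Lemma procS_vmeas t : 0 <= t <= T -> vmeas FT (@procS R T H t).
Proof.
move=> tT x; apply: borel_rmeas => //.
apply: (@borel_comp_continuous _ _ _ _ _ _ (procS t) (dot x : H -> R^o)) => //.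
  by apply: filt_procS => //; case/andP: tT.
exact: dot_continuous.
Qed.

(** With s the k-th time, [E y] is the event that the path has moved by 2^-m from its position at s
    at some time in [s, y]. The maximal displacement is attained, and by continuity rational times
    clamped to [s, y] by [tau] detect it up to 1 / (j+1). The next time is >= x iff [E] fails at all
    rationals below x. *)
Lemma qv_time_rmeas m k : rmeas FT (fun w : Omega => qv_time T m w k).
Proof.
elim: k => [|k ih]; first exact: rmeas_cst.
have sT (w : Omega) : 0 <= qv_time T m w k <= T by exact/qv_time_ge0_le/ltW.
pose tau (y : R) (q : rat) (w : Omega) := Num.max (qv_time T m w k) (Num.min y (ratr q)).
have tauT y q w : y <= T -> 0 <= tau y q w <= T.
  move=> yT; have /andP[s0 sT'] := sT w.
  by rewrite le_max s0 /= ge_max sT' ge_min yT.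
pose E (y : R) := [set w : Omega | qv_time T m w k <= y] `&` \bigcap_j \bigcup_q
  [set w : Omega | 2 ^- m - j.+1%:R^-1 < `|w (tau y q w) - w (qv_time T m w k)|].
have mE y : y <= T -> FT (E y).
  move=> yT; apply: (sigma_setI hFT).
    by apply: (rmeas_le_set hFT) => //; exact: rmeas_cst.
  apply: (sigma_bigcapT hFT) => j; apply: (sigma_bigcupT_rat hFT) => q.
  apply: (rmeas_lt_set hFT); first exact: rmeas_cst.
  apply: (vmeas_norm hFT sepH); apply: vmeasB.
    apply: (@vmeas_eval_time _ _ _ hFT _ T (@procS R T H)) => //.
    - exact: procS_unif.
    - exact: procS_vmeas.
    - apply: rmeas_max => //; exact: rmeas_cst.
    - by move=> w; exact: tauT.
  apply: (@vmeas_eval_time _ _ _ hFT _ T (@procS R T H)) => //.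
  - exact: procS_unif.
  - exact: procS_vmeas.
have EP y w : y <= T -> E y w <-> exists t, qv_time T m w k <= t <= y /\
    2 ^- m <= `|w t - w (qv_time T m w k)|.
  move=> yT; have /andP[s0 sT'] := sT w; set s := qv_time T m w k in s0 sT' *.
  split=> [[/= sy hE]|[t [/andP[st ty] ht]]].
    pose g t := `|w t - w s|.
    have cg : {within `[s, y], continuous g}.
      apply/subspace_continuousP => x; rewrite /= in_itv /= => /andP[sx xy].
      apply/cvgrPdist_lt => e e0; have [d d0 hd] := cpath_unif w e0.
      rewrite near_withinE; exists d => //= t; rewrite in_itv /= => xt /andP[st ty].
      rewrite /g; apply: le_lt_trans (ler_dist_dist _ _) _.
      rewrite opprB addrA subrK; apply: hd => //.
        by rewrite (le_trans s0)// (le_trans xy).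
      by rewrite (le_trans s0)// (le_trans ty).
    have [t + ht] := EVT_max sy cg; rewrite in_itv /= => tI.
    exists t; split=> //; rewrite -/(g t); apply/ler_addgt0Pr => e e0.
    have [j _ /(_ j (leqnn j))/= hj] := near_infty_natSinv_lt (PosNum e0).
    have [q _ /= hq] := hE j I.
    have : g (tau y q w) <= g t.
      by apply: ht; rewrite in_itv /= /tau -/s le_max lexx /= ge_max sy ge_min lexx.
    by move: hj hq; rewrite -/s /g; move: (j.+1%:R^-1 : R) => a; lra.
  split=> [|j _] /=; first exact: le_trans ty.
  have [d d0 hd] := cpath_unif w (ltac:(by []) : 0 < j.+1%:R^-1 :> R).
  have [|q] := @rat_in_itvoo R t (t + d); first by rewrite ltrDl.
  rewrite in_itv /= => /andP[tq qd]; exists q => //=.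
  have t1 : t <= tau y q w by rewrite /tau le_max le_min ty (ltW tq) orbT.
  have t2 : tau y q w < t + d.
    by rewrite /tau gt_max gt_min qd orbT andbT -/s (le_lt_trans st)// ltrDl.
  have := hd t (tau y q w) _ (tauT y q w yT).
  rewrite (le_trans s0 st) (le_trans ty yT) => /(_ isT).
  rewrite ler0_norm ?subr_le0// opprB ltrBlDl => /(_ t2) h.
  have := ler_distD (w (tau y q w)) (w t) (w s); rewrite -/s.
  by move: h ht; move: (j.+1%:R^-1 : R) => a; lra.
apply: (rmeas_of_ge hFT) => x; have [xT|Tx] := leP x T; last first.
  rewrite (_ : [set w | _] = set0); first by case: hFT.
  apply/seteqP; split=> // w xw; have /andP[_] := qv_time_ge0_le (ltW T0) m (w : Omega) k.+1.
  by rewrite leNgt (lt_le_trans Tx xw).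
rewrite (_ : [set w | _] = ~` \bigcup_(q : rat) (E (ratr q) `&` [set _ | ratr q < x])).
  apply: (sigma_setC hFT); apply: (sigma_bigcupT_rat hFT) => q.
  have [qx|qx] := ltP (ratr q) x.
    by apply: (sigma_setI_prop _ hFT); apply: mE; exact: ltW (lt_le_trans qx xT).
  rewrite (_ : E _ `&` _ = set0); first by case: hFT.
  by apply/seteqP; split=> // w [].
apply/seteqP; split=> w /=.
  move=> /(le_qv_timeS (ltW T0) _ _ _ xT) h [q _ [/EP + /= qx]].
  move=> /(_ (ltW (lt_le_trans qx xT)))[t [/andP[st tq] ht]].
  have := h t; rewrite st (le_trans tq (ltW (lt_le_trans qx xT))) => /(_ isT ht).
  by rewrite leNgt (le_lt_trans tq qx).
move=> h; apply/(le_qv_timeS (ltW T0) _ _ _ xT) => t /andP[st tT] ht.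
rewrite leNgt; apply/negP => tx; apply: h.
have [q] := @rat_in_itvoo R t x tx; rewrite in_itv /= => /andP[tq qx].
exists q => //; split=> //=; apply/EP; first exact: ltW (lt_le_trans qx xT).
by exists t; rewrite st (ltW tq).
Qed.

Lemma qv_sum_rmeas m t : 0 <= t <= T -> rmeas FT (fun w : Omega => qv_sum T w m t).
Proof.
move=> tT; pose g k (w : Omega) :=
  `|w (Num.min (qv_time T m w k.+1) t) - w (Num.min (qv_time T m w k) t)| ^+ 2.
apply: (@rmeas_cvg _ _ FT (fun n w => \sum_(k < n) g k w)) => [n|w].
  apply: rmeas_sum => k; apply: measurable_funX; apply: (vmeas_norm hFT sepH).
  have mS j : vmeas FT (fun w : Omega => w (Num.min (qv_time T m w j) t)).
    apply: (@vmeas_eval_time _ _ _ hFT _ T (@procS R T H)) => //.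
    - exact: procS_unif.
    - exact: procS_vmeas.
    - by apply: rmeas_min; [exact: qv_time_rmeas|exact: rmeas_cst].
    - move=> w; have /andP[s0 sT] := qv_time_ge0_le (ltW T0) m (w : Omega) j.
      by rewrite le_min s0 (andP tT).1 ge_min sT.
  exact: vmeasB.
have [K hK] := qv_time_eventually (ltW T0) m (w : Omega).
have tT' : t <= T by case/andP: tT.
rewrite (qv_sumE (ltW T0) hK tT'); apply: cvg_near_cst.
exists K => // n /= Kn; rewrite -!(big_mkord xpredT (g^~ w)) (big_cat_nat (leq0n K))//=.
rewrite [X in _ + X]big_nat_cond [X in _ + X]big1 ?addr0// => i /andP[/andP[Ki _] _].
have hT j : (K <= j)%N -> qv_time T m (w : Omega) j = T by exact: (qv_time_stays (ltW T0) hK).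
by rewrite /g !hT ?(leqW Ki)// subrr normr0 expr0n.
Qed.

Lemma qv_rmeas t : 0 <= t <= T -> rmeas FT (fun w : Omega => qv w t).
Proof.
move=> tT; apply: (@rmeas_cvg _ _ FT (fun m (w : Omega) => qv_sum T w m t)) => [m|w].
  exact: qv_sum_rmeas.
have [q [qE hq]] := Omega_qv w; rewrite qE//.
by apply/cvgrPdist_lt => e e0; have [N hN] := hq e e0; exists N => // m Nm; exact: hN.
Qed.

Lemma procSS_unif : unif_paths T (@procSS R T H).
Proof.
move=> w e e0; have [q [qE _]] := Omega_qv w.
have e40 : 0 < e / 2 by rewrite divr_gt0.
have [d1 d10 h1] := cpath_unif q e40.
have [M M0 hM] : exists2 M : R, 0 < M & forall t, 0 <= t <= T -> `|w t| <= M.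
  have cg : {within `[0, T], continuous (fun t => `|w t|)}.
    apply/subspace_continuousP => x; rewrite /= in_itv /= => xT.
    apply/cvgrPdist_lt => r r0; have [d d0 hd] := cpath_unif w r0.
    rewrite near_withinE; exists d => //= t; rewrite in_itv /= => xt tT.
    by apply: le_lt_trans (ler_dist_dist _ _) _; exact: hd.
  have [t _ ht] := EVT_max (ltW T0) cg.
  exists (`|w t| + 1); first by rewrite ltr_wpDl.
  by move=> s sT; rewrite (le_trans (ht s _)) ?in_itv// lerDl.
have [d2 d20 h2] := cpath_unif w (divr_gt0 e40 (mulr_gt0 (ltr0Sn R 1) M0)).
exists (Num.min d1 d2); first by rewrite lt_min d10.
move=> s t sT tT; rewrite lt_min => /andP[st1 st2]; rewrite /procSS !qE//.
have a1 := h1 s t sT tT st1; have a2 := h2 s t sT tT st2.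
have -> : `|w s| ^+ 2 - q s - (`|w t| ^+ 2 - q t) =
  (`|w s| - `|w t|) * (`|w s| + `|w t|) - (q s - q t) :> R by ring.
apply: le_lt_trans (ler_normB _ _) _.
have a3 : `|(`|w s| - `|w t|) * (`|w s| + `|w t|)| <= `|w s - w t| * (2 * M).
  rewrite normrM ler_pM//; first exact: ler_dist_dist.
  by rewrite ger0_norm ?addr_ge0// mulrDl mul1r lerD ?hM.
have a4 : `|w s - w t| * (2 * M) < e / 2 by rewrite -ltr_pdivlMr// mulr_gt0.
by move: a1 a3 a4; rewrite -[`|q s - q t|]/(`|(q s : R) - (q t : R)|); lra.
Qed.

Lemma procSS_vmeas t : 0 <= t <= T -> vmeas FT (@procSS R T H t).
Proof.
move=> tT x; apply: rmeasM; first exact: rmeas_cst.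
apply: rmeasB; last exact: qv_rmeas.
by apply: measurable_funX; apply: (vmeas_norm hFT sepH); exact: procS_vmeas.
Qed.

End PathMeasurability.

(** * Simple integrands *)

Section MergeTimes.
Context {R : realType} (T : R).
Implicit Types (a b : nat -> R).

Fixpoint running_min (s : nat -> R) (q : nat) : R :=
  if q is q'.+1 then Num.min (running_min s q') (s q) else s 0.

Lemma running_min_le s q i : (i <= q)%N -> running_min s q <= s i.
Proof.
elim: q => [|q ih] /=; first by rewrite leqn0 => /eqP ->.
by rewrite leq_eqVlt ltnS ge_min => /orP[/eqP ->|/ih ->//]; rewrite lexx orbT.
Qed.

Lemma running_min_attained s q : exists2 i, (i <= q)%N & running_min s q = s i.
Proof.
elim: q => [|q [i iq e]] /=; first by exists 0%N.
have [_|_] := leP (running_min s q) (s q.+1); last by exists q.+1.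
by exists i => //; rewrite leqW.
Qed.

(* The n-th order statistic of the union of the two sequences, the common time 0
   being counted once. *)
Definition merge_time a b n := running_min (fun i => Num.max (a i) (b (n - i)%N)) n.

Definition grid a := [/\ a 0 = 0, forall n, a n <= a n.+1 <= T & exists n, a n = T].

Lemma grid_homo a : grid a -> {homo a : m n / (m <= n)%N >-> m <= n}.
Proof. move=> [_ h _]; apply: homo_leq => [x|y x z|n]; [exact: lexx|exact: le_trans|].
by case/andP: (h n). Qed.

Lemma grid_bounds a n : grid a -> 0 <= a n <= T.
Proof.
move=> ga; have [a0 h _] := ga; rewrite -{1}a0 grid_homo//=.
by have /andP[/le_trans] := h n; apply.
Qed.

Lemma grid_end a m n : grid a -> a m = T -> (m <= n)%N -> a n = T.
Proof.
move=> ga am mn; apply/eqP; rewrite eq_le (andP (grid_bounds n ga)).2 /= -am.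
exact: grid_homo.
Qed.

Lemma grid_bracket a s : grid a -> 0 <= s < T -> exists i, a i <= s < a i.+1.
Proof.
move=> ga /andP[s0 sT]; have [a0 _ [N aN]] := ga.
have ex : exists n, s < a n by exists N; rewrite aN.
case: (ex_minnP ex) => -[|n]; first by rewrite a0 ltNge s0.
move=> sn mn; exists n; rewrite sn andbT leNgt; apply/negP => /mn.
by rewrite ltnn.
Qed.

Lemma grid_bracket_oc a s : grid a -> 0 < s <= T -> exists i, a i < s <= a i.+1.
Proof.
move=> ga /andP[s0 sT]; have [a0 _ [N aN]] := ga.
have ex : exists n, s <= a n by exists N; rewrite aN.
case: (ex_minnP ex) => -[|n]; first by rewrite a0 leNgt s0.
move=> sn mn; exists n; rewrite sn andbT ltNge; apply/negP => /mn.
by rewrite ltnn.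
Qed.

Lemma merge_time_le_max a b i j : merge_time a b (i + j) <= Num.max (a i) (b j).
Proof.
have := @running_min_le (fun k => Num.max (a k) (b (i + j - k)%N)) (i + j) i (leq_addr _ _).
by rewrite addKn.
Qed.

Lemma merge_time_attained a b n : exists i j, (i + j)%N = n /\
  merge_time a b n = Num.max (a i) (b j).
Proof.
have [i iN e] := running_min_attained (fun i => Num.max (a i) (b (n - i)%N)) n.
by exists i, (n - i)%N; rewrite subnKC.
Qed.

Lemma merge_timeC a b : merge_time a b = merge_time b a.
Proof.
suff h a' b' n : merge_time a' b' n <= merge_time b' a' n.
  by apply/funext => n; apply/eqP; rewrite eq_le !h.
have [i [j [<- ->]]] := merge_time_attained b' a' n.
by rewrite addnC maxC merge_time_le_max.
Qed.

Lemma merge_time_grid a b : grid a -> grid b -> grid (merge_time a b).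
Proof.
move=> ga gb; have [a0 _ [n an]] := ga; have [b0 _ [m bm]] := gb; split.
- by rewrite /merge_time /= a0 b0 maxxx.
- move=> k; have [i [j [ij e]]] := merge_time_attained a b k.+1.
  apply/andP; split; last first.
    by rewrite e ge_max (andP (grid_bounds i ga)).2 (andP (grid_bounds j gb)).2.
  rewrite e; case: i ij e => [|i] /= ij e.
    case: j ij e => [//|j] ij e; case: ij => <-.
    apply: le_trans (merge_time_le_max a b 0 j) _.
    by rewrite ge_max !le_max lexx/= (grid_homo gb) ?orbT.
  case: ij => <-; apply: le_trans (merge_time_le_max a b i j) _.
  by rewrite ge_max !le_max lexx/= (grid_homo ga) ?orbT.
exists (n + m)%N; have [i [j [ij ->]]] := merge_time_attained a b (n + m).
have [ni|/ltnW ni] := leqP n i.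
  by rewrite (grid_end ga an ni) max_l// (andP (grid_bounds j gb)).2.
have mj : (m <= j)%N by rewrite -(leq_add2l i) ij leq_add2r.
by rewrite (grid_end gb bm mj) max_r// (andP (grid_bounds i ga)).2.
Qed.

(** No time of a falls inside a cell of the merged grid. If the n-th merged time is max (a_i, b_j)
    with i + j = n and lies below a_k, then i < k, and the pair (i+1, j) bounds the next merged time
    by a_k. *)
Lemma merge_time_gap a b n k : grid a -> merge_time a b n < a k ->
  merge_time a b n.+1 <= a k.
Proof.
move=> ga; have [i [j [<- ->]]] := merge_time_attained a b n.
rewrite gt_max => /andP[aik bjk].
have ik : (i < k)%N.
  by rewrite ltnNge; apply/negP => /(grid_homo ga); rewrite leNgt aik.
rewrite -addSn; apply: le_trans (merge_time_le_max a b i.+1 j) _.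
by rewrite ge_max (grid_homo ga)//= ltW.
Qed.

End MergeTimes.

Section SimpleTheory.
Context {R : realType} {T : R} {H V W : normedModType R}.
Local Notation Omega := (Omega T H).
Local Notation simple := (@simple R T H V W).
Implicit Types (F G : simple) (N : R -> Omega -> V) (w : Omega).

Definition simple_grid F := forall w, grid T (stime F ^~ w).

Lemma in_Hs_grid F : in_Hs F -> simple_grid F.
Proof. by move=> [h1 h2 _ h4 _] w; split. Qed.

Lemma simple_int_sum F N t w M : simple_grid F -> stime F M w = T ->
  simple_int F N t w = \sum_(n < M) scoef F n w
    (N (Num.min (stime F n.+1 w) t) w - N (Num.min (stime F n w) t) w).
Proof.
move=> gF FM; apply: lim_series_eventually0 => k Mk.
by rewrite !(grid_end (gF w) FM) ?(leqW Mk)// subrr blin0.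
Qed.

(** Right-continuous companion of [simple_proc]: at the left endpoint of a cell it gives the
    coefficient in force just after that time, as needed when sums are taken over finer grids. *)
Definition simple_right F (s : R) w : 'L(V, W) :=
  limn (series (fun n => \1_`[stime F n w, stime F n.+1 w[ s *: scoef F n w)).

Lemma simple_single (D : nat -> set R) F (s : R) w i :
  (forall n, D n s -> n = i) ->
  limn (series (fun n => \1_(D n) s *: scoef F n w)) = \1_(D i) s *: scoef F i w.
Proof.
move=> Di; rewrite (@lim_series_eventually0 _ _ _ i.+1) => [|k ik].
  rewrite big_ord_recr /= big1 ?add0r// => -[j ji] _ /=.
  rewrite indicE memNset ?scale0r// => /Di ji'; move: ji; by rewrite ji' ltnn.
by rewrite indicE memNset ?scale0r// => /Di ki; move: ik; rewrite ki ltnn.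
Qed.

Lemma simple_rightE F s w i : simple_grid F ->
  stime F i w <= s < stime F i.+1 w -> simple_right F s w = scoef F i w.
Proof.
move=> gF /andP[is1 is2].
rewrite /simple_right (@simple_single (fun n => `[stime F n w, stime F n.+1 w[%classic) _ _ _ i).
  by rewrite indicE mem_set ?scale1r//= in_itv /= is1.
move=> n /=; rewrite in_itv /= => /andP[ns1 ns2]; apply/eqP; rewrite eqn_leq.
apply/andP; split; rewrite leqNgt; apply/negP => /(grid_homo (gF w)).
  by rewrite leNgt (le_lt_trans ns1).
by rewrite leNgt (le_lt_trans is1).
Qed.

Lemma simple_right_out F s w : simple_grid F -> ~ (0 <= s < T) ->
  simple_right F s w = 0.
Proof.
move=> gF h; rewrite /simple_right (@lim_series_eventually0 _ _ _ 0) ?big_ord0// => k _.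
rewrite indicE memNset ?scale0r//= in_itv /= => /andP[ks sk]; apply: h.
have /andP[k0 _] := grid_bounds k (gF w); have /andP[_ kT] := grid_bounds k.+1 (gF w).
by rewrite (le_trans k0)// (lt_le_trans sk).
Qed.

Lemma simple_procE F s w i : simple_grid F ->
  stime F i w < s <= stime F i.+1 w -> simple_proc F s w = scoef F i w.
Proof.
move=> gF /andP[is1 is2].
rewrite /simple_proc (@simple_single (fun n => `]stime F n w, stime F n.+1 w]%classic) _ _ _ i).
  by rewrite indicE mem_set ?scale1r//= in_itv /= is1.
move=> n /=; rewrite in_itv /= => /andP[ns1 ns2]; apply/eqP; rewrite eqn_leq.
apply/andP; split; rewrite leqNgt; apply/negP => /(grid_homo (gF w)).
  by rewrite leNgt (lt_le_trans ns1).
by rewrite leNgt (lt_le_trans is1).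
Qed.

Lemma simple_proc_out F s w : simple_grid F -> ~ (0 < s <= T) ->
  simple_proc F s w = 0.
Proof.
move=> gF h; rewrite /simple_proc (@lim_series_eventually0 _ _ _ 0) ?big_ord0// => k _.
rewrite indicE memNset ?scale0r//= in_itv /= => /andP[ks sk]; apply: h.
have /andP[k0 _] := grid_bounds k (gF w); have /andP[_ kT] := grid_bounds k.+1 (gF w).
by rewrite (le_lt_trans k0)// (le_trans sk).
Qed.

(** Both sides sum the terms [scoef F i w (br i n)], where [br i n] is the increment of N over the
    intersection of cell i of F with cell n of p. The gap hypothesis puts each cell of p inside one
    cell of F, so for fixed n one term survives; for fixed i the sum over n telescopes. *)
Lemma simple_int_refine F N t w (p : nat -> R) M : simple_grid F -> grid T p ->
  (forall n k, p n < stime F k w -> p n.+1 <= stime F k w) -> p M = T ->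
  \sum_(n < M) simple_right F (p n) w (N (Num.min (p n.+1) t) w - N (Num.min (p n) t) w)
  = simple_int F N t w.
Proof.
move=> gF gp gap pM; have gFw := gF w; have [F0 _ [A FA]] := gFw.
pose Z s := N (Num.min s t) w.
pose br i n := Z (Num.min (stime F i.+1 w) (p n.+1)) - Z (Num.min (stime F i.+1 w) (p n))
  - (Z (Num.min (stime F i w) (p n.+1)) - Z (Num.min (stime F i w) (p n))).
transitivity (\sum_(n < M) \sum_(i < A) scoef F i w (br i n)).
  apply: eq_bigr => -[n nM] _ /=.
  have pp : p n <= p n.+1 by apply: (grid_homo gp).
  move: (pp); rewrite le_eqVlt => /orP[/eqP pE|plt].
    by rewrite pE subrr blin0 big1// => i _; rewrite /br pE !subrr blin0.
  have pT : 0 <= p n < T.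
    have /andP[-> _] := grid_bounds n gp; have /andP[_] := grid_bounds n.+1 gp.
    exact: lt_le_trans.
  have [i /andP[i1 i2]] := grid_bracket gFw pT.
  have i3 := gap _ _ i2.
  have iA : (i < A)%N.
    rewrite ltnNge; apply/negP => Ai; move: i1; rewrite (grid_end gFw FA Ai).
    by rewrite leNgt; case/andP: pT => _ ->.
  rewrite (bigD1 (Ordinal iA))//= big1 ?addr0 => [|[j jA] /= ji].
    rewrite (simple_rightE gF (i := i)) ?i1//; congr (scoef F i w _).
    rewrite /br !(min_r (le_trans _ i3))// (min_l i1) (min_l (le_trans i1 pp)).
    by rewrite subrr subr0.
  have {}ji : j != i by move: ji; rewrite -val_eqE.
  move: ji; rewrite neq_ltn => /orP[ji|ij].
    have h1 : stime F j.+1 w <= p n by apply: le_trans i1; exact: grid_homo gFw _ _ ji.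
    have h0 : stime F j w <= p n by apply: le_trans i1; exact: grid_homo gFw _ _ (ltnW ji).
    by rewrite /br (min_l h1) (min_l h0) (min_l (le_trans h1 pp)) (min_l (le_trans h0 pp)) !subrr blin0.
  have h0 : p n.+1 <= stime F j w by apply: le_trans i3 _; exact: grid_homo gFw _ _ ij.
  have h1 : p n.+1 <= stime F j.+1 w.
    by apply: le_trans i3 _; exact: grid_homo gFw _ _ (leqW ij).
  by rewrite /br (min_r h1) (min_r h0) (min_r (le_trans pp h1)) (min_r (le_trans pp h0)) subrr blin0.
rewrite exchange_big (simple_int_sum N t gF FA) /=; apply: eq_bigr => -[i iA] _ /=.
rewrite -(big_mkord xpredT (fun n => scoef F i w (br i n))).
have tel m : \sum_(0 <= n < m) scoef F i w (br i n) = scoef F i w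
    (Z (Num.min (stime F i.+1 w) (p m)) - Z (Num.min (stime F i.+1 w) (p 0))
     - (Z (Num.min (stime F i w) (p m)) - Z (Num.min (stime F i w) (p 0)))).
  elim: m => [|m ih]; first by rewrite big_geq// !subrr blin0.
  rewrite big_nat_recr//= ih -blinD; congr (scoef F i w _); rewrite /br.
  have tri (x y z : V) : (x - z) + (y - x) = y - z by rewrite addrC addrA subrK.
  by rewrite addrACA tri -opprD tri.
rewrite tel pM; congr (scoef F i w _).
have [p0 _ _] := gp.
have /andP[i0 iT] := grid_bounds i gFw; have /andP[i0' iT'] := grid_bounds i.+1 gFw.
by rewrite p0 (min_l iT) (min_l iT') (min_r i0) (min_r i0') opprB addrA subrK.
Qed.

Lemma simple_proc_right F (p : nat -> R) n s w : simple_grid F -> grid T p ->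
  (forall n k, p n < stime F k w -> p n.+1 <= stime F k w) ->
  p n < s <= p n.+1 -> simple_proc F s w = simple_right F (p n) w.
Proof.
move=> gF gp gap /andP[ps sp].
have pT : 0 <= p n < T.
  have /andP[-> _] := grid_bounds n gp; have /andP[_] := grid_bounds n.+1 gp.
  by move=> /(le_trans sp)/(lt_le_trans ps).
have [i /andP[i1 i2]] := grid_bracket (gF w) pT.
rewrite (simple_rightE gF (i := i)) ?i1// (simple_procE gF (i := i))//.
by rewrite (le_lt_trans i1 ps) (le_trans sp (gap _ _ i2)).
Qed.

(** A single construction for linear combinations and for switching: the weights x and y may depend
    on the cell and on the path. *)
Definition combine F G (x y : nat -> Omega -> R) : simple :=
  let p n w := merge_time (stime F ^~ w) (stime G ^~ w) n in
  Simple p (fun n w => x n w *: simple_right F (p n w) w +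
                       y n w *: simple_right G (p n w) w).

Lemma combine_app F G x y n w d : scoef (combine F G x y) n w d =
  x n w *: simple_right F (stime (combine F G x y) n w) w d +
  y n w *: simple_right G (stime (combine F G x y) n w) w d.
Proof. by []. Qed.

Section Combine.
Variables (F G : simple) (x y : nat -> Omega -> R).
Hypotheses (gF : simple_grid F) (gG : simple_grid G).

Lemma combine_grid : simple_grid (combine F G x y).
Proof. by move=> w; exact: merge_time_grid. Qed.

Lemma combine_gapl n k w : stime (combine F G x y) n w < stime F k w ->
  stime (combine F G x y) n.+1 w <= stime F k w.
Proof. exact: merge_time_gap. Qed.

Lemma combine_gapr n k w : stime (combine F G x y) n w < stime G k w ->
  stime (combine F G x y) n.+1 w <= stime G k w.
Proof. by rewrite /= merge_timeC; exact: merge_time_gap. Qed.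

Lemma combine_int_cst N t w (a b : R) :
  (forall n, x n w = a) -> (forall n, y n w = b) ->
  simple_int (combine F G x y) N t w = a *: simple_int F N t w + b *: simple_int G N t w.
Proof.
move=> xa yb; have [_ _ [M hM]] := combine_grid w.
rewrite (simple_int_sum N t combine_grid hM).
rewrite -(simple_int_refine N t gF (combine_grid w) (fun n k => @combine_gapl n k w) hM).
rewrite -(simple_int_refine N t gG (combine_grid w) (fun n k => @combine_gapr n k w) hM).
rewrite !scaler_sumr -big_split /=; apply: eq_bigr => i _.
by rewrite xa yb.
Qed.

(** G has zero coefficients and only inserts u among the merged times. Each merged cell then lies on
    one side of u, with weight 1 before and b after. *)
Lemma combine_int_switch N t w (u b : R) :
  (exists k, stime G k w = u) -> (forall n w, scoef G n w = 0) ->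
  (forall n, x n w = if stime (combine F G x y) n w < u then 1 else b) ->
  simple_int (combine F G x y) N t w = simple_int F N (Num.min t u) w +
    b *: (simple_int F N t w - simple_int F N (Num.min t u) w).
Proof.
move=> [k Gk] G0 xb; have [_ _ [M hM]] := combine_grid w.
rewrite (simple_int_sum N t combine_grid hM).
have hF t' := simple_int_refine N t' gF (combine_grid w) (fun n k => @combine_gapl n k w) hM.
rewrite -!hF -sumrB scaler_sumr -big_split; apply: eq_bigr => o _; rewrite -[RHS]/(_ + _).
move: (nat_of_ord o) => n.
have rG s : simple_right G s w = 0.
  have [sT|] := pselect (0 <= s < T); last exact: simple_right_out.
  by have [i hi] := grid_bracket (gG w) sT; rewrite (simple_rightE gG hi).
rewrite combine_app rG blin_zeroE scaler0 addr0 xb; set p := stime (combine F G x y); case: ifPn => [pu|].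
  have pu' : p n.+1 w <= u by rewrite -Gk; apply: combine_gapr; rewrite Gk.
  rewrite scale1r !minA !(minAC _ t u) (min_l (ltW pu)) (min_l pu').
  by rewrite subrr scaler0 addr0.
rewrite -leNgt => up.
have up' : u <= p n.+1 w.
  by apply: le_trans up _; apply: (grid_homo (combine_grid w)).
by rewrite !minA !(minAC _ t u) (min_r up) (min_r up') subrr blin0 subr0 add0r.
Qed.

Lemma combine_proc s w (a b : R) : 
  (forall n, x n w = a) -> (forall n, y n w = b) ->
  simple_proc (combine F G x y) s w = a *: simple_proc F s w + b *: simple_proc G s w.
Proof.
move=> xa yb; have gC := combine_grid.
have [sT|sT] := pselect (0 < s <= T); last first.
  by rewrite !simple_proc_out// !scaler0 addr0.
have [n hn] := grid_bracket_oc (gC w) sT.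
rewrite (simple_procE gC hn) /= xa yb.
rewrite (simple_proc_right gF (gC w) (fun n k => @combine_gapl n k w) hn).
by rewrite (simple_proc_right gG (gC w) (fun n k => @combine_gapr n k w) hn).
Qed.

Lemma combine_proc_cut s w u : (exists k, stime G k w = u) ->
  (forall n w, scoef G n w = 0) ->
  (forall n, x n w = if stime (combine F G x y) n w < u then 1 else 0) ->
  simple_proc (combine F G x y) s w = if s <= u then simple_proc F s w else 0.
Proof.
move=> [k Gk] G0 xb; have gC := combine_grid.
have [sT|sT] := pselect (0 < s <= T); last by rewrite !simple_proc_out//; case: ifP.
have [n /[dup] hn /andP[n1 n2]] := grid_bracket_oc (gC w) sT.
rewrite (simple_procE gC hn) /= xb.
rewrite (simple_proc_right gF (gC w) (fun n k => @combine_gapl n k w) hn).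
have rG s' : simple_right G s' w = 0.
  have [sT'|] := pselect (0 <= s' < T); last exact: simple_right_out.
  by have [i hi] := grid_bracket (gG w) sT'; rewrite (simple_rightE gG hi).
rewrite rG scaler0 addr0; have [pu|up] := ltP (stime (combine F G x y) n w) u.
  rewrite scale1r (le_trans n2)// -Gk; apply: combine_gapr; by rewrite Gk.
by rewrite scale0r leNgt (le_lt_trans up).
Qed.

End Combine.

(** The integrand f 1_(u, v]. The times 0, u, v are continued by T, and cell number 1 is the only
    one with a nonzero coefficient. *)
Definition elementary (u v : R) (f : Omega -> 'L(V, W)) : simple :=
  Simple (fun n _ => nth T [:: 0; u; v] n) (fun n w => if n == 1%N then f w else 0).

Lemma elementary_grid u v f : 0 <= u -> u <= v <= T -> simple_grid (elementary u v f).
Proof.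
move=> u0 /andP[uv vT] w; split=> [//|[|[|[|n]]]|] /=.
- by rewrite u0 (le_trans uv).
- by rewrite uv.
- by rewrite vT lexx.
- by rewrite nth_nil lexx.
by exists 3%N.
Qed.

Lemma elementary_int u v f N t w : 0 <= u -> u <= v <= T ->
  simple_int (elementary u v f) N t w =
    f w (N (Num.min v t) w - N (Num.min u t) w).
Proof.
move=> u0 uv; rewrite (@simple_int_sum _ _ _ _ 3)//; last exact: elementary_grid.
rewrite (bigD1 (Ordinal (isT : (1 < 3)%N)))//= big1 ?addr0//.
by move=> [[|[|[|//]]]].
Qed.

Lemma elementary_proc u v f s w : 0 <= u -> u <= v <= T -> 
  simple_proc (elementary u v f) s w = if u < s <= v then f w else 0.
Proof.
move=> u0 uv; have gE := elementary_grid f u0 uv; case: ifPn => [suv|suv].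
  by rewrite (simple_procE gE (i := 1)).
have [sT|] := pselect (0 < s <= T); last exact: simple_proc_out.
have [n hn] := grid_bracket_oc (gE w) sT; rewrite (simple_procE gE hn) /=.
by case: eqP hn => // -> /=; rewrite (negbTE suv).
Qed.

End SimpleTheory.

(** * Stopping times and their sigma-algebras *)

Section StoppingTimes.
Context {R : realType} {T : R} {H : normedModType R}.
Local Notation Omega := (Omega T H).
Implicit Types (tau pi : Omega -> R) (B : set Omega).

Lemma stopping_time_cst u : stopping_time ((fun=> u) : Omega -> R).
Proof.
move=> t tT; have [ut|tu] := leP u t.
  by rewrite (_ : [set w | _] = setT); [exact: (sigma_setT (filt_plus_sigma t))|exact/seteqP].
rewrite (_ : [set w | _] = set0); first by case: (@filt_plus_sigma R T H t).
by apply/seteqP; split.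
Qed.

Lemma filt_stopped_sigma tau : stopping_time tau ->
  sigma_algebra setT (filt_stopped tau).
Proof.
move=> htau; split=> [|A [AT hA]|A hA].
- split; first by case: (@filt_sigma R T H T).
  by move=> t tT; rewrite set0I; case: (@filt_plus_sigma R T H t).
- split; first by have [_ GC _] := @filt_sigma R T H T; exact: GC.
  move=> t tT; rewrite (_ : _ `&` _ = [set w | tau w <= t] `&` ~` (A `&` [set w | tau w <= t])).
    have hs := @filt_plus_sigma R T H t.
    by apply: (sigma_setI hs); [exact: htau|apply: (sigma_setC hs); exact: hA].
  apply/seteqP; split=> w /=; first by move=> [[_ nA] tt]; split=> // -[].
  by move=> [tt nA]; split=> //; split=> // wA; apply: nA.
- split.
    by have [_ _ GU] := @filt_sigma R T H T; apply: GU => n; have [] := hA n.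
  move=> t tT; rewrite setI_bigcupl; have [_ _ GU] := @filt_plus_sigma R T H t.
  by apply: GU => n; have [_] := hA n; exact.
Qed.

Lemma filt_stopped_cst u B : 0 <= u -> filt u B -> filt_stopped (fun=> u) B.
Proof.
move=> u0 hB; split=> [|t tT]; first exact: filt_leT hB.
have [ut|tu] := leP u t.
  rewrite (_ : [set w | _] = setT) ?setIT; last exact/seteqP.
  by apply: filt_sub_plus; exact: filt_le hB.
rewrite (_ : [set w | _] = set0) ?setI0; last by apply/seteqP; split.
by case: (@filt_plus_sigma R T H t).
Qed.

Lemma filt_stopped_cst_plus u B : 0 <= u <= T -> filt_stopped (fun=> u) B -> filt_plus u B.
Proof.
move=> uT [_ /(_ u uT)]; rewrite (_ : [set w | _] = setT) ?setIT//.
by apply/seteqP; split=> w /=.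
Qed.

Lemma stopping_min_rmeas tau t : stopping_time tau -> (forall w, 0 <= tau w) ->
  0 <= t <= T -> rmeas (filt_plus t) (fun w => Num.min (tau w) t).
Proof.
move=> htau tau0 /andP[t0 tT]; apply: rmeas_of_le => [|a]; first exact: filt_plus_sigma.
have [ta|a_lt_t] := leP t a.
  rewrite (_ : [set w | _] = setT); first exact: (sigma_setT (filt_plus_sigma t)).
  by apply/seteqP; split=> w //= _; rewrite ge_min ta orbT.
rewrite (_ : [set w | _] = [set w | tau w <= a]).
  have [a0|a0] := leP 0 a.
    apply: (filt_plus_le (ltW a_lt_t)); apply: htau.
    by rewrite a0 (le_trans (ltW a_lt_t)).
  rewrite (_ : [set w | _] = set0); first by case: (@filt_plus_sigma R T H t).
  by apply/seteqP; split=> // w /=; rewrite leNgt (lt_le_trans a0).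
by apply/seteqP; split=> w /=; rewrite ge_min (leNgt t) a_lt_t orbF.
Qed.

Lemma stopping_rmeas tau : 0 < T -> stopping_time tau -> (forall w, 0 <= tau w <= T) ->
  rmeas (filt T) tau.
Proof.
move=> T0 htau tauT; rewrite (_ : tau = fun w => Num.min (tau w) T).
  apply: (rmeas_sub (filt_plus_sigma T) (filt_sigma T)); first exact: filt_plus_subT.
  by apply: stopping_min_rmeas => //; [move=> w; case/andP: (tauT w)|rewrite ltW//= lexx].
by apply/funext => w; rewrite min_l//; case/andP: (tauT w).
Qed.

(** On {pi <= t} both times may be truncated at t; the truncated times are measurable at t, so their
    comparison is an event of time t. *)
Lemma filt_stopped_le tau pi B : 0 < T -> stopping_time tau -> stopping_time pi ->
  (forall w, 0 <= tau w <= T) -> (forall w, 0 <= pi w <= T) ->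
  filt_stopped tau B -> filt_stopped pi (B `&` [set w | tau w <= pi w]).
Proof.
move=> T0 htau hpi tauT piT [BT hB].
have h t : 0 <= t <= T -> filt_plus t ((B `&` [set w | tau w <= pi w]) `&` [set w | pi w <= t]).
  move=> tT; rewrite (_ : _ `&` _ = (B `&` [set w | tau w <= t]) `&` [set w | pi w <= t] `&`
      [set w | Num.min (tau w) t <= Num.min (pi w) t]).
    have hs := @filt_plus_sigma R T H t.
    apply: (sigma_setI hs); first by apply: (sigma_setI hs); [exact: hB|exact: hpi].
    by apply: (rmeas_le_set hs); apply: stopping_min_rmeas => // w;
      [case/andP: (tauT w)|case/andP: (piT w)].
  apply/seteqP; split=> w /=.
    move=> [[Bw tp] pt]; have tt := le_trans tp pt.
    by rewrite !min_l.
  move=> [[[Bw tt] pt]]; rewrite !min_l//.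
split=> //; have := h T; rewrite ltW//= lexx => /(_ isT) /filt_plus_subT.
rewrite (_ : [set w | pi w <= T] = setT) ?setIT//.
by apply/seteqP; split=> w //= _; case/andP: (piT w).
Qed.

Lemma filt_stopped_comparison tau pi : 0 < T -> stopping_time tau -> stopping_time pi ->
  (forall w, 0 <= tau w <= T) -> (forall w, 0 <= pi w <= T) ->
  filt_stopped pi [set w | tau w <= pi w].
Proof.
move=> T0 htau hpi tauT piT; rewrite -[X in filt_stopped _ X]setTI.
by apply: filt_stopped_le => //; exact: (sigma_setT (filt_stopped_sigma htau)).
Qed.

Lemma merge_stopping (a b : nat -> Omega -> R) n :
  (forall k, stopping_time (a k)) -> (forall k, stopping_time (b k)) ->
  stopping_time (fun w => merge_time (a ^~ w) (b ^~ w) n).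
Proof.
move=> ha hb t tT; have hs := @filt_plus_sigma R T H t; rewrite /merge_time.
suff h q : filt_plus t [set w | running_min (fun i => Num.max (a i w) (b (n - i)%N w)) q <= t].
  exact: h.
have hm i j : filt_plus t [set w | Num.max (a i w) (b j w) <= t].
  rewrite (_ : [set w | _] = [set w | a i w <= t] `&` [set w | b j w <= t]).
    by apply: (sigma_setI hs); [exact: ha|exact: hb].
  by apply/seteqP; split=> w /=; rewrite ge_max => /andP.
elim: q => [|q ih] /=; first exact: hm.
rewrite (_ : [set w | _] = [set w | running_min (fun i => Num.max (a i w) (b (n - i)%N w)) q <= t]
  `|` [set w | Num.max (a q.+1 w) (b (n - q.+1)%N w) <= t]).
  exact: (sigma_setU hs).
by apply/seteqP; split=> w /=; rewrite ge_min => /orP.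
Qed.

End StoppingTimes.

Section SimpleMeasurability.
Context {R : realType} {T : R} {H : normedModType R} {V : hilbertType R}.
Hypotheses (T0 : 0 < T) (sepV : separable V).
Local Notation Omega := (Omega T H).
Local Notation simple := (@simple R T H V R^o).
Implicit Types (F G : simple).

Lemma stime_bounds (V' W' : normedModType R) (F : @Defs.simple R T H V' W') n w :
  in_Hs F -> 0 <= stime F n w <= T.
Proof. by move=> hF; exact: (grid_bounds n (in_Hs_grid hF w)). Qed.

(** On {stime i <= pi < stime (i+1)} the value is the i-th coefficient, known at [stime F i] and
    hence at pi. Off these events it is 0. *)
Lemma simple_right_rmeas F pi x : in_Hs F -> stopping_time pi ->
  (forall w, 0 <= pi w <= T) ->
  rmeas (filt_stopped pi) (fun w => simple_right F (pi w) w x).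
Proof.
move=> hF hpi piT; have [_ _ hst _ hco] := hF.
have tT i w := stime_bounds i w hF; have gF := in_Hs_grid hF.
have hs := filt_stopped_sigma hpi; apply: (rmeas_of_le hs) => a.
pose D i := [set w : Omega | stime F i w <= pi w < stime F i.+1 w].
have mD i : filt_stopped pi (D i).
  rewrite (_ : D i = [set w | stime F i w <= pi w] `&` ~` [set w | stime F i.+1 w <= pi w]).
    apply: (sigma_setI hs); first exact: filt_stopped_comparison.
    by apply: (sigma_setC hs); exact: filt_stopped_comparison.
  apply/seteqP; split=> w /=; first by move=> /andP[? ?]; split=> //; apply/negP; rewrite -ltNge.
  by rewrite /D /= => -[-> /negP]; rewrite -ltNge.
rewrite (_ : [set w | _] = (\bigcup_i (D i `&` [set w | scoef F i w x <= a])) `|`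
   ((~` \bigcup_i D i) `&` [set _ | 0 <= a])).
  have [_ _ GU] := hs; apply: (sigma_setU hs).
    apply: GU => i; rewrite (_ : _ `&` _ = D i `&` ([set w | scoef F i w x <= a] `&`
        [set w | stime F i w <= pi w])).
      apply: (sigma_setI hs) => //; apply: (filt_stopped_le (tau := stime F i)) => //.
      have hsi := filt_stopped_sigma (hst i).
      apply: (rmeas_le_set hsi); last exact: rmeas_cst.
      exact: (blin_app_rmeas _ hsi (hco i)).
    by apply/seteqP; split=> w /= [Dw]; [move=> ?; split=> //; split=> //; case/andP: Dw|move=> []].
  by apply: (sigma_setI_prop _ hs); apply: (sigma_setC hs); exact: GU.
apply/seteqP; split=> w /=.
  move=> ha; have [[i _ Di]|nD] := pselect ((\bigcup_i D i) w).
    by left; exists i => //; split=> //=; rewrite -(simple_rightE gF Di).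
  right; split=> //; move: ha; rewrite simple_right_out//.
  by move=> /(grid_bracket (gF w))[i Di]; apply: nD; exists i.
case=> [[i _ [Di /=]]|[nD /=]]; first by rewrite (simple_rightE gF Di).
move=> a0; rewrite simple_right_out//.
by move=> /(grid_bracket (gF w))[i Di]; apply: nD; exists i.
Qed.

Lemma combine_in_Hs F G (x y : nat -> Omega -> R) : in_Hs F -> in_Hs G ->
  (forall n, rmeas (filt_stopped (stime (combine F G x y) n)) (x n)) ->
  (forall n, rmeas (filt_stopped (stime (combine F G x y) n)) (y n)) ->
  in_Hs (combine F G x y).
Proof.
move=> hF hG mx my; have gC := combine_grid x y (in_Hs_grid hF) (in_Hs_grid hG).
have hst n : stopping_time (stime (combine F G x y) n).
  by have [_ _ hF' _ _] := hF; have [_ _ hG' _ _] := hG; apply: merge_stopping.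
split=> //.
- by move=> w; have [] := gC w.
- by move=> n w; have [] := gC w.
- by move=> w; have [] := gC w.
move=> n; have hs := filt_stopped_sigma (hst n).
apply: (blin_borel sepV hs) => z; set pn := stime (combine F G x y) n in hs *.
have pnT w : 0 <= pn w <= T by exact: grid_bounds (gC w).
have mF := simple_right_rmeas z hF (hst n) pnT.
have mG := simple_right_rmeas z hG (hst n) pnT.
rewrite (_ : (fun w => _) = (fun w => x n w * simple_right F (pn w) w z +
  y n w * simple_right G (pn w) w z)); last by apply/funext => w; rewrite combine_app.
exact: (rmeasD (rmeasM (mx n) mF) (rmeasM (my n) mG)).
Qed.

Lemma borel_cst {Y : topologicalType} (GG : set (set Omega)) (y : Y) :
  sigma_algebra setT GG -> borel_measurable_for GG (fun=> y).
Proof.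
move=> hs B _; have [yB|yB] := pselect (B y).
  by rewrite (_ : _ @^-1` _ = setT); [exact: (sigma_setT hs)|apply/seteqP; split].
by rewrite (_ : _ @^-1` _ = set0); [case: hs|apply/seteqP; split].
Qed.

Lemma elementary_in_Hs (V' W' : normedModType R) u v (f : Omega -> 'L(V', W')) :
  0 <= u -> u <= v <= T -> borel_measurable_for (filt u) f ->
  in_Hs (elementary u v f).
Proof.
move=> u0 uv mf; have gE := elementary_grid f u0 uv.
have v0 : 0 <= v by case/andP: uv => /(le_trans u0).
have hst n : stopping_time (stime (elementary u v f) n).
  exact: stopping_time_cst.
split=> //.
- by move=> n w; have [] := gE w.
- by move=> w; have [] := gE w.
move=> [|[|n]] /=.
- exact: (borel_cst _ (filt_stopped_sigma (hst 0))).
- by apply: borel_sub mf => B; exact: filt_stopped_cst.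
- exact: (borel_cst _ (filt_stopped_sigma (hst n.+2))).
Qed.

End SimpleMeasurability.

(** * Simple integrands with continuous coefficients *)

Section ContinuousSimple.
Context {R : realType} {T : R} {H : normedModType R} {V W : normedModType R}.
Hypotheses (T0 : 0 < T) (sepH : separable H).
Local Notation Omega := (Omega T H).
Local Notation simple := (@simple R T H V W).
Implicit Types (F G : simple).

(** For continuous maps, measurability at time u amounts to invariance under stopping at u. In this
    form no sigma-algebra appears, and the property passes to compositions with continuous maps. *)
Definition cadapted {Y : topologicalType} (u : R) (f : Omega -> Y) : Prop :=
  continuous f /\ forall w, f (stop u w) = f w.

Lemma cadapted_le {Y : topologicalType} u v (f : Omega -> Y) : 0 <= u -> u <= v ->
  cadapted u f -> cadapted v f.
Proof.
move=> u0 uv [cf fu]; split=> // w.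
by rewrite -fu stop_stop// ?(le_trans u0)// min_l.
Qed.

Lemma cadapted_borel {Y : topologicalType} u (f : Omega -> Y) : 0 <= u ->
  cadapted u f -> borel_measurable_for (filt u) f.
Proof. by move=> u0 [cf fu]; exact: continuous_stop_borel. Qed.

Lemma cadapted_stopped {Y : normedModType R} u (f : Omega -> Y) : 0 <= u <= T ->
  continuous f -> borel_measurable_for (filt_stopped (fun=> u)) f -> cadapted u f.
Proof.
move=> uT cf mf; split=> // w; apply: filt_plus_continuous_stop => //.
  by case/andP: uT.
by apply: borel_sub mf => B; exact: filt_stopped_cst_plus.
Qed.

(** Removes sigma-algebras from the class of continuous simple integrands; merging, cutting and the
    Euler coefficients are treated through this form. *)
Lemma in_HscP F : in_Hsc F <-> exists p : nat -> R, grid T p /\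
  forall n, (forall w, stime F n w = p n) /\ cadapted (p n) (scoef F n).
Proof.
split.
  move=> [hF det cF]; have [p hp] := choice det; exists p.
  have gp : grid T p.
    have := in_Hs_grid hF point; congr (grid T _); apply/funext => n; exact: hp.
  split=> // n; split=> //; apply: cadapted_stopped => //; first exact: grid_bounds gp.
  have [_ _ _ _ /(_ n)] := hF; congr (borel_measurable_for (filt_stopped _) _).
  by apply/funext => w; exact: hp.
move=> [p [gp hp]]; have gF : simple_grid F.
  by move=> w; rewrite (_ : (fun n => _) = p)//; apply/funext => n; have [] := hp n.
have Fp n : stime F n = fun=> p n by apply/funext => w; have [] := hp n.
have p0 n : 0 <= p n by case/andP: (grid_bounds n gp).
split; last 2 first.
- by move=> n; exists (p n); have [] := hp n.
- by move=> n; have [_ []] := hp n.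
split.
- by move=> w; have [] := gF w.
- by move=> n w; have [] := gF w.
- by move=> n; rewrite Fp; exact: stopping_time_cst.
- by move=> w; have [] := gF w.
move=> n; rewrite Fp; have [_ cn] := hp n.
apply: borel_sub (cadapted_borel (p0 n) cn) => B; exact: filt_stopped_cst.
Qed.

Lemma cadapted_cst {Y : topologicalType} u (y : Y) : cadapted u (fun=> y).
Proof. by split=> //; exact: cst_continuous. Qed.

Lemma continuousD_Omega {Y : normedModType R} (f g : Omega -> Y) :
  continuous f -> continuous g -> continuous (fun w => f w + g w).
Proof. by move=> cf cg w; exact: (@cvgD _ _ _ _ (nbhs_filter w) f g _ _ (cf w) (cg w)). Qed.

Lemma continuousZ_Omega {Y : normedModType R} (a : R) (f : Omega -> Y) :
  continuous f -> continuous (fun w => a *: f w).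
Proof. by move=> cf w; exact: (@cvgZl_tmp _ _ _ _ (nbhs_filter w) a f _ (cf w)). Qed.

Lemma continuous_blin_app {V' W' : normedModType R} (f : Omega -> 'L(V', W')) (g : Omega -> V') :
  continuous f -> continuous g -> continuous (fun w => f w (g w)).
Proof.
move=> cf cg w; apply/(@cvgrPdist_lt _ _ _ _ (nbhs_filter w)) => e e0.
pose M := `|f w| + `|g w| + 2; have M0 : 0 < M by rewrite ltr_wpDl// addr_ge0.
have d0 : 0 < Num.min 1 (e / M) by rewrite lt_min ltr01 divr_gt0.
have hf := (@cvgrPdist_lt _ _ _ _ (nbhs_filter w) _ _).1 (cf w) _ d0.
have hg := (@cvgrPdist_lt _ _ _ _ (nbhs_filter w) _ _).1 (cg w) _ d0.
apply: (@filterS2 _ _ (nbhs_filter w) _ _ _ _ hf hg) => w' /=.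
rewrite !lt_min => /andP[f1 f2] /andP[g1 g2].
have -> : f w (g w) - f w' (g w') = (f w - f w') (g w') + f w (g w - g w').
  by rewrite blin_subE blinB [RHS]addrC addrA subrK.
apply: le_lt_trans (ler_normD _ _) _.
apply: le_lt_trans (lerD (blin_norm_le _ _) (blin_norm_le _ _)) _.
have gw' : `|g w'| <= `|g w| + 1.
  rewrite -[g w'](subKr (g w)) (le_trans (ler_normB _ _))// lerD2l ltW//.
have h1 : `|f w - f w'| * `|g w'| <= (e / M) * (`|g w| + 1) by rewrite ler_pM// ltW.
have h2 : `|f w| * `|g w - g w'| <= `|f w| * (e / M) by rewrite ler_wpM2l// ltW.
apply: le_lt_trans (lerD h1 h2) _; rewrite (mulrC `|f w|) -mulrDr.
rewrite mulrAC ltr_pdivrMr// ltr_pM2l// /M.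
by move: (`|f w| : R) (`|g w| : R) => a b; lra.
Qed.

Lemma simple_right_cadapted F (p : nat -> R) s : grid T p ->
  (forall n, (forall w, stime F n w = p n) /\ cadapted (p n) (scoef F n)) ->
  cadapted s (simple_right F s).
Proof.
move=> gp hp; have gF : simple_grid F.
  by move=> w; rewrite (_ : (fun n => _) = p)//; apply/funext => n; have [] := hp n.
have [sT|sT] := pselect (0 <= s < T); last first.
  rewrite (_ : simple_right F s = fun=> 0); first exact: cadapted_cst.
  by apply/funext => w; rewrite simple_right_out.
have [i /andP[i1 i2]] := grid_bracket gp sT.
rewrite (_ : simple_right F s = scoef F i).
  apply: cadapted_le (hp i).2 => //; by case/andP: (grid_bounds i gp).
by apply/funext => w; rewrite (simple_rightE gF (i := i))// !(hp _).1 i1.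
Qed.

Lemma combine_in_Hsc F G (x y : nat -> Omega -> R) : in_Hsc F -> in_Hsc G ->
  (forall n, exists a, forall w, x n w = a) ->
  (forall n, exists a, forall w, y n w = a) ->
  in_Hsc (combine F G x y).
Proof.
move=> /in_HscP[p [gp hp]] /in_HscP[q [gq hq]] hx hy.
apply/in_HscP; exists (merge_time p q); split; first exact: merge_time_grid.
have tE n w : stime (combine F G x y) n w = merge_time p q n.
  by rewrite /=; congr (merge_time _ _ n); apply/funext => k; [exact: (hp k).1|exact: (hq k).1].
move=> n; split=> [w|]; first exact: tE.
have [a ha] := hx n; have [b hb] := hy n.
have -> : scoef (combine F G x y) n = fun w => a *: simple_right F (merge_time p q n) w +
    b *: simple_right G (merge_time p q n) w.
  by apply/funext => w; rewrite -(tE n w) -(ha w) -(hb w).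
have [cF sF] := simple_right_cadapted (merge_time p q n) gp hp.
have [cG sG] := simple_right_cadapted (merge_time p q n) gq hq.
split; first by apply: continuousD_Omega; exact: continuousZ_Omega.
by move=> w; rewrite sF sG.
Qed.

Lemma elementary_in_Hsc u v (f : Omega -> 'L(V, W)) :
  0 <= u -> u <= v <= T -> cadapted u f -> in_Hsc (elementary u v f).
Proof.
move=> u0 uv cf; apply/in_HscP; exists (nth T [:: 0; u; v]); split.
  exact: (elementary_grid f u0 uv point).
by move=> n; split=> // /=; case: eqP => [->//|_]; exact: cadapted_cst.
Qed.

Definition simple_sub F G := combine F G (fun _ _ => 1) (fun _ _ => -1).

Lemma simple_sub_in_Hsc F G : in_Hsc F -> in_Hsc G -> in_Hsc (simple_sub F G).
Proof. by move=> hF hG; apply: combine_in_Hsc => // n; [exists 1|exists (-1)]. Qed.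

Lemma simple_sub_int F G N t w : simple_grid F -> simple_grid G ->
  simple_int (simple_sub F G) N t w = simple_int F N t w - simple_int G N t w.
Proof. by move=> gF gG; rewrite (combine_int_cst gF gG N t (a := 1) (b := -1))// scale1r scaleN1r. Qed.

Lemma simple_sub_proc F G s w : simple_grid F -> simple_grid G ->
  simple_proc (simple_sub F G) s w = simple_proc F s w - simple_proc G s w.
Proof. by move=> gF gG; rewrite (combine_proc gF gG s (a := 1) (b := -1))// scale1r scaleN1r. Qed.

(** The integrand F 1_[0, u]; the elementary integrand with coefficient 0 serves to insert u into
    the grid. *)
Definition simple_cut (u : R) F := combine F (elementary u T (fun=> 0))
  (fun n w => if merge_time (stime F ^~ w) (nth T [:: 0; u; T]) n < u then 1 else 0)
  (fun _ _ => 0).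

Lemma simple_cut_in_Hsc u F : 0 <= u <= T -> in_Hsc F -> in_Hsc (simple_cut u F).
Proof.
move=> /andP[u0 uT] hF; have /in_HscP[p [gp hp]] := hF.
apply: combine_in_Hsc => // [|n|n]; last by exists 0.
  by apply: elementary_in_Hsc => //; [rewrite uT lexx|exact: cadapted_cst].
exists (if merge_time p (nth T [:: 0; u; T]) n < u then 1 else 0) => w.
by rewrite (_ : (fun n => stime F n w) = p)//; apply/funext => k; exact: (hp k).1.
Qed.

Lemma simple_cut_int u F N t w : 0 <= u <= T -> simple_grid F ->
  simple_int (simple_cut u F) N t w = simple_int F N (Num.min t u) w.
Proof.
move=> /andP[u0 uT] gF.
have gE : simple_grid (elementary u T (fun=> 0 : 'L(V, W)) : simple).
  by apply: elementary_grid => //; rewrite uT lexx.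
rewrite (combine_int_switch gF gE N t (u := u) (b := 0)) ?scale0r ?addr0//.
  by exists 1%N.
by move=> n w'; rewrite /=; case: ifP.
Qed.

Lemma simple_cut_proc u F s w : 0 <= u <= T -> simple_grid F ->
  simple_proc (simple_cut u F) s w = if s <= u then simple_proc F s w else 0.
Proof.
move=> /andP[u0 uT] gF.
have gE : simple_grid (elementary u T (fun=> 0 : 'L(V, W)) : simple).
  by apply: elementary_grid => //; rewrite uT lexx.
rewrite (combine_proc_cut gF gE s (u := u))//; first by exists 1%N.
by move=> n w'; rewrite /=; case: ifP.
Qed.

End ContinuousSimple.

(** * Gains and the outer expectation *)

Section Gains.
Context {R : realType} {T : R} {H : hilbertType R}.
Hypotheses (T0 : 0 < T) (sepH : separable H).
Local Notation Omega := (Omega T H).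

(** Galmarino's test: the events {tau <= a} with a < u are decided before u even for the
    right-continuous filtration, so w and its stopped path give the same value of tau below u. *)
Lemma stop_time_eq (tau : Omega -> R) u w : 0 <= u <= T -> stopping_time tau ->
  (forall w, 0 <= tau w) -> Num.min (tau (stop u w)) u = Num.min (tau w) u.
Proof.
move=> /andP[u0 uT] htau tau0.
have h a : a < u -> (tau (stop u w) <= a <-> tau w <= a).
  move=> au; have [a0|a0] := leP 0 a; last first.
    by split=> ta; have := le_lt_trans ta a0; rewrite ltNge tau0.
  apply: (filt_plus_agree au (htau a _)); first by rewrite a0 (le_trans (ltW au)).
  by move=> t tT tu; rewrite stopE// min_l.
have [t1|t1] := ltP (tau w) u.
  have t2 : tau (stop u w) <= tau w by apply/h.
  have t3 := le_lt_trans t2 t1.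
  have t4 : tau w <= tau (stop u w) by apply/h.
  by rewrite (min_l (ltW t3)); apply/eqP; rewrite eq_le t2.
rewrite min_r// leNgt; apply/negP => t2.
by have /(h _ t2) := lexx (tau (stop u w)); rewrite leNgt (lt_le_trans t2).
Qed.

(** The event {f = f w} intersected with {tau <= tau w} is known right after tau w < u, hence cannot
    separate w from [stop u w]. *)
Lemma stop_coef_eq {Y : normedModType R} (tau : Omega -> R) (f : Omega -> Y) u w :
  0 <= u <= T -> stopping_time tau -> (forall w, 0 <= tau w) ->
  borel_measurable_for (filt_stopped tau) f -> tau w < u -> f (stop u w) = f w.
Proof.
move=> /andP[u0 uT] htau tau0 mf tu.
have [_ /(_ (tau w))] : filt_stopped tau (f @^-1` [set f w]).
  apply: borel_closed => //; apply: accessible_closed_set1.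
  exact/hausdorff_accessible/(@norm_hausdorff _ Y).
rewrite tau0 (le_trans (ltW tu))// => /(_ isT) hB.
have : (f @^-1` [set f w] `&` [set w' | tau w' <= tau w]) (stop u w).
  apply/(filt_plus_agree (w := stop u w) (w' := w) tu hB); last by split=> /=.
  by move=> t tT tu'; rewrite stopE// min_l.
by case.
Qed.

(** Cells that start at or after u contribute nothing on either side; on the others neither the
    truncated times nor the coefficients change under stopping. *)
Lemma simple_int_stop {V : normedModType R} (F : @simple R T H V R^o)
    (N : R -> Omega -> V) u w : 0 <= u <= T -> in_Hs F ->
  (forall s, 0 <= s <= T -> N s (stop u w) = N (Num.min s u) w) ->
  simple_int F N T (stop u w) = simple_int F N u w.
Proof.
move=> uT hF hN; have gF := in_Hs_grid hF; have [_ _ hst _ hco] := hF.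
have [_ _ [M1 h1]] := gF w; have [_ _ [M2 h2]] := gF (stop u w).
have e1 := grid_end (gF w) h1 (leq_maxl M1 M2).
have e2 := grid_end (gF (stop u w)) h2 (leq_maxr M1 M2).
rewrite (simple_int_sum N T gF e2) (simple_int_sum N u gF e1).
apply: eq_bigr => -[n nM] _ /=.
have tT k w' := stime_bounds k w' hF.
have NE k : N (Num.min (stime F k (stop u w)) T) (stop u w) = N (Num.min (stime F k w) u) w.
  have /andP[t0 tT'] := tT k (stop u w).
  rewrite min_l// hN ?t0// stop_time_eq// => w'; by case/andP: (tT k w').
rewrite !NE; have [tu|ut] := ltP (stime F n w) u.
  by rewrite (stop_coef_eq uT (hst n) _ (hco n) tu)// => w'; case/andP: (tT n w').
have ut' : u <= stime F n.+1 w by apply: le_trans ut _; exact: (grid_homo (gF w)).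
by rewrite !min_r// subrr !blin0.
Qed.

Lemma filt_stop_preimage u (B : set Omega) : 0 <= u -> filt T B -> filt u (stop u @^-1` B).
Proof.
move=> u0; move: B; apply: (smallest_sub (X := [set B | filt u (stop u @^-1` B)])).
  have [G0 GC GU] := @filt_sigma R T H u; split=> [//|A hA|A hA] /=; first exact: GC.
  by rewrite preimage_bigcup; exact: GU.
move=> _ [s /= + [U oU <-]]; rewrite in_itv /= minxx => sT.
rewrite (_ : stop u @^-1` _ = procS (Num.min s u) @^-1` U).
  apply: borel_open => //; apply: filt_procS; last by rewrite ge_min lexx orbT.
  by case/andP: sT => s0 sT; rewrite le_min s0 u0 ge_min sT.
by apply/seteqP; split=> w /=; rewrite /procS stopE.
Qed.

Lemma simple_int_rmeas {V : hilbertType R} (F : @simple R T H V R^o)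
    (N : R -> Omega -> V) : separable V -> in_Hs F -> unif_paths T N ->
  (forall t, 0 <= t <= T -> vmeas (filt T) (N t)) ->
  rmeas (filt T) (simple_int F N T).
Proof.
move=> sepV hF uN mN; have [_ _ hst _ hco] := hF; have gF := in_Hs_grid hF.
have hFT := @filt_sigma R T H T.
pose g n w := scoef F n w (N (Num.min (stime F n.+1 w) T) w - N (Num.min (stime F n w) T) w).
apply: (@rmeas_cvg _ _ _ (fun k w => \sum_(n < k) g n w)) => [k|w].
  apply: rmeas_sum => n; apply: (vmeas_blin hFT sepV).
    move=> x; apply: (blin_app_rmeas _ hFT).
    by apply: borel_sub (hco n) => B; case.
  have mS k' : vmeas (filt T) (fun w => N (Num.min (stime F k' w) T) w).
    apply: (vmeas_eval_time hFT T0 uN mN).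
      apply: rmeas_min; last exact: rmeas_cst.
      by apply: stopping_rmeas => // w; exact: stime_bounds.
    move=> w; have /andP[t0 tT] := stime_bounds k' w hF.
    by rewrite le_min t0 (ltW T0) ge_min tT.
  exact: vmeasB.
have [_ _ [M hM]] := gF w; rewrite (simple_int_sum N T gF hM).
apply: cvg_near_cst; exists M => // k /= Mk.
rewrite -!(big_mkord xpredT (fun n => g n w)) (big_cat_nat (leq0n M))//=.
rewrite [X in _ + X]big_nat_cond [X in _ + X]big1 ?addr0// => i /andP[/andP[Mi _] _].
by rewrite /g !(grid_end (gF w) hM) ?(leqW Mi)// subrr blin0.
Qed.

Definition gain (V : R -> Omega -> R) : Prop :=
  exists (F : @simple R T H H R^o) (G : @simple R T H R^o R^o),
    [/\ in_Hs F, in_Hs G & forall w t, 0 <= t <= T ->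
      V t w = simple_int F (@procS R T H) t w + simple_int G (@procSS R T H) t w].

(** For the part against [procSS] the reason is that stopping commutes with the quadratic
    variation. *)
Lemma gain_stop V u w : gain V -> 0 <= u <= T -> V T (stop u w) = V u w.
Proof.
move=> [F [G [hF hG hV]]] uT; have u0 : 0 <= u by case/andP: uT.
have TT : 0 <= T <= T by rewrite ltW//= lexx.
rewrite (hV _ _ TT) (hV _ _ uT).
have hS s : 0 <= s <= T -> @procS R T H s (stop u w) = procS (Num.min s u) w.
  by move=> sT; rewrite /procS stopE.
have hSS s : 0 <= s <= T -> @procSS R T H s (stop u w) = procSS (Num.min s u) w.
  by move=> sT; rewrite /procSS qv_stop ?stopE.
by rewrite (simple_int_stop uT hF hS) (simple_int_stop uT hG hSS).
Qed.

(** V u is V T composed with [stop u], which pulls events of time T back to time u. This gives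
    measurability for the raw filtration, although the coefficients are adapted to the
    right-continuous one. *)
Lemma gain_rmeas V u : gain V -> 0 <= u <= T -> rmeas (filt u) (V u).
Proof.
move=> gV uT; have [F [G [hF hG hV]]] := gV; have u0 : 0 <= u by case/andP: uT.
have mT : rmeas (filt T) (V T).
  rewrite (_ : V T = fun w => simple_int F (@procS R T H) T w + simple_int G (@procSS R T H) T w).
    apply: rmeasD; apply: simple_int_rmeas => //.
    - exact: procS_unif.
    - by move=> t; exact: procS_vmeas.
    - exact: separable_regular.
    - exact: procSS_unif.
    - by move=> t; exact: procSS_vmeas.
  by apply/funext => w; rewrite hV// ltW//= lexx.
apply: (rmeas_of_le (filt_sigma u)) => a.
rewrite (_ : [set w | _] = stop u @^-1` [set w | V T w <= a]).
  apply: filt_stop_preimage => //; apply: (rmeas_le_set (filt_sigma T)) => //.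
  exact: rmeas_cst.
by apply/seteqP; split=> w /=; rewrite gain_stop.
Qed.

Lemma combine_cst_in_Hs {V : hilbertType R} (F G : @simple R T H V R^o) (a b : R) :
  separable V -> in_Hs F -> in_Hs G -> in_Hs (combine F G (fun _ _ => a) (fun _ _ => b)).
Proof. by move=> sV hF hG; apply: combine_in_Hs => // n; exact: rmeas_cst. Qed.

Lemma gain_lin V V' (a b : R) : gain V -> gain V' ->
  gain (fun t w => a * V t w + b * V' t w).
Proof.
move=> [F [G [hF hG hV]]] [F' [G' [hF' hG' hV']]].
exists (combine F F' (fun _ _ => a) (fun _ _ => b)),
  (combine G G' (fun _ _ => a) (fun _ _ => b)); split.
- exact: combine_cst_in_Hs.
- by apply: combine_cst_in_Hs => //; exact: separable_regular.
move=> w t tT; rewrite hV// hV'//.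
rewrite !(@combine_int_cst _ _ _ _ _ _ _ _ _ _ _ _ _ _ a b)//; try exact: in_Hs_grid.
rewrite -![_ *: _]/(_ * _).
move: (simple_int F _ t w : R) (simple_int G _ t w : R) (simple_int F' _ t w : R) (simple_int G' _ t w : R).
by move=> p q r s; rewrite -![(_ + _)%R in RHS]/((_ : R) + _); ring.
Qed.

Lemma gain_ext V V' : (forall t w, 0 <= t <= T -> V t w = V' t w) -> gain V -> gain V'.
Proof.
move=> VV' [F [G [hF hG hV]]]; exists F, G; split=> // w t tT.
by rewrite -VV'// hV.
Qed.

Lemma gain_elementaryS u v (f : Omega -> 'L(H, R^o)) : 0 <= u -> u <= v <= T ->
  (forall x, rmeas (filt u) (fun w => f w x)) ->
  gain (fun t w => f w (w (Num.min v t) - w (Num.min u t))).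
Proof.
move=> u0 uv mf; exists (elementary u v f), (elementary u v (fun=> 0)); split.
- by apply: elementary_in_Hs => //; apply: (blin_borel sepH (filt_sigma u)).
- by apply: elementary_in_Hs => //; exact: (borel_cst _ (filt_sigma u)).
by move=> w t tT; rewrite !elementary_int// blin_zeroE addr0.
Qed.

Definition scalar_blin (a : R) : 'L(R^o, R^o) := riesz (a : R^o).

Lemma gain_elementarySS u v (f : Omega -> R) : 0 <= u -> u <= v <= T ->
  rmeas (filt u) f ->
  gain (fun t w => f w * (procSS (Num.min v t) w - procSS (Num.min u t) w)).
Proof.
move=> u0 uv mf; exists (elementary u v (fun=> 0)), (elementary u v (fun w => scalar_blin (f w))); split.
- by apply: elementary_in_Hs => //; exact: (borel_cst _ (filt_sigma u)).
- apply: elementary_in_Hs => //; apply: (blin_borel separable_regular (filt_sigma u)) => x.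
  by apply: rmeasM => //; exact: rmeas_cst.
by move=> w t tT; rewrite !elementary_int// blin_zeroE add0r.
Qed.

Lemma gain0 : gain (fun _ _ => 0).
Proof.
apply: (@gain_ext (fun t w => 0 * (procSS (Num.min 0 t) w - procSS (Num.min 0 t) w))).
  by move=> t w _; rewrite mul0r.
by apply: gain_elementarySS => //; rewrite ?lexx ?ltW//; exact: rmeas_cst.
Qed.

Lemma gain_sum n (V : nat -> R -> Omega -> R) : (forall i, (i < n)%N -> gain (V i)) ->
  gain (fun t w => \sum_(i < n) V i t w).
Proof.
elim: n => [|n ih] hV; first by apply: gain_ext gain0 => t w _; rewrite big_ord0.
have h1 := ih (fun i ni => hV i (ltnW ni)).
apply: gain_ext (gain_lin 1 1 h1 (hV n (ltnSn n))) => t w _.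
by rewrite big_ord_recr /= !mul1r.
Qed.

Lemma rmeas_indic {X : pointedType} (G : set (set X)) (D : set X) :
  sigma_algebra setT G -> G D -> rmeas G (\1_D : X -> R).
Proof.
move=> hG GD; apply: measurable_indic.
by rewrite /measurable /= sigma_algebra_id.
Qed.

(** After u the position is kept on B and closed off B. The weight at a merged time p is 1 for p < u
    and the indicator of B for p >= u, and the latter is known at p because B is known at u. *)
Lemma simple_switch {V : hilbertType R} (F : @simple R T H V R^o) u (B : set Omega) :
  separable V -> in_Hs F -> 0 <= u <= T -> filt u B ->
  exists F', in_Hs F' /\ forall N t w, simple_int F' N t w =
    simple_int F N (Num.min t u) w + (\1_B w : R) *: (simple_int F N t w - simple_int F N (Num.min t u) w).
Proof.
move=> sV hF /andP[u0 uT] hB.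
pose E : @simple R T H V R^o := elementary u T (fun=> 0).
have uTT : u <= T <= T by rewrite uT lexx.
have hE : in_Hs E by apply: elementary_in_Hs => //; exact: (borel_cst _ (filt_sigma u)).
pose p n w := merge_time (stime F ^~ w) (stime E ^~ w) n.
have [_ _ hst _ _] := hF; have [_ _ hst' _ _] := hE.
have hp n : stopping_time (p n) by exact: merge_stopping.
have pT n w : 0 <= p n w <= T.
  by apply: grid_bounds; apply: merge_time_grid; [exact: (in_Hs_grid hF)|exact: (in_Hs_grid hE)].
pose x n w : R := if p n w < u then 1 else \1_B w.
have mx n : rmeas (filt_stopped (p n)) (x n).
  have hs := filt_stopped_sigma (hp n).
  rewrite (_ : x n = \1_(~` [set w | u <= p n w] `|` (B `&` [set w | u <= p n w]))).
    apply: (rmeas_indic hs); apply: (sigma_setU hs).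
      apply: (sigma_setC hs); apply: (filt_stopped_comparison (tau := fun=> u)) => //.
        exact: stopping_time_cst.
      by move=> _; rewrite u0.
    apply: (filt_stopped_le (tau := fun=> u)) => //.
    - exact: stopping_time_cst.
    - by move=> _; rewrite u0.
    - exact: filt_stopped_cst.
  apply/funext => w; rewrite /x !indicE; case: ifPn => pu.
    by rewrite mem_set//; left => /=; rewrite leNgt pu.
  rewrite -leNgt in pu; have [wB|wB] := pselect (B w).
    by rewrite !mem_set//; right.
  by rewrite [in RHS]memNset ?memNset// => -[//|[]].
exists (combine F E x (fun _ _ => 0)); split.
  by apply: combine_in_Hs => // n; exact: rmeas_cst.
move=> N t w; apply: (combine_int_switch (in_Hs_grid hF) (in_Hs_grid hE)) => //.
- by exists 1%N.
- by move=> n w'; rewrite /=; case: ifP.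
Qed.

Lemma simple_switch_scalar (F : @simple R T H R^o R^o) u (B : set Omega) :
  in_Hs F -> 0 <= u <= T -> filt u B ->
  exists F' : @simple R T H R^o R^o, in_Hs F' /\ forall N t w, simple_int F' N t w =
    simple_int F N (Num.min t u) w + (\1_B w : R) *: (simple_int F N t w - simple_int F N (Num.min t u) w).
Proof. exact: simple_switch separable_regular. Qed.

Lemma gain_switch V u (B : set Omega) : gain V -> 0 <= u <= T -> filt u B ->
  gain (fun t w => V (Num.min t u) w + \1_B w * (V t w - V (Num.min t u) w)).
Proof.
move=> [F [G [hF hG hV]]] uT hB.
have [F' [hF' F'E]] := simple_switch sepH hF uT hB.
have [G' [hG' G'E]] := simple_switch_scalar hG uT hB.
exists F', G'; split; [exact: hF'|exact: hG'|move=> w t tT].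
have mT : 0 <= Num.min t u <= T.
  by case/andP: uT => u0 _; case/andP: tT => t0 tT; rewrite le_min t0 u0 ge_min tT.
rewrite (hV _ _ tT) (hV _ _ mT) (F'E (@procS R T H)) (G'E (@procSS R T H)).
rewrite -![_ *: _]/(_ * _).
move: (simple_int F _ t w : R) (simple_int G _ t w : R) (simple_int F _ _ w : R) (simple_int G _ _ w : R).
by move=> p q r s; rewrite -![(_ + _)%R in RHS]/((_ : R) + _); ring.
Qed.

End Gains.

Section ExtendedReals.
Context {R : realType}.
Local Open Scope ereal_scope.
Implicit Types (x y : \bar R).

Lemma le_of_lt_fin x y : (forall a : R, a%:E < x -> a%:E <= y) -> x <= y.
Proof.
move=> h; rewrite leNgt; apply/negP => yx.
move: y x yx h => [s| |] [r| |]//= yx h.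
- rewrite lte_fin in yx; have hm : ((r + s) / 2)%:E < r%:E by rewrite lte_fin; lra.
  by have := h _ hm; rewrite lee_fin; lra.
- by have := h (s + 1)%R (ltry _); rewrite lee_fin; lra.
- by have := h (r - 1)%R; rewrite lte_fin ltrBlDr ltrDl ltr01 => /(_ isT).
- by have := h 0%R (ltry _).
Qed.

Lemma le_of_gt_fin x y : (forall a : R, y < a%:E -> x <= a%:E) -> x <= y.
Proof.
move=> h; rewrite -leeN2; apply: le_of_lt_fin => a ha.
by rewrite leeNr; apply: h; rewrite EFinN lteNr.
Qed.

(** Domination by a lower limit becomes an eventual inequality at each real level below x, where x
    may be infinite. Sums of strategies are then handled without arithmetic of lower limits. *)
Lemma le_limn_einfP x (u : nat -> R) (l : R) :
  x <= l%:E + limn_einf (fun k => (u k)%:E) <->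
  forall a : R, a%:E < x -> \forall k \near \oo, (a <= l + u k)%R.
Proof.
have -> : limn_einf (fun k => (u k)%:E) = limf_einf (fun k => (u k)%:E) \oo by [].
rewrite limf_einfE; split=> [h a ax|h].
  have /ereal_sup_gt[_ [A hA <-] hu] : (a - l)%:E < ereal_sup
      [set ereal_inf [set (u k)%:E | k in A] | A in \oo].
    by have := lt_le_trans ax h; rewrite -lteBlDl// EFinB.
  apply: filterS hA => k Ak; rewrite -lerBlDl -lee_fin.
  by apply: le_trans (ltW hu) _; apply: ereal_inf_lbound; exists k.
apply: le_of_lt_fin => a ax; rewrite -leeBlDl// -EFinB.
apply: (@le_trans _ _ (ereal_inf [set (u k)%:E | k in [set k | (a <= l + u k)%R]])).
  by apply: le_ereal_inf_tmp => _ [k /= hk <-]; rewrite lee_fin lerBlDl.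
apply: ereal_sup_ubound; exists [set k | (a <= l + u k)%R] => //; exact: h.
Qed.

(** A level below x + y is split into a level for x and one for y; if one of them is infinite, the
    other gets level 0, where nonnegativity suffices. *)
Lemma near_split_lt x y (u v : nat -> R) : 0 <= x -> 0 <= y ->
  (forall k, (0 <= u k)%R) -> (forall k, (0 <= v k)%R) ->
  (forall a : R, a%:E < x -> \forall k \near \oo, (a <= u k)%R) ->
  (forall a : R, a%:E < y -> \forall k \near \oo, (a <= v k)%R) ->
  forall a : R, a%:E < x + y -> \forall k \near \oo, (a <= u k + v k)%R.
Proof.
move=> x0 y0 u0 v0 hu hv a axy.
suff [b [c [abc hb hc]]] : exists b c : R, [/\ (a <= b + c)%R,
    \forall k \near \oo, (b <= u k)%R & \forall k \near \oo, (c <= v k)%R].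
  apply: filterS2 hb hc => k h1 h2; apply: le_trans abc _; exact: lerD.
move: x y x0 y0 hu hv axy => [x| |] [y| |]//= x0 y0 hu hv axy.
- exists (x - (x + y - a) / 2)%R, (y - (x + y - a) / 2)%R; rewrite -EFinD lte_fin in axy.
  by split; [lra|apply: hu; rewrite lte_fin; lra|apply: hv; rewrite lte_fin; lra].
- by exists 0%R, a; split; [rewrite add0r|exact: nearW|apply: hv; rewrite ltry].
- by exists a, 0%R; split; [rewrite addr0|apply: hu; rewrite ltry|exact: nearW].
- by exists a, 0%R; split; [rewrite addr0|apply: hu; rewrite ltry|exact: nearW].
Qed.

Lemma near_sum_lt (x : nat -> \bar R) (u : nat -> nat -> R) :
  (forall n, 0 <= x n) -> (forall n k, (0 <= u n k)%R) ->
  (forall n (a : R), a%:E < x n -> \forall k \near \oo, (a <= u n k)%R) ->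
  forall N (a : R), a%:E < \sum_(n < N) x n ->
    \forall k \near \oo, (a <= \sum_(n < N) u n k)%R.
Proof.
move=> x0 u0 hu; elim=> [|N ih] a.
  rewrite big_ord0 lte_fin => a0; apply: nearW => k; rewrite big_ord0; exact: ltW.
rewrite big_ord_recr /= => ha.
have := @near_split_lt (\sum_(n < N) x n) (x N) (fun k => \sum_(n < N) u n k)%R (u N).
move=> /(_ _ _ _ _ _ _ a ha) h.
under eq_near => k do rewrite big_ord_recr /=.
by apply: h => //; [exact: sume_ge0|move=> k; exact: sumr_ge0|exact: hu].
Qed.

Lemma sum_half_powers (e : R) N : (0 <= e -> \sum_(n < N) e / 2 ^+ n.+1 <= e)%R.
Proof.
move=> e0; suff -> : (\sum_(n < N) e / 2 ^+ n.+1 = e - e / 2 ^+ N)%R.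
  by rewrite gerBl divr_ge0// exprn_ge0.
elim: N => [|N ih]; first by rewrite big_ord0 expr0 divr1 subrr.
rewrite big_ord_recr ih /= !exprS; field.
by rewrite expf_neq0.
Qed.

End ExtendedReals.

(** * Superhedging and subadditivity *)

Section OuterExpectation.
Context {R : realType} {T : R} {H : hilbertType R}.
Hypotheses (T0 : 0 < T) (sepH : separable H).
Local Notation Omega := (Omega T H).
Context (P : set Omega).
Local Notation E := (outer_E P).

(** Superhedging from capital l, in terms of gains and with the lower limit in the form of
    [le_limn_einfP]. *)
Definition hedges (l : R) (V : nat -> R -> Omega -> R) (X : Omega -> \bar R) : Prop :=
  [/\ 0 <= l, forall k, gain (V k),
      forall w k t, P w -> 0 <= t <= T -> 0 <= l + V k t w &
      forall w, P w -> forall a : R, (a%:E < X w)%E ->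
        \forall k \near \oo, a <= l + V k T w].

Lemma outer_E_ge0 X : (0 <= E X)%E.
Proof. by apply: le_ereal_inf_tmp => _ [l [l0 _] <-]; rewrite lee_fin. Qed.

Lemma hedges_outer_E l V X : hedges l V X -> (E X <= l%:E)%E.
Proof.
move=> [l0 gV hV hX]; apply: ereal_inf_lbound; exists l => //; split=> //.
have [F hF] := choice gV; have [G hG] := choice hF.
have TT : 0 <= T <= T by rewrite ltW//= lexx.
exists F, G; split=> [n|n|w n t Pw tT|w Pw].
- by have [] := hG n.
- by have [] := hG n.
- by rewrite -addrA; have [_ _ <-//] := hG n; exact: hV.
apply/le_limn_einfP => a /hX - /(_ Pw); apply: filterS => k.
by have [_ _ <-] := hG k.
Qed.

Lemma outer_E_hedges X l : (E X < l%:E)%E -> exists l', l' < l /\ exists V, hedges l' V X.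
Proof.
move=> /ereal_inf_lt[_ [l' [l0 [F [G [hF hG adm lim]]]] <-]]; rewrite lte_fin => l'l.
exists l'; split=> //.
exists (fun k t w => simple_int (F k) (@procS R T H) t w + simple_int (G k) (@procSS R T H) t w).
split=> //.
- by move=> k; exists (F k), (G k).
- by move=> w k t Pw tT; rewrite addrA; exact: adm.
by move=> w Pw; apply/le_limn_einfP; exact: lim.
Qed.

Lemma outer_E_le X Y : (forall w, P w -> (X w <= Y w)%E) -> (E X <= E Y)%E.
Proof.
move=> XY; apply: le_of_gt_fin => l /outer_E_hedges[l' [l'l [V [l0 gV hV hY]]]].
apply: (@le_trans _ _ l'%:E); last by rewrite lee_fin ltW.
apply: (@hedges_outer_E _ V); split=> // w Pw a aX; apply: hY => //.
exact: lt_le_trans (XY w Pw).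
Qed.

Lemma outer_E_le_cst X (a : R) : 0 <= a -> (forall w, P w -> (X w <= a%:E)%E) -> (E X <= a%:E)%E.
Proof.
move=> a0 Xa; apply: (@hedges_outer_E a (fun _ _ _ => 0)); split=> //.
- by move=> _; exact: gain0.
- by move=> *; rewrite addr0.
move=> w Pw b /lt_le_trans/(_ (Xa w Pw)); rewrite lte_fin => ba.
by apply: nearW => k; rewrite addr0 ltW.
Qed.

Lemma outer_E0 X : (forall w, P w -> (X w <= 0)%E) -> E X = 0%E.
Proof. by move=> X0; apply/eqP; rewrite eq_le outer_E_ge0 andbT; exact: outer_E_le_cst. Qed.

Lemma outer_E_scale (a : R) X : 0 <= a -> (forall w, P w -> (0 <= X w)%E) ->
  (E (fun w => a%:E * X w) <= a%:E * E X)%E.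
Proof.
rewrite le_eqVlt => /orP[/eqP <-|a0] X0.
  by rewrite outer_E0 ?mul0e// => w _; rewrite mul0e.
apply: le_of_gt_fin => l; rewrite -lte_pdivlMl// => /outer_E_hedges[l' [l'l [V [l0 gV hV hX]]]].
apply: (@le_trans _ _ (a * l')%:E); last first.
  by rewrite lee_fin ltW// -ltr_pdivlMl.
apply: (@hedges_outer_E _ (fun k t w => a * V k t w)); split=> //.
- by rewrite mulr_ge0// ltW.
- move=> k; apply: (gain_ext _ (gain_lin T0 sepH a 0 (gV k) (gV k))) => t w _.
  by rewrite mul0r addr0.
- by move=> w k t Pw tT; rewrite -mulrDr mulr_ge0 ?hV// ltW.
move=> w Pw b; rewrite -lte_pdivrMl// => /hX - /(_ Pw); apply: filterS => k.
by rewrite -mulrDr ler_pdivrMl.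
Qed.

(** The n-th claim is hedged from capital E (Xn n) + e / 2^(n+1), where e is the slack between a and
    the sum of the expectations. A level below the series is already below a partial sum, so only
    finitely many hedges matter for it; the others are nonnegative together with their capital. *)
Lemma outer_E_sigma_subadditive X (Xn : nat -> Omega -> \bar R) :
  (forall n w, P w -> (0 <= Xn n w)%E) ->
  (forall w, P w -> (X w <= \sum_(n <oo) Xn n w)%E) ->
  (E X <= \sum_(n <oo) E (Xn n))%E.
Proof.
move=> X0 hX; apply: le_of_gt_fin => a ha.
have E0 n : (0 <= E (Xn n))%E by exact: outer_E_ge0.
have le_sum N : (\sum_(n < N) E (Xn n) <= \sum_(n <oo) E (Xn n))%E.
  by rewrite -(big_mkord xpredT (fun n => E (Xn n))); exact: nneseries_lim_ge.
have fin n : E (Xn n) \is a fin_num.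
  rewrite ge0_fin_numE//; apply: le_lt_trans (lt_trans ha (ltry _)).
  by apply: le_trans (le_sum n.+1); rewrite big_ord_recr /= leeDr// sume_ge0.
have S0 : (0 <= \sum_(n <oo) E (Xn n))%E by exact: nneseries_ge0.
have Sfin : (\sum_(n <oo) E (Xn n))%E \is a fin_num.
  by rewrite ge0_fin_numE//; exact: lt_trans ha (ltry _).
pose e := a - fine (\sum_(n <oo) E (Xn n))%E.
have e0 : 0 < e by rewrite subr_gt0 -lte_fin fineK.
pose l n := fine (E (Xn n)) + e / 2 ^+ n.+1.
have El n : (E (Xn n) < (l n)%:E)%E.
  by rewrite /l EFinD fineK// lteDl// lte_fin divr_gt0// exprn_gt0.
have /choice[V hV] n : exists V, hedges (l n) V (Xn n).
  have [l' [l'l [V [l0 gV hV hXn]]]] := outer_E_hedges (El n).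
  exists V; split=> // [|w k t Pw tT|w Pw b bX].
  - exact: le_trans l0 (ltW l'l).
  - by apply: le_trans (hV w k t Pw tT) _; rewrite lerD2r ltW.
  - by apply: filterS (hXn w Pw b bX) => k /le_trans; apply; rewrite lerD2r ltW.
have suml N : \sum_(n < N) l n <= a.
  rewrite big_split /= -lerBrDl.
  apply: le_trans (sum_half_powers N (ltW e0)) _; rewrite /e lerD2l lerN2.
  rewrite -lee_fin fineK// -sumEFin (eq_bigr (fun n : 'I_N => E (Xn n))).
    exact: le_sum.
  by move=> i _; rewrite fineK.
have a0 : 0 <= a by have := suml 0%N; rewrite big_ord0.
(* A strategy must be a finite combination: the k-th one holds the first k hedges, each in its k-th
   approximation, so that every hedge is eventually included. *)
pose W k t w := \sum_(n < k) V n k t w.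
have WE k N t w : P w -> 0 <= t <= T -> (N <= k)%N -> \sum_(n < N) (l n + V n k t w) <= a + W k t w.
  move=> Pw tT Nk; apply: (@le_trans _ _ (\sum_(n < k) (l n + V n k t w))).
    rewrite -!(big_mkord xpredT (fun n => l n + V n k t w)) (big_cat_nat (leq0n N) Nk)//= lerDl.
    by apply: sumr_ge0 => i _; have [_ _ hVi _] := hV i; exact: hVi.
  by rewrite big_split /= lerD2r suml.
apply: (@hedges_outer_E a W); split=> //.
- move=> k; apply: (gain_sum T0 sepH (V := fun n => V n k)) => i _.
  by have [_ gV _ _] := hV i.
- move=> w k t Pw tT; apply: le_trans (WE k 0%N t w Pw tT (leq0n k)).
  by rewrite big_ord0.
move=> w Pw b bX.
have [N hN] : exists N, (b%:E < \sum_(n < N) Xn n w)%E.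
  apply: contrapT => /forallNP hN.
  have : (\sum_(n <oo) Xn n w <= b%:E)%E.
    apply: lime_le; first by apply: is_cvg_nneseries => n _ _; exact: X0.
    by apply: nearW => n; rewrite leNgt big_mkord; apply/negP/hN.
  by rewrite leNgt => /negP; apply; exact: lt_le_trans (hX w Pw).
have TT : 0 <= T <= T by rewrite ltW//= lexx.
have := @near_sum_lt R (fun n => Xn n w) (fun n k => l n + V n k T w) _ _ _ N b hN.
move=> h; near=> k; apply: le_trans (WE k N T w Pw TT _); last by near: k; exists N.
near: k; apply: h => [n|n k|n b' hb']; first exact: X0.
  by have [_ _ hVn _] := hV n; exact: hVn.
by have [_ _ _ hXn] := hV n; exact: hXn.
Unshelve. all: end_near. Qed.

Lemma outer_ED X Y : (forall w, P w -> (0 <= X w)%E) -> (forall w, P w -> (0 <= Y w)%E) ->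
  (E (fun w => X w + Y w) <= E X + E Y)%E.
Proof.
move=> X0 Y0.
have h := @outer_E_sigma_subadditive (fun w => X w + Y w)%E
  (fun n => if n is 0 then X else if n is 1 then Y else fun=> 0%E).
have sum2 (f : nat -> \bar R) : (forall n, 0 <= f n)%E -> (forall n, f n.+2 = 0%E) ->
    (\sum_(n <oo) f n = f 0%N + f 1%N)%E.
  move=> f0 f2; rewrite (nneseries_split _ 2) //.
  rewrite eseries0 ?adde0; last by move=> [|[|n]].
  by rewrite !big_nat_recr //= big_geq// add0e.
have := h _ _; rewrite (sum2 (fun n => E _)).
- apply=> [[|[|n]] w Pw|w Pw]//; [exact: X0|exact: Y0|].
  by rewrite sum2// => -[|[|n]]//; [exact: X0|exact: Y0].
- by move=> n; exact: outer_E_ge0.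
- by move=> n; exact: outer_E0.
Qed.

Hypothesis P_stop : forall u w, 0 <= u <= T -> P w -> P (stop u w).

(* The gains [h k] are switched off at time [u] whenever the capital [l + V k]
   accumulated until then fails to cover [X]. *)
Lemma conditional_hedge_step u (X : Omega -> R) (l L : R)
    (h : nat -> R -> Omega -> R) (Y : R -> Omega -> R) :
  0 <= u <= T -> rmeas (filt u) X -> (forall w, 0 <= X w) ->
  (forall w, X (stop u w) = X w) -> (E (EFin \o X) < l%:E)%E ->
  (forall k, gain (h k)) ->
  (forall w s t, s <= t -> Y s w <= Y t w) ->
  (forall w k t, P w -> 0 <= t <= T ->
    0 <= L + h k t w + (if u < t then X w else 0) + Y t w) ->
  exists h' : nat -> R -> Omega -> R, [/\ forall k, gain (h' k),
    forall w k t, P w -> 0 <= t <= T -> 0 <= l + L + h' k t w + Y t w &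
    forall w, P w -> \forall k \near \oo, h k T w + X w <= l + h' k T w].
Proof.
move=> uT mX X0 Xu El gh Ymono hadm; have /andP[u0 uT'] := uT.
have TT : 0 <= T <= T by rewrite ltW//= lexx.
have [l' [l'l [V [l'0 gV Vadm hV]]]] := outer_E_hedges El.
pose B k := [set w | X w <= l + V k u w].
have mB k : filt u (B k).
  apply: (rmeas_le_set (filt_sigma u)) => //; apply: rmeasD; first exact: rmeas_cst.
  exact: gain_rmeas.
have mT t : 0 <= t <= T -> 0 <= Num.min t u <= T.
  by move=> /andP[t0 tT]; rewrite le_min t0 u0 ge_min tT.
pose h' k t w := V k (Num.min t u) w + (h k (Num.min t u) w +
  \1_(B k) w * (h k t w - h k (Num.min t u) w)).
have Vpos w k t : P w -> 0 <= t <= T -> 0 <= l + V k t w.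
  by move=> Pw tT; apply: le_trans (Vadm w k t Pw tT) _; rewrite lerD2r ltW.
exists h'; split=> [k|w k t Pw tT|w Pw].
(* Switching on the empty set closes the hedge [V k] at time u. *)
- have g1 := gain_switch T0 sepH (gV k) uT (let: And3 G0 _ _ := @filt_sigma R T H u in G0).
  have g2 := gain_switch T0 sepH (gh k) uT (mB k).
  apply: (gain_ext _ (gain_lin T0 sepH 1 1 g1 g2)) => t w _.
  by rewrite !mul1r indic0 mul0r addr0.
- rewrite /h'; have [tu|ut] := leP t u.
    have := hadm w k t Pw tT; have := Vpos w k t Pw tT.
    by rewrite ltNge tu /= subrr mulr0; lra.
  (* On [B k] the capital l + V k u covers the amount X owed after u. Off [B k] the position h is
     closed, and its bound at u persists because Y increases. *)
  have := hadm w k t Pw tT; have := Vpos w k u Pw uT; rewrite ut.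
  have := hadm w k u Pw uT; rewrite ltxx.
  have := Ymono w u t (ltW ut).
  rewrite indicE; case: (pselect (B k w)) => hB.
    by rewrite mem_set// mul1r; move: hB; rewrite /B /=; lra.
  by rewrite memNset// mul0r; lra.
(* The hedge of X is evaluated at T on the stopped path, where X is unchanged and the gain is
   [V k u w]. The surplus l - l' turns levels just below X into X itself. *)
have := hV (stop u w) (P_stop uT Pw) (X w - (l - l')).
rewrite /= lte_fin Xu ltrBlDr ltrDl subr_gt0 => /(_ l'l).
apply: filterS => k; rewrite gain_stop// => hk.
have Bk : B k w by rewrite /B /=; lra.
rewrite /h' indicE mem_set// mul1r (min_r uT').
by move: Bk; rewrite /B /=; lra.
Qed.

(** The gains h are admissible only if X i is supplied from time u i on. These amounts are financed
    one after the other, each from capital E (X i) plus a share of the slack a - S. The induction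
    leaves the amounts M <= i < N unpaid and collects one eventual inequality at T per step. *)
Lemma conditional_hedge N (u : nat -> R) (X : nat -> Omega -> R)
    (h : nat -> R -> Omega -> R) (Z : Omega -> \bar R) :
  (forall i, 0 <= u i <= T) -> (forall i, rmeas (filt (u i)) (X i)) ->
  (forall i w, 0 <= X i w) -> (forall i w, X i (stop (u i) w) = X i w) ->
  (forall k, gain (h k)) ->
  (forall w k t, P w -> 0 <= t <= T ->
    0 <= h k t w + \sum_(i < N) (if u i < t then X i w else 0)) ->
  (forall w, P w -> forall a : R, (a%:E < Z w)%E ->
    \forall k \near \oo, a <= h k T w + \sum_(i < N) X i w) ->
  (E Z <= \sum_(i < N) E (EFin \o X i))%E.
Proof.
move=> uT mX X0 Xu gh hadm hZ; apply: le_of_gt_fin => a ha.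
have E0 i : (0 <= E (EFin \o X i))%E by exact: outer_E_ge0.
have fin (i : 'I_N) : E (EFin \o X i) \is a fin_num.
  rewrite ge0_fin_numE//; apply: le_lt_trans (lt_trans ha (ltry _)).
  by rewrite (bigD1 i)//= leeDl// sume_ge0.
pose S := \sum_(i < N) fine (E (EFin \o X i)).
have SE : (S%:E = \sum_(i < N) E (EFin \o X i))%E.
  by rewrite /S -sumEFin; apply: eq_bigr => i _; rewrite fineK.
have e0 : 0 < a - S by rewrite subr_gt0 -lte_fin SE.
pose l n := fine (E (EFin \o X n)) + (a - S) / 2 ^+ n.+1.
have El (i : 'I_N) : (E (EFin \o X i) < (l i)%:E)%E.
  by rewrite /l EFinD fineK// lteDl// lte_fin divr_gt0// exprn_gt0.
have l0 (i : 'I_N) : 0 <= l i.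
  by rewrite addr_ge0 ?fine_ge0// divr_ge0 ?exprn_ge0// ltW.
have suml : \sum_(i < N) l i <= a.
  rewrite big_split /= -lerBrDl.
  by apply: le_trans (sum_half_powers N (ltW e0)) _.
have [h' [gh' h'adm h'lim]] : exists h' : nat -> R -> Omega -> R, [/\ forall k, gain (h' k),
    forall w k t, P w -> 0 <= t <= T -> 0 <= \sum_(i < N) l i + h' k t w &
    forall w, P w -> \forall k \near \oo,
      h k T w + \sum_(i < N) X i w <= \sum_(i < N) l i + h' k T w].
  suff : forall M, (M <= N)%N -> exists h' : nat -> R -> Omega -> R, [/\ forall k, gain (h' k),
    forall w k t, P w -> 0 <= t <= T -> 0 <= \sum_(i < M) l i + h' k t w +
       \sum_(M <= i < N) (if u i < t then X i w else 0) &
    forall w, P w -> \forall k \near \oo,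
      h k T w + \sum_(i < M) X i w <= \sum_(i < M) l i + h' k T w].
    move=> /(_ N (leqnn N))[h' [h1 h2 h3]]; exists h'; split=> // w k t Pw tT.
    by have := h2 w k t Pw tT; rewrite big_geq// addr0.
  elim=> [_|M ih MN].
    exists h; split=> // [w k t Pw tT|w Pw].
      by rewrite big_ord0 add0r big_mkord; exact: hadm.
    by apply: nearW => k; rewrite !big_ord0 addr0 add0r.
  have [h1 [gh1 h1adm h1lim]] := ih (ltnW MN).
  have [|w k t Pw tT|h2 [gh2 h2adm h2lim]] := conditional_hedge_step
      (L := \sum_(i < M) l i) (Y := fun t w => \sum_(M.+1 <= i < N) (if u i < t then X i w else 0))
      (uT M) (mX M) (X0 M) (Xu M) (El (Ordinal MN)) gh1.
  - move=> w s t st; apply: ler_sum => i _; case: ifPn => us; last by case: ifP.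
    by rewrite (lt_le_trans us st).
  - by have := h1adm w k t Pw tT; rewrite (big_ltn MN) !addrA.
  exists h2; split=> // [w k t Pw tT|w Pw].
    by have := h2adm w k t Pw tT; rewrite big_ord_recr /= (addrC (l M)).
  apply: filterS2 (h1lim w Pw) (h2lim w Pw) => k; rewrite !big_ord_recr /=.
  move: (\sum_(i < M) X i w) (\sum_(i < M) l i) => p q; lra.
apply: (@hedges_outer_E _ h'); split=> //.
- by apply: le_trans suml; apply: sumr_ge0 => i _; exact: l0.
- by move=> w k t Pw tT; apply: le_trans (h'adm w k t Pw tT) _; rewrite lerD2r.
move=> w Pw b bZ; apply: filterS2 (hZ w Pw b bZ) (h'lim w Pw) => k h1 h2.
by apply: le_trans h1 (le_trans h2 _); rewrite lerD2r.
Qed.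

End OuterExpectation.

(** * The prediction set and the maximal inequality *)

Section PathEstimates.
Context {R : realType} {T : R} {H : normedModType R}.
Hypothesis T0 : 0 < T.
Local Notation Omega := (Omega T H).
Local Notation mu := (@lebesgue_measure R).

(** The increment is the integral of the density over ]s, t]. Passing to the positive part, a.e. at
    most c since c >= 0, reduces the bound to a comparison of nonnegative integrals. *)
Lemma abs_cont_rate_le_incr (c : R) (f : R -> R) s t : 0 <= c ->
  abs_cont_rate_le T c f -> 0 <= s -> s <= t -> t <= T -> f t - f s <= c * (t - s).
Proof.
move=> c0 [g [ig hg gc]] s0 st tT.
have ist : mu.-integrable `]s, t] (EFin \o g).
  apply: integrableS ig => //= x; rewrite /= !in_itv /= => /andP[sx xt].
  by rewrite (le_trans s0 (ltW sx)) (le_trans xt).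
have split_int : ((f t - f 0)%:E = (f s - f 0)%:E + \int[mu]_(x in `]s, t]) (g x)%:E)%E.
  rewrite -!hg ?s0 ?(le_trans s0)//= ?(le_trans st)//.
  have -> : `[0, t]%classic = `[0, s]%classic `|` `]s, t]%classic.
    by rewrite -itv_bndbnd_setU// bnd_simp.
  rewrite integral_setU//=.
    apply: (measurable_int mu); apply: integrableS ig => //=; first exact: measurableU.
    move=> x; rewrite /= !in_itv /= => -[/andP[-> xs]|/andP[sx xt]].
      by rewrite (le_trans xs)// (le_trans st).
    by rewrite (le_trans s0 (ltW sx)) (le_trans xt).
  apply/disj_set2P; rewrite -subset0 => x [/=]; rewrite !in_itv /= => /andP[_ xs] /andP[sx _].
  by move: sx; rewrite ltNge xs.
have le_c : (\int[mu]_(x in `]s, t]) (g x)%:E <= (c * (t - s))%:E)%E.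
  rewrite integralE; apply: (@le_trans _ _ (\int[mu]_(x in `]s, t]) ((EFin \o g)^\+ x))%E).
    by apply: geeDl; rewrite oppe_le0 integral_ge0.
  have mg := measurable_int _ ist.
  apply: (@le_trans _ _ (\int[mu]_(x in `]s, t]) (cst c%:E x))%E).
    apply: ae_ge0_le_integral => //=.
    - exact: measurable_funepos.
    - move: gc; apply: (@filterS _ _ (ae_filter_ringOfSetsType mu)) => x hx; rewrite in_itv /= => /andP[sx xt].
      rewrite (_ : _ x = maxe (g x)%:E 0) ?funeposE// -EFin_max lee_fin ge_max c0 andbT; apply: hx.
      by rewrite (le_trans s0 (ltW sx)) (le_trans xt).
  rewrite integral_cst//= lebesgue_measure_itv/= lte_fin.
  by case: ifPn => [_|]; rewrite ?mule0 lee_fin// mulr_ge0 ?subr_ge0.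
have fe : (f t - f s)%:E = (\int[mu]_(x in `]s, t]) (g x)%:E)%E.
  have fn := integrable_fin_num _ ist; move: split_int; rewrite -(fineK (fn _))//.
  by rewrite -EFinD => -[]; move: (fine _) => z; move: (f t) (f s) (f 0) => a b d h; congr EFin; lra.
by rewrite -lee_fin fe.
Qed.

Lemma Xi_qv_incr (c : R) (w : Omega) s t : 0 <= c -> Xi c w -> 0 <= s -> s <= t -> t <= T ->
  qv w t - qv w s <= c * (t - s).
Proof. by move=> c0 [_]; exact: abs_cont_rate_le_incr. Qed.

(** Truncation of times is 1-Lipschitz, so the Hoelder exponent survives; the density g of the
    quadratic variation becomes g 1_[0, u], still at most c because c >= 0. *)
Lemma Xi_stop (c u : R) (w : Omega) : 0 <= c -> 0 <= u <= T -> Xi c w -> Xi c (stop u w).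
Proof.
move=> c0 /andP[u0 uT] [[al [C [/andP[al0 al1] hC]]] [g [ig hg gc]]]; split.
  exists al, `|C|; rewrite al0; split=> // s t sT tT; rewrite !stopE//.
  have mT r : 0 <= r <= T -> 0 <= Num.min r u <= T.
    by move=> /andP[r0 rT]; rewrite le_min r0 u0 ge_min rT.
  apply: le_trans (hC _ _ (mT s sT) (mT t tT)) _.
  apply: (@le_trans _ _ (`|C| * `|Num.min t u - Num.min s u| `^ al)).
    by rewrite ler_wpM2r ?powR_ge0// ler_norm.
  rewrite ler_wpM2l// ge0_ler_powR ?nnegrE ?(ltW al0)//; exact: ler_dist_min.
exists (fun s => g s * \1_`[0, u] s); split.
- have -> : EFin \o (fun s => g s * \1_`[0, u] s) = (EFin \o g) \_ `[0, u].
    apply/funext => s; rewrite /= patchE indicE; case: ifPn => _.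
      by rewrite mulr1.
    by rewrite mulr0.
  apply/integrable_restrict => //; apply: integrableS ig => //; exact: measurableI.
- move=> t tT; have /andP[t0 tT'] := tT.
  rewrite !qv_stop ?lexx ?(ltW T0)// (min_l u0) -hg; last first.
    by rewrite le_min t0 u0 ge_min tT'.
  rewrite (_ : (fun s => (g s * \1_`[0, u] s)%:E) = (EFin \o g) \_ `[0, u]); last first.
    apply/funext => s; rewrite /= patchE indicE; case: ifPn => _.
      by rewrite mulr1.
    by rewrite mulr0.
  rewrite -integral_mkcondr; congr (integral _ _ _); apply/seteqP; split=> x /=.
    by rewrite !in_itv /= => -[/andP[-> xt] /andP[_ xu]]; rewrite le_min xt.
  by rewrite !in_itv /= le_min => /andP[-> /andP[-> ->]].
move: gc; apply: (@filterS _ _ (ae_filter_ringOfSetsType mu)) => s hs sT; rewrite indicE; case: (_ \in _).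
  by rewrite mulr1 hs.
by rewrite mulr0.
Qed.

End PathEstimates.

Section SimpleIntegralRegularity.
Context {R : realType} {T : R} {H V W : normedModType R}.
Hypotheses (T0 : 0 < T) (sepH : separable H).
Local Notation Omega := (Omega T H).
Local Notation simple := (@simple R T H V W).
Implicit Types (F : simple) (N : R -> Omega -> V).

Lemma simple_int_incr F N w n a b : simple_grid F ->
  stime F n w <= a -> a <= b -> b <= stime F n.+1 w ->
  simple_int F N b w - simple_int F N a w = scoef F n w (N b w - N a w).
Proof.
move=> gF na ab bn; have gFw := gF w; have [_ _ [M hM]] := gFw.
have hM' := grid_end gFw hM (leq_maxl M n.+1).
have nM : (n < maxn M n.+1)%N by rewrite leq_max ltnSn orbT.
rewrite !(simple_int_sum N _ gF hM') -sumrB (bigD1 (Ordinal nM))//= big1 ?addr0.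
  rewrite -blinB; congr (scoef F n w _).
  rewrite (min_r bn) (min_r (le_trans ab bn)) (min_l na) (min_l (le_trans na ab)).
  by rewrite opprB addrA subrK.
move=> [i iM] /= ji; rewrite -blinB.
have {ji} : i != n by move: ji; rewrite -val_eqE.
rewrite neq_ltn => /orP[ji|ij].
  have h1 : stime F i.+1 w <= a by apply: le_trans na; exact: grid_homo gFw _ _ ji.
  have h0 : stime F i w <= a by apply: le_trans na; exact: grid_homo gFw _ _ (ltnW ji).
  by rewrite (min_l h1) (min_l h0) (min_l (le_trans h1 ab)) (min_l (le_trans h0 ab)) subrr blin0.
have h0 : b <= stime F i w by apply: le_trans bn _; exact: grid_homo gFw _ _ ij.
have h1 : b <= stime F i.+1 w.
  by apply: le_trans bn _; exact: grid_homo gFw _ _ (leqW ij).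
by rewrite (min_r h1) (min_r h0) (min_r (le_trans ab h1)) (min_r (le_trans ab h0)) !subrr blin0.
Qed.

Lemma simple_int0 F N w : simple_grid F -> simple_int F N 0 w = 0.
Proof.
move=> gF; have [_ _ [M hM]] := gF w; rewrite (simple_int_sum N _ gF hM) big1// => i _.
have h k : 0 <= stime F k w by case/andP: (grid_bounds k (gF w)).
by rewrite !min_r// subrr blin0.
Qed.

Lemma simple_int_unif F N : simple_grid F -> unif_paths T N -> unif_paths T (simple_int F N).
Proof.
move=> gF uN w; have [_ _ [M hM]] := gF w.
suff h m e : 0 < e -> exists2 d : R, 0 < d & forall s t, 0 <= s <= T -> 0 <= t <= T ->
    `|s - t| < d -> `|\sum_(n < m) scoef F n w (N (Num.min (stime F n.+1 w) s) w -
      N (Num.min (stime F n w) s) w) - \sum_(n < m) scoef F n w (N (Num.min (stime F n.+1 w) t) w -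
      N (Num.min (stime F n w) t) w)| < e.
  move=> e e0; have [d d0 hd] := h M e e0; exists d => // s t sT tT st.
  by rewrite !(simple_int_sum N _ gF hM) hd.
elim: m e => [|m ih] e e0.
  by exists 1 => // *; rewrite !big_ord0 subrr normr0.
have e20 : 0 < e / 2 by rewrite divr_gt0.
have [d1 d10 h1] := ih _ e20.
pose C := `|scoef F m w| + 1; have C0 : 0 < C by rewrite ltr_wpDl.
have e40 : 0 < e / 2 / C / 2 by rewrite !divr_gt0.
have [d2 d20 h2] := uN w _ e40.
exists (Num.min d1 d2); first by rewrite lt_min d10.
move=> s t sT tT; rewrite lt_min => /andP[st1 st2].
rewrite !big_ord_recr /= opprD addrACA; apply: le_lt_trans (ler_normD _ _) _.
have := h1 s t sT tT st1; move: (\sum_(n < m) _) (\sum_(n < m) _) => p q hpq.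
have mT k r : 0 <= r <= T -> 0 <= Num.min (stime F k w) r <= T.
  move=> /andP[r0 rT]; have /andP[k0 kT] := grid_bounds k (gF w).
  by rewrite le_min k0 r0 ge_min kT.
have hN k : `|N (Num.min (stime F k w) s) w - N (Num.min (stime F k w) t) w| < e / 2 / C / 2.
  by apply: h2; rewrite ?mT// !(minC (stime F k w)); exact: le_lt_trans (ler_dist_min _ _ _) st2.
rewrite -blinB.
set A := N _ w; set B := N _ w; set A' := N _ w; set B' := N _ w.
have hAB : `|A - B - (A' - B')| <= e / 2 / C.
  have -> : A - B - (A' - B') = (A - A') - (B - B').
    by rewrite !opprD !opprK addrACA.
  apply: le_trans (ler_normB _ _) _; have := hN m.+1; have := hN m.
  by rewrite -/A -/B -/A' -/B'; move: (e / 2 / C) => z; lra.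
have : `|scoef F m w (A - B - (A' - B'))| <= e / 2.
  apply: le_trans (blin_norm_le _ _) _.
  apply: (@le_trans _ _ (C * (e / 2 / C))).
    by rewrite ler_pM// lerDl.
  by rewrite mulrC mulfVK ?gt_eqF.
by move: hpq; lra.
Qed.

(** The pathwise properties shared by S and A. Integrals of continuous simple integrands against
    such a process have them again. *)
Definition integrator N := unif_paths T N /\ forall t, 0 <= t <= T -> cadapted t (N t).

Lemma simple_int_cadapted F N t : integrator N -> in_Hsc F -> 0 <= t <= T ->
  cadapted t (simple_int F N t).
Proof.
move=> [_ cN] hF tT; have [p [gp pF]] := (in_HscP T0 sepH F).1 hF; have [t0 tT'] := andP tT.
have gF : simple_grid F.
  by move=> w; rewrite (_ : (stime F)^~ w = p)//; apply/funext => n; case: (pF n).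
have [_ _ [M hM]] := gp.
have pT n : 0 <= Num.min (p n) t <= T.
  by have /andP[h1 h2] := grid_bounds n gp; rewrite le_min h1 t0 ge_min h2.
have -> : simple_int F N t = (fun w => \sum_(n < M) scoef F n w
    (N (Num.min (p n.+1) t) w - N (Num.min (p n) t) w)).
  apply/funext => w; rewrite (@simple_int_sum _ _ _ _ _ F N t w M gF)//; last by rewrite (pF M).1.
  by apply: eq_bigr => n _; rewrite !(pF _).1.
elim: M {hM} => [|M ih].
  rewrite (_ : (fun _ => _) = cst 0); first exact: cadapted_cst.
  by apply/funext => w; rewrite big_ord0.
have hM : cadapted t (fun w => scoef F M w (N (Num.min (p M.+1) t) w - N (Num.min (p M) t) w)).
  case/orP: (le_total t (p M)) => [tp|pt].
    rewrite (_ : (fun _ => _) = cst 0); first exact: cadapted_cst.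
    apply/funext => w; rewrite !min_r ?subrr ?blin0//.
    exact: le_trans tp (grid_homo gp (leqnSn M)).
  have /andP[pM0 _] := grid_bounds M gp.
  have cf : cadapted t (scoef F M) := cadapted_le pM0 pt (pF M).2.
  have cn n : cadapted t (N (Num.min (p n) t)).
    have /andP[m0 _] := pT n; apply: (cadapted_le m0 _ (cN _ (pT n))).
    by rewrite ge_min lexx orbT.
  split; last by move=> w; rewrite cf.2 !(cn _).2.
  apply: continuous_blin_app cf.1 _; apply: continuousD_Omega; first exact: (cn _).1.
  move=> w; apply: (@cvgN _ _ _ _ (nbhs_filter w)); exact: (cn _).1.
rewrite (_ : (fun _ => _) = (fun w => \sum_(n < M) scoef F n w
    (N (Num.min (p n.+1) t) w - N (Num.min (p n) t) w) +
    scoef F M w (N (Num.min (p M.+1) t) w - N (Num.min (p M) t) w))); last first.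
  by apply/funext => w; rewrite big_ord_recr.
split; first exact: continuousD_Omega ih.1 hM.1.
by move=> w; rewrite (ih.2 w) (hM.2 w).
Qed.

End SimpleIntegralRegularity.

Section CadaptedCalculus.
Context {R : realType} {T : R} {H : hilbertType R}.
Hypotheses (T0 : 0 < T) (sepH : separable H).
Local Notation Omega := (Omega T H).

Lemma cadapted_norm {Y : normedModType R} u (f : Omega -> Y) :
  cadapted u f -> cadapted u (fun w => `|f w| : R^o).
Proof.
move=> [cf fu]; split; last by move=> w; rewrite fu.
move=> w; exact: (@cvg_norm _ _ _ _ (nbhs_filter w)) (cf w).
Qed.

Lemma cadapted_sqr u (f : Omega -> R^o) : cadapted u f -> cadapted u (fun w => f w ^+ 2 : R^o).
Proof.
move=> [cf fu]; split; last by move=> w; rewrite fu.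
move=> w; exact: (@cvgM _ _ _ (nbhs_filter w) f f _ _ (cf w) (cf w)).
Qed.

Lemma cadapted_rmeas u (f : Omega -> R) : 0 <= u ->
  cadapted u (f : Omega -> R^o) -> rmeas (filt u) f.
Proof.
by move=> u0 cf; apply: (borel_rmeas (filt_sigma u)); exact: cadapted_borel.
Qed.

Lemma cadapted_blin {V W : normedModType R} u (f : Omega -> 'L(V, W)) (g : Omega -> V) :
  cadapted u f -> cadapted u g -> cadapted u (fun w => f w (g w)).
Proof.
move=> [cf fu] [cg gu]; split; first exact: continuous_blin_app.
by move=> w; rewrite fu gu.
Qed.

Lemma cadapted_comp {Y Z : topologicalType} u (f : Omega -> Y) (g : Y -> Z) :
  continuous g -> cadapted u f -> cadapted u (g \o f).
Proof.
move=> cg [cf fu]; split; first by move=> w; apply: continuous_comp; [exact: cf|exact: cg].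
by move=> w /=; rewrite fu.
Qed.

Lemma riesz_continuous {V : hilbertType R} : continuous (@riesz R V).
Proof.
apply/norm_continuousP => x e e0; exists e => // y.
by rewrite -rieszB riesz_norm.
Qed.

Lemma cadapted_dot {V : hilbertType R} u (f g : Omega -> V) :
  cadapted u f -> cadapted u g -> cadapted u (fun w => dot (f w) (g w) : R^o).
Proof.
move=> cf cg; apply: (@cadapted_blin V R^o u (@riesz R V \o f) g) => //.
by apply: cadapted_comp cf; exact: riesz_continuous.
Qed.

Lemma procS_integrator : integrator (@procS R T H).
Proof.
split; first exact: procS_unif.
move=> t tT; split; first exact: procS_continuous.
by move=> w; rewrite /procS stopE//; [rewrite minxx|case/andP: tT].
Qed.

End CadaptedCalculus.

Section RefiningGrids.
Context {R : realType} (T : R).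
Hypothesis T0 : 0 < T.

Definition uniform_grid (k n : nat) : R := Num.min T (n%:R * (T / k.+1%:R)).

Lemma uniform_step_gt0 k : 0 < T / k.+1%:R.
Proof. by rewrite divr_gt0. Qed.

Lemma uniform_grid_grid k : grid T (uniform_grid k).
Proof.
split; first by rewrite /uniform_grid mul0r min_r// ltW.
  move=> n; rewrite /uniform_grid; apply/andP; split; last by rewrite ge_min lexx.
  by rewrite le_min !ge_min lexx/= ler_wpM2r ?orbT ?ler_nat// ltW// uniform_step_gt0.
by exists k.+1; rewrite /uniform_grid mulrC divfK ?minxx.
Qed.

Lemma uniform_gridS k n : uniform_grid k n.+1 <= uniform_grid k n + T / k.+1%:R.
Proof.
rewrite /uniform_grid -natr1 mulrDl mul1r; have := uniform_step_gt0 k.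
move: (T / _) => a a0; rewrite /Num.min; case: ifPn; case: ifPn; rewrite -?leNgt; lra.
Qed.

(** The uniform grid makes the mesh small, while the times of p keep an integrand with grid p
    constant on each cell. *)
Definition refined (p : nat -> R) k := merge_time p (uniform_grid k).

Lemma refined_grid p k : grid T p -> grid T (refined p k).
Proof. by move=> gp; apply: merge_time_grid => //; exact: uniform_grid_grid. Qed.

Lemma refined_gap p k n m : grid T p -> refined p k n < p m -> refined p k n.+1 <= p m.
Proof. by move=> gp; exact: (merge_time_gap gp). Qed.

Lemma refined_mesh p k n : grid T p -> refined p k n.+1 <= refined p k n + T / k.+1%:R.
Proof.
move=> gp; have gq := refined_grid k gp; have gu := uniform_grid_grid k.
have /andP[q0 qT] := grid_bounds n gq; have /andP[_ qT1] := grid_bounds n.+1 gq.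
have [Tq|qlt] := leP T (refined p k n).
  by rewrite (le_trans qT1)// (le_trans Tq)// lerDl ltW// uniform_step_gt0.
have [i /andP[iq qi]] : exists i, uniform_grid k i <= refined p k n < uniform_grid k i.+1.
  by apply: (grid_bracket gu); rewrite q0.
have -> : refined p k n.+1 = merge_time (uniform_grid k) p n.+1 by rewrite merge_timeC.
rewrite /refined merge_timeC in iq qi *.
apply: le_trans (merge_time_gap (b := p) gu qi) _.
by apply: le_trans (uniform_gridS k i) _; rewrite lerD2r.
Qed.

End RefiningGrids.

Section SupSquare.
Context {R : realType} {T : R} {H W : normedModType R}.
Local Notation Omega := (Omega T H).

Definition sup_sqr (u : R) (Y : R -> Omega -> W) (w : Omega) : \bar R :=
  ereal_sup [set (`|Y t w| ^+ 2)%:E | t in `[0, u]].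

Lemma sup_sqr_ge u Y w t : 0 <= t <= u -> ((`|Y t w| ^+ 2)%:E <= sup_sqr u Y w)%E.
Proof. by move=> tu; apply: ereal_sup_ubound; exists t. Qed.

Lemma sup_sqr_le u Y w (a : \bar R) :
  (forall t, 0 <= t <= u -> ((`|Y t w| ^+ 2)%:E <= a)%E) -> (sup_sqr u Y w <= a)%E.
Proof. by move=> h; apply: ge_ereal_sup => _ [t /= + <-]; rewrite in_itv /=; exact: h. Qed.

Lemma sup_sqr_ge0 u Y w : 0 <= u -> (0 <= sup_sqr u Y w)%E.
Proof. by move=> u0; apply: le_trans (sup_sqr_ge Y w (t := 0) _); rewrite ?lee_fin ?sqr_ge0// lexx. Qed.

Lemma sup_sqr_gt u Y w (a : R) : (a%:E < sup_sqr u Y w)%E ->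
  exists2 t, 0 <= t <= u & a < `|Y t w| ^+ 2.
Proof.
by move=> /ereal_sup_gt[_ [t /= + <-]]; rewrite in_itv /= lte_fin => tu ha; exists t.
Qed.

End SupSquare.

Section RefinedIntegral.
Context {R : realType} {T : R} {H V W : normedModType R}.
Local Notation Omega := (Omega T H).
Local Notation simple := (@simple R T H V W).
Implicit Types (F : simple) (N : R -> Omega -> V).

Lemma simple_int_step F N (q : nat -> R) j t w : simple_grid F -> grid T q ->
  (forall n k, q n < stime F k w -> q n.+1 <= stime F k w) -> 0 <= t <= T ->
  simple_int F N (Num.min (q j.+1) t) w = simple_int F N (Num.min (q j) t) w +
    simple_right F (q j) w (N (Num.min (q j.+1) t) w - N (Num.min (q j) t) w).
Proof.
move=> gF gq gap /andP[t0 tT]; have [_ /(_ j)/andP[qS _] _] := gq.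
have /andP[q0 _] := grid_bounds j gq.
case/orP: (le_total t (q j)) => [tq|qt].
  by rewrite !min_r ?(le_trans tq)// subrr blin0 addr0.
have [qT|] := eqVneq (q j) T.
  have -> : t = q j by apply/le_anti; rewrite qt qT tT.
  by rewrite minxx (min_r qS) subrr blin0 addr0.
move=> qT; have [i /andP[iq qi]] : exists i, stime F i w <= q j < stime F i.+1 w.
  by apply: (grid_bracket (gF w)); rewrite q0 lt_neqAle qT; case/andP: (grid_bounds j gq).
rewrite (simple_rightE gF (i := i)) ?iq// -(@simple_int_incr _ _ _ _ _ F N w i).
- by rewrite addrC subrK.
- exact: gF.
- by rewrite (min_l qt).
- by rewrite (min_l qt) le_min qS.
- by rewrite ge_min gap.
Qed.

End RefinedIntegral.

(** * Superhedging the squared maximum of an integral *)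

Section DoobHedge.
Context {R : realType} {T : R} {H K : hilbertType R}.
Hypotheses (T0 : 0 < T) (sepH : separable H).
Local Notation Omega := (Omega T H).

(** The terms linear in the increment of S come from the maximal inequality and from rewriting
    |dS|^2; a strategy needs them as one bounded functional on H. *)
Lemma hedge_functional (M : Omega -> K) (f : Omega -> 'L(H, K)) (S : Omega -> H)
    (a b : Omega -> R) : exists g : Omega -> 'L(H, R^o), forall w y,
  g w y = a w * dot (M w) (f w y) + b w * dot (S w) y.
Proof.
suff h w : exists g : 'L(H, R^o), forall y, g y = a w * dot (M w) (f w y) + b w * dot (S w) y.
  by have [g hg] := choice h; exists g.
apply: (@blin_pack R H R^o _ (`|a w| * `|M w| * `|f w| + `|b w| * `|S w|)).
  move=> r x y; rewrite blinD blinZ !dotDr !dotZr.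
  rewrite /GRing.scale/=.
  move: (dot _ _ : R) (dot _ _ : R) (dot _ _ : R) (dot _ _ : R) => m1 m2 m3 m4.
  by move: (a w) (b w) => u v; ring.
move=> y; apply: le_trans (ler_normD _ _) _; rewrite mulrDl !normrM lerD//.
  rewrite -!mulrA ler_wpM2l//; apply: le_trans (dot_CauchySchwarz _ _) _.
  by rewrite ler_wpM2l// blin_norm_le.
by rewrite -mulrA ler_wpM2l// dot_CauchySchwarz.
Qed.

Lemma rmeas_inv {X : pointedType} (G : set (set X)) (f : X -> R) : sigma_algebra setT G ->
  (forall w, 0 <= f w) -> rmeas G f -> rmeas G (fun w => (f w)^-1).
Proof.
move=> hG f0 mf; rewrite (_ : (fun _ => _) = (fun x => x `^ (-1)) \o f).
  by apply: measurableT_comp => //; exact: measurable_powR.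
by apply/funext => w /=; rewrite powR_inv1.
Qed.

Lemma running_max_rmeas {X : pointedType} (G : set (set X)) (s : nat -> X -> R) j :
  (forall i, (i <= j)%N -> rmeas G (s i)) -> rmeas G (fun w => running_max (s ^~ w) j).
Proof.
elim: j => [|j ih] ms /=; first exact: ms.
apply: rmeas_max; last exact: ms.
by apply: ih => i ij; apply: ms; exact: leqW.
Qed.

Section Hedge.
Context (F : @simple R T H H K) (p : nat -> R) (N : nat) (c : R).
Hypotheses (c0 : 0 <= c) (gp : grid T p) (pN : p N = T).
Hypothesis Fp : forall n, (forall w, stime F n w = p n) /\ cadapted (p n) (scoef F n).

Let gF : simple_grid F.
Proof. by move=> w; rewrite (_ : (stime F)^~ w = p)//; apply/funext => n; case: (Fp n). Qed.

Let hF : in_Hsc F. Proof. by apply/(in_HscP T0 sepH); exists p. Qed.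

Local Notation M := (simple_int F (@procS R T H)).

Let cM t : 0 <= t <= T -> cadapted t (M t).
Proof. by move=> tT; apply: simple_int_cadapted => //; exact: procS_integrator. Qed.

(** Both sums are the integral against the clock t of the scalar simple integrand with coefficients
    |f_n|^2, and refining the grid does not change an integral. *)
Lemma cost_regroup (q : nat -> R) Q t w : grid T q ->
  (forall n k, q n < p k -> q n.+1 <= p k) -> q Q = T ->
  \sum_(j < Q) `|simple_right F (q j) w| ^+ 2 * (Num.min (q j.+1) t - Num.min (q j) t) =
  \sum_(n < N) `|scoef F n w| ^+ 2 * (Num.min (p n.+1) t - Num.min (p n) t).
Proof.
move=> gq gap qQ.
pose G := Simple (stime F) (fun n w => scalar_blin (`|scoef F n w| ^+ 2)).
have gG : simple_grid G by [].
have gapF n k : q n < stime F k w -> q n.+1 <= stime F k w by rewrite !(Fp k).1; exact: gap.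
have := simple_int_refine (fun t _ => (t : R^o)) t gG gq gapF qQ.
rewrite (@simple_int_sum _ _ _ _ _ G (fun t _ => (t : R^o)) t w N) //; last by rewrite /= (Fp N).1.
move=> e; transitivity (\sum_(n < N) scoef G n w (Num.min (stime G n.+1 w) t - Num.min (stime G n w) t : R^o)); last first.
  by apply: eq_bigr => n _; rewrite /= !(Fp _).1.
rewrite -e; apply: eq_bigr => j _.
have /andP[q0 qT] := grid_bounds j gq.
have [qeT|qneT] := eqVneq (q j) T.
  have -> : q j.+1 = q j by rewrite qeT (grid_end gq qeT).
  by rewrite subrr mulr0 blin0.
have [i /andP[iq qi]] : exists i, stime F i w <= q j < stime F i.+1 w.
  by apply: (grid_bracket (gF w)); rewrite q0 lt_neqAle qneT.
by rewrite (simple_rightE gF (i := i)) ?iq// (simple_rightE gG (i := i)) ?iq.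
Qed.

(** Truncating the grid times at t gives the estimate at every t, as admissibility demands. The
    functional g has the part th <M, f y> from [pathwise_doob_ito] and the part -8 |f|^2 <S, y> from
    4 |f|^2 |dS|^2; what remains of the latter is 4 |f|^2 times the increment of [procSS] and the
    cost of the quadratic variation. *)
Lemma doob_hedge (q : nat -> R) Q : grid T q ->
  (forall n k, q n < p k -> q n.+1 <= p k) -> q Q = T ->
  exists2 h : R -> Omega -> R, gain h & forall w t j, Xi c w -> 0 <= t <= T -> (j <= Q)%N ->
    `|M (Num.min (q j) t) w| ^+ 2 <= h t w + \sum_(n < N)
      4 * c * (`|scoef F n w| ^+ 2 * (Num.min (p n.+1) t - Num.min (p n) t)).
Proof.
move=> gq gap qQ.
pose f j w := simple_right F (q j) w.
pose th j w := 8 - 4 * (running_max (fun i => `|M (q i) w|) j * `|M (q j) w|^-1).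
have qT j : 0 <= q j <= T := grid_bounds j gq.
have q0 j : 0 <= q j by case/andP: (qT j).
have qS j : q j <= q j.+1 by have [_ /(_ j)/andP[]] := gq.
have cf j : cadapted (q j) (f j) by exact: (simple_right_cadapted (q j) gp Fp).
have [g hg] := choice (fun j => hedge_functional (M (q j)) (f j) (fun w => w (q j)) (th j)
  (fun w => - 8 * `|f j w| ^+ 2)).
have mM i j : (i <= j)%N -> rmeas (filt (q j)) (fun w => `|M (q i) w|).
  move=> ij; apply: cadapted_rmeas => //; apply: cadapted_norm.
  apply: cadapted_le (cM (qT i)) => //; exact: grid_homo gq _ _ ij.
have mth j : rmeas (filt (q j)) (th j).
  apply: rmeasB; first exact: rmeas_cst.
  apply: rmeasM; first exact: rmeas_cst.
  apply: rmeasM; first by apply: running_max_rmeas => i; exact: mM.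
  by apply: rmeas_inv => //; [exact: filt_sigma|exact: mM].
have mf2 j : rmeas (filt (q j)) (fun w => `|f j w| ^+ 2).
  by apply: cadapted_rmeas => //; apply: cadapted_sqr; apply: cadapted_norm.
have mg j x : rmeas (filt (q j)) (fun w => g j w x).
  rewrite (_ : (fun w => g j w x) = fun w => th j w * dot (M (q j) w) (f j w x) +
      (- 8 * `|f j w| ^+ 2) * dot (w (q j)) x); last by apply/funext => w; rewrite hg.
  apply: rmeasD; apply: rmeasM => //.
  - apply: cadapted_rmeas => //; apply: cadapted_dot => //; first exact: cM.
    by apply: cadapted_blin => //; exact: cadapted_cst.
  - by apply: rmeasM => //; exact: rmeas_cst.
  - apply: cadapted_rmeas => //; apply: cadapted_dot; last exact: cadapted_cst.
    by have [_ /(_ _ (qT j))] := @procS_integrator R T H.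
exists (fun t w => \sum_(j < Q) (g j w (w (Num.min (q j.+1) t) - w (Num.min (q j) t)) +
    4 * `|f j w| ^+ 2 * (procSS (Num.min (q j.+1) t) w - procSS (Num.min (q j) t) w))).
  apply: (gain_sum T0 sepH (V := fun j t w => g j w (w (Num.min (q j.+1) t) - w (Num.min (q j) t)) +
    4 * `|f j w| ^+ 2 * (procSS (Num.min (q j.+1) t) w - procSS (Num.min (q j) t) w))) => j _.
  have qq : q j <= q j.+1 <= T by rewrite qS; case/andP: (qT j.+1).
  have m4 : rmeas (filt (q j)) (fun w => 4 * `|f j w| ^+ 2) by apply: rmeasM => //; exact: rmeas_cst.
  have gS := gain_elementaryS sepH (q0 j) qq (mg j).
  have gSS := gain_elementarySS (q0 j) qq m4.
  apply: gain_ext (gain_lin T0 sepH 1 1 gS gSS) => t w _.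
  by rewrite !mul1r.
move=> w t j Pw tT jQ; have /andP[t0 tT'] := tT.
pose a i := M (Num.min (q i) t) w; pose x i := w (Num.min (q i) t).
have gapF n k : q n < stime F k w -> q n.+1 <= stime F k w by rewrite !(Fp k).1; exact: gap.
have a0 : a 0 = 0.
  by rewrite /a; have [-> _ _] := gq; rewrite (min_l t0) simple_int0.
have aS i : (i < Q)%N -> a i.+1 = a i + f i w (x i.+1 - x i).
  by move=> _; exact: simple_int_step.
apply: le_trans (pathwise_doob_ito a0 aS jQ) _.
rewrite -mulr_sumr -(cost_regroup t w gq gap qQ) mulr_sumr -big_split /=.
apply: ler_sum => -[i iQ] _ /=.
case/orP: (le_total t (q i)) => [tq|qt].
  rewrite /x !min_r ?(le_trans tq)// !subrr !blin0 !(dotC _ 0) !dot0l !normr0 !mulr0 expr0n /=.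
  by rewrite !mulr0 !addr0.
have qm k : (k <= i)%N -> Num.min (q k) t = q k.
  by move=> ki; rewrite min_l// (le_trans _ qt)//; exact: grid_homo gq _ _ ki.
have ai : a i = M (q i) w by rewrite /a qm.
have ri k : (k <= i)%N -> running_max (fun k => `|a k|) k = running_max (fun k => `|M (q k) w|) k.
  elim: k => [|k ih] ki /=; first by rewrite /a qm.
  by rewrite ih ?(ltnW ki)// /a qm.
rewrite -/(f i w) (qm i (leqnn i)) hg -/(x i.+1).
have -> : x i = w (q i) by rewrite /x qm.
rewrite (ri i (leqnn i)) ai -/(th i w).
set d := x i.+1 - w (q i).
have mT : q i <= Num.min (q i.+1) t by rewrite le_min qS.
have mt : Num.min (q i.+1) t <= T by rewrite ge_min tT' orbT.
have hq := Xi_qv_incr c0 Pw (q0 i) mT mt.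
(* |d|^2 is the increment of SS plus that of the quadratic variation minus 2 <S, d>. *)
have hd : `|d| ^+ 2 = `|x i.+1| ^+ 2 - `|w (q i)| ^+ 2 - 2 * dot (w (q i)) d.
  rewrite /d normB_sqr dotBr dotE (dotC (w (q i)) (x i.+1)); move: (dot _ _ : R) => u.
  by ring.
rewrite hd /procSS -/(x i.+1).
have f0 : 0 <= `|f i w| ^+ 2 by rewrite sqr_ge0.
rewrite /th.
move: (dot (M (q i) w) _ : R) (running_max _ _) (`|M (q i) w|^-1) (dot (w (q i)) d : R) => m1 m2 m3 m4.
move: (`|f i w| ^+ 2) f0 hq => f2 f20.
move: (qv w (Num.min _ _)) (qv w (q i)) => q1 q2.
move: (`|x i.+1| ^+ 2) (`|w (q i)| ^+ 2) => x1 x2; move: (Num.min (q i.+1) t) (q i) => s1 s2 hq.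
have hm : f2 * (q1 - q2) <= f2 * (c * (s1 - s2)) by rewrite ler_wpM2l.
have -> : 4 * (f2 * (x1 - x2 - 2 * m4)) = - 8 * f2 * m4 + 4 * f2 * (x1 - x2) by ring.
by nra.
Qed.

(** The refinement number k is the index of the hedging sequence: each hedge controls grid points
    only, but in the lower limit the supremum over all of [0, T] is reached. The costs of
    [doob_hedge] are financed by [conditional_hedge]. *)
Lemma BDG : (outer_E (Xi c) (sup_sqr T M) <=
  \sum_(n < N) outer_E (Xi c) (fun w => (4 * c * `|scoef F n w| ^+ 2 * (p n.+1 - p n))%:E))%E.
Proof.
have TT : 0 <= T <= T by rewrite ltW//= lexx.
have pS n : 0 <= p n.+1 - p n by have [_ /(_ n)/andP[h _] _] := gp; rewrite subr_ge0.
have gr k := refined_grid T0 k gp.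
have hex k : exists h : R -> Omega -> R, gain h /\ forall w t j, Xi c w -> 0 <= t <= T ->
    `|M (Num.min (refined T p k j) t) w| ^+ 2 <= h t w + \sum_(n < N)
      4 * c * (`|scoef F n w| ^+ 2 * (Num.min (p n.+1) t - Num.min (p n) t)).
  have [_ _ [Q qQ]] := gr k.
  have [h gh hh] := doob_hedge (gr k) (fun n m => @refined_gap _ T p k n m gp) qQ.
  exists h; split; first exact: gh.
  move=> w t j Pw tT; have [jQ|jQ] := orP (leq_total j Q); first exact (hh w t j Pw tT jQ).
  have -> : refined T p k j = refined T p k Q by rewrite qQ (grid_end (gr k) qQ jQ).
  exact (hh w t Q Pw tT (leqnn Q)).
have [h hh] := choice hex.
pose X n w := 4 * c * `|scoef F n w| ^+ 2 * (p n.+1 - p n).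
have X0 n w : 0 <= X n w by rewrite !mulr_ge0// sqr_ge0.
(* The cost of cell n is charged in full as soon as p n is passed. This amount is known at p n, as
   [conditional_hedge] requires. *)
have cost_le w t : \sum_(n < N) 4 * c * (`|scoef F n w| ^+ 2 * (Num.min (p n.+1) t - Num.min (p n) t))
    <= \sum_(n < N) (if p n < t then X n w else 0).
  apply: ler_sum => -[n nN] _ /=; case: ifPn => [nt|]; last first.
    rewrite -leNgt => tn; rewrite !min_r ?subrr ?mulr0//.
    by rewrite (le_trans tn)// -subr_ge0.
  rewrite /X -[leRHS]mulrA ler_wpM2l ?mulr_ge0// ler_wpM2l ?sqr_ge0//.
  by rewrite (min_l (ltW nt)) lerB// ge_min lexx.
apply: (@conditional_hedge _ _ _ T0 sepH _ _ N p X h).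
- by move=> u w uT Pw; exact: (Xi_stop T0 c0 uT Pw).
- by move=> n; exact: grid_bounds gp.
- move=> n; have /andP[p0 _] := grid_bounds n gp.
  apply: rmeasM; last exact: rmeas_cst; apply: rmeasM; first exact: rmeas_cst.
  by apply: cadapted_rmeas => //; apply: cadapted_sqr; apply: cadapted_norm; case: (Fp n).
- exact: X0.
- by move=> n w; rewrite /X (Fp n).2.2.
- by move=> k; case: (hh k).
- move=> w k t Pw tT; have [_ /(_ w t 0%N Pw tT) h0] := hh k.
  by apply: le_trans (le_trans h0 _); [exact: sqr_ge0|rewrite lerD2l].
move=> w Pw a /sup_sqr_gt[t tT aM].
have bound k j : `|M (refined T p k j) w| ^+ 2 <= h k T w + \sum_(i < N) X i w.
  have [_ /(_ w T j Pw TT)] := hh k.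
  rewrite (min_l (andP (grid_bounds j (gr k))).2) => /le_trans -> //.
  rewrite lerD2l; apply: le_trans (cost_le w T) _; apply: ler_sum => n _.
  by case: ifP.
have [a0|a0] := ltP a 0.
  near=> k; apply: le_trans (bound k 0%N); exact: le_trans (ltW a0) (sqr_ge0 _).
(* The room |M_t| - sqrt a is used up by uniform continuity: a grid point closer to t than d still
   has |M|^2 >= a. *)
have sM : Num.sqrt a < `|M t w| by rewrite -(ltr_sqr) ?nnegrE ?sqrtr_ge0// sqr_sqrtr.
have sM0 : 0 < `|M t w| - Num.sqrt a by rewrite subr_gt0.
have [d d0 hd] := simple_int_unif gF (@procS_unif R T H) w sM0.
have t0 : 0 < t.
  rewrite lt_neqAle; case/andP: tT => -> _; rewrite andbT; apply/eqP => t0.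
  by move: sM; rewrite -t0 simple_int0// normr0 ltNge sqrtr_ge0.
have kd : \forall k \near \oo, T / k.+1%:R < d.
  have [k0 hk0] : exists k0, T / d < k0%:R.
    by exists (Num.truncn (T / d)).+1; rewrite truncnS_gt.
  exists k0 => // k /= k0k; rewrite ltr_pdivrMr// mulrC -ltr_pdivrMr//.
  by rewrite (lt_le_trans hk0)// ler_nat leqW.
move: kd; apply: filterS => k kd.
have [j /andP[jt tj]] : exists j, refined T p k j < t <= refined T p k j.+1.
  by apply: (grid_bracket_oc (gr k)); rewrite t0; case/andP: tT.
apply: le_trans (bound k j).
have tj' : `|t - refined T p k j| < d.
  rewrite gtr0_norm ?subr_gt0//; apply: le_lt_trans kd.
  by rewrite lerBlDl; apply: le_trans tj (refined_mesh T0 _ _ gp).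
have := hd t _ tT (grid_bounds j (gr k)) tj' => hM.
have sM' : Num.sqrt a <= `|M (refined T p k j) w|.
  have := ler_dist_dist (M t w) (M (refined T p k j) w); rewrite ler_norml => /andP[_].
  by move: hM; move: (`|M t w - _|) (Num.sqrt a) (`|M t w|) (`|M _ w|) => m1 m2 m3 m4; lra.
rewrite -(sqr_sqrtr a0) ler_sqr ?nnegrE ?sqrtr_ge0//.
Unshelve. all: end_near.
Qed.

End Hedge.

End DoobHedge.

(** * Upper integrals and Gronwall's inequality *)

Section UpperIntegralTheory.
Context {R : realType}.
Local Open Scope ereal_scope.
Implicit Types (u v : R) (f g : R -> \bar R).

Definition ui u f : \bar R := upper_integral `[0%R, u] f.

Local Notation mu := (@lebesgue_measure R).

Lemma ui_lt u f (a : \bar R) : ui u f < a -> exists g, [/\ measurable_fun `[0%R, u] g,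
  forall x, (0 <= x <= u)%R -> f x <= g x & \int[mu]_(x in `[0%R, u]) g x < a].
Proof.
move=> /ereal_inf_lt[_ [g [mg fg] <-] ga]; by exists g; split=> // x xu.
Qed.

Lemma ui_le_int u f g : measurable_fun `[0%R, u] g ->
  (forall x, (0 <= x <= u)%R -> f x <= g x) -> ui u f <= \int[mu]_(x in `[0%R, u]) g x.
Proof.
by move=> mg fg; apply: ereal_inf_lbound; exists g.
Qed.

Lemma ui_ge0 u f : (forall x, (0 <= x <= u)%R -> 0 <= f x) -> 0 <= ui u f.
Proof.
move=> f0; apply: le_ereal_inf_tmp => _ [g [mg fg] <-]; apply: integral_ge0 => x xu.
by apply: le_trans (fg _ xu); apply: f0; move: xu; rewrite /= in_itv.
Qed.

Lemma ui_le u f g : (forall x, (0 <= x <= u)%R -> f x <= g x) -> ui u f <= ui u g.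
Proof.
move=> fg; apply: le_ereal_inf_tmp => _ [h [mh gh] <-]; apply: ui_le_int => // x xu.
by rewrite (le_trans (fg _ xu))// gh//= in_itv.
Qed.

Lemma lt_addP (x y : \bar R) (a : R) : 0 <= x -> 0 <= y -> x + y < a%:E ->
  exists b c : R, [/\ x < b%:E, y < c%:E & (b + c <= a)%R].
Proof.
case: x => [x||]// x0; case: y => [y||]// y0; rewrite -EFinD lte_fin => xya.
exists (x + (a - (x + y)) / 2)%R, (y + (a - (x + y)) / 2)%R.
by rewrite !lte_fin; split; lra.
Qed.

Lemma uiD u f g : (forall x, (0 <= x <= u)%R -> 0 <= f x) ->
  (forall x, (0 <= x <= u)%R -> 0 <= g x) ->
  ui u (fun x => f x + g x) <= ui u f + ui u g.
Proof.
move=> f0 g0; apply: le_of_gt_fin => a /lt_addP[||b [c [/ui_lt[h [mh fh hb]] /ui_lt[k [mk gk kc]] bca]]].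
- exact: ui_ge0.
- exact: ui_ge0.
apply: (@le_trans _ _ (\int[mu]_(x in `[0%R, u]) (h x + k x))).
  apply: ui_le_int; first exact: emeasurable_funD.
  by move=> x xu; rewrite leeD// ?fh ?gk.
rewrite ge0_integralD//=.
- by rewrite (le_trans (leeD (ltW hb) (ltW kc)))// lee_fin.
- by move=> x; rewrite /= in_itv => xu; rewrite (le_trans (f0 _ xu))// fh.
- by move=> x; rewrite /= in_itv => xu; rewrite (le_trans (g0 _ xu))// gk.
Qed.

Lemma uiZ u (a : R) f : (0 <= a)%R -> (forall x, (0 <= x <= u)%R -> 0 <= f x) ->
  ui u (fun x => a%:E * f x) <= a%:E * ui u f.
Proof.
move=> a0 f0; have [->|an0] := eqVneq a 0%R.
  rewrite mul0e; apply: le_trans (ui_le_int (g := cst 0) _ _) _ => //.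
    by move=> x _; rewrite mul0e.
  by rewrite integral0.
have {a0}a0 : (0 < a)%R by rewrite lt_neqAle eq_sym an0.
apply: le_of_gt_fin => b; rewrite muleC -lte_pdivlMr// => /ui_lt[h [mh fh hb]].
apply: (@le_trans _ _ (\int[mu]_(x in `[0%R, u]) (a%:E * h x))).
  apply: ui_le_int; first exact: measurable_funeM.
  by move=> x xu; rewrite lee_pmul2l// fh.
rewrite ge0_integralZl//=.
- by rewrite muleC -lee_pdivlMr// ltW.
- by move=> x; rewrite /= in_itv => xu; rewrite (le_trans (f0 _ xu))// fh.
- by rewrite lee_fin ltW.
Qed.

(** A measurable majorant of f on [0, u] is extended by the constant a on ]u, v]; f itself may be
    nonmeasurable. *)
Lemma ui_split u v f (a : R) : (0 <= u)%R -> (u <= v)%R -> (0 <= a)%R ->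
  (forall x, (0 <= x <= u)%R -> 0 <= f x) ->
  (forall x, (u < x <= v)%R -> f x <= a%:E) -> ui v f <= ui u f + (a * (v - u))%:E.
Proof.
move=> u0 uv a0 f0 fa; apply: le_of_gt_fin => b.
have b0 : (0 <= a * (v - u))%R by rewrite mulr_ge0// subr_ge0.
move=> /lt_addP[||b1 [b2 [/ui_lt[g [mg fg gb]] b2b bb]]]; rewrite ?lee_fin//; first exact: ui_ge0.
pose h x := if (x <= u)%R then g x else a%:E.
have m1 : measurable (`[0%R, u] : set R) by [].
have m2 : measurable (`]u, v] : set R) by [].
have E : `[0%R, v]%classic = `[0%R, u]%classic `|` `]u, v]%classic.
  by rewrite -itv_bndbnd_setU// bnd_simp.
have h0 x : (`[0%R, u] `|` `]u, v])%classic x -> 0 <= h x.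
  rewrite /h /= !in_itv /= => -[/andP[x0 xu]|/andP[ux _]].
    by rewrite xu (le_trans (f0 _ _) (fg _ _)) ?x0.
  by rewrite (lt_geF ux) lee_fin.
have mh : measurable_fun `[0%R, v] h.
  rewrite E; apply/measurable_funU => //; split.
    by apply: eq_measurable_fun mg => x; rewrite inE /= in_itv /h /= => /andP[_ ->].
  apply: (eq_measurable_fun (cst a%:E)) => // x; rewrite inE /= in_itv /h /= => /andP[ux _].
  by rewrite (lt_geF ux).
apply: (@le_trans _ _ (\int[mu]_(x in `[0%R, v]) h x)).
  apply: ui_le_int => // x /andP[x0 xv]; rewrite /h; case: (leP x u) => xu; first by rewrite fg ?x0.
  by rewrite fa ?xu.
rewrite E ge0_integral_setU//=; last 2 first.
- by rewrite -E.
- apply/disj_set2P; rewrite -subset0 => x [/=]; rewrite !in_itv /= => /andP[_ xu] /andP[ux _].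
  by move: ux; rewrite ltNge xu.
have -> : \int[mu]_(x in `[0%R, u]) h x = \int[mu]_(x in `[0%R, u]) g x.
  by apply: eq_integral => x; rewrite inE /= in_itv /h /= => /andP[_ ->].
have -> : \int[mu]_(x in `]u, v]) h x = (a * (v - u))%:E.
  transitivity (\int[mu]_(x in `]u, v]) cst a%:E x).
    apply: eq_integral => x; rewrite inE /= in_itv /h /= => /andP[ux _].
    by rewrite (lt_geF ux).
  rewrite integral_cst//= lebesgue_measure_itv/= lte_fin.
  have [uv'|vu] := ltP u v; first by rewrite -EFinD -EFinM.
  have -> : v = u by apply: le_anti; rewrite uv vu.
  by rewrite subrr mulr0 mule0.
apply: (@le_trans _ _ (b1%:E + b2%:E)); last by rewrite lee_fin.
by rewrite leeD// ltW.
Qed.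

Lemma ui0 f : ui 0 f <= 0.
Proof.
apply: (@le_trans _ _ (\int[mu]_(x in `[0%R, 0%R]) cst +oo x)).
  by apply: ui_le_int => // x _; rewrite leey.
by rewrite set_itv1 integral_set1.
Qed.

Lemma ui_cst u f (a : R) : (0 <= u)%R -> (0 <= a)%R ->
  (forall x, (0 <= x <= u)%R -> 0 <= f x) ->
  (forall x, (0 < x <= u)%R -> f x <= a%:E) -> ui u f <= (a * u)%:E.
Proof.
move=> u0 a0 f0 fa; apply: le_trans (ui_split (lexx 0%R) u0 a0 _ fa) _.
  by move=> x /andP[h1 h2]; apply: f0; rewrite h1 (le_trans h2).
by rewrite subr0 -[leRHS]add0e leeD2r// ui0.
Qed.

Lemma ui_mono u v f : (0 <= u)%R -> (u <= v)%R -> (forall x, (0 <= x <= v)%R -> 0 <= f x) ->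
  ui u f <= ui v f.
Proof.
move=> u0 uv f0; apply: le_ereal_inf_tmp => _ [g [mg fg] <-].
have sub : `[0%R, u]%classic `<=` `[0%R, v]%classic.
  by move=> x; rewrite /= !in_itv /= => /andP[-> xu]; exact: le_trans uv.
apply: (@le_trans _ _ (\int[mu]_(x in `[0%R, u]) g x)).
  apply: ui_le_int => [|x xu]; first exact: measurable_funS mg.
  by apply: fg; apply: sub; rewrite /= in_itv.
apply: ge0_subset_integral => // x xv; apply: le_trans (fg _ xv).
by apply: f0; move: xv; rewrite /= in_itv.
Qed.

Lemma ui_cut u v f : (0 <= u)%R -> (u <= v)%R -> (forall x, (0 <= x <= u)%R -> 0 <= f x) ->
  ui v (fun x => if (x <= u)%R then f x else 0) <= ui u f.
Proof.
move=> u0 uv f0; rewrite -[leRHS]adde0.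
apply: le_trans (ui_split u0 uv (lexx 0%R) _ _) _ => [x /andP[x0 xu]|x /andP[ux _]|].
- by rewrite xu f0 ?x0.
- by rewrite (lt_geF ux).
by rewrite mul0r leeD2r//; apply: ui_le => x /andP[_ ->].
Qed.

(** Every measurable majorant of f dominates a_n on the n-th cell, so its integral dominates the
    step sum. The half-open cells leave out time 0, where simple integrands vanish by convention. *)
Lemma sum_le_ui (p : nat -> R) N f (a : nat -> \bar R) :
  (forall n, p n <= p n.+1)%R -> p 0%N = 0%R ->
  (forall x, (0 <= x <= p N)%R -> 0 <= f x) -> (forall n, 0 <= a n) ->
  (forall n x, (p n < x <= p n.+1)%R -> a n <= f x) ->
  \sum_(n < N) (p n.+1 - p n)%:E * a n <= ui (p N) f.
Proof.
move=> pS p0 f0 a0 fa; apply: le_ereal_inf_tmp => _ [g [mg fg] <-].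
have ph : {homo p : m n / (m <= n)%N >-> (m <= n)%R}.
  by apply: homo_leq => [x|y x z|n]; [exact: lexx|exact: le_trans|exact: pS].
have g0 x : (0 <= x <= p N)%R -> 0 <= g x.
  by move=> xN; rewrite (le_trans (f0 _ xN))// fg//= in_itv.
have mS n : (n <= N)%N -> `]0%R, p n]%classic `<=` `[0%R, p N]%classic.
  move=> nN x; rewrite /= !in_itv /= => /andP[/ltW -> xp].
  by rewrite (le_trans xp)// ph.
suff h n : (n <= N)%N -> \sum_(i < n) (p i.+1 - p i)%:E * a i <= \int[mu]_(x in `]0%R, p n]) g x.
  by apply: le_trans (h N (leqnn N)) _; apply: ge0_subset_integral => //; exact: mS.
elim: n => [|n ih] nN; first by rewrite big_ord0 p0 set_itvoc0// integral_set0.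
have p0n : (0 <= p n)%R by rewrite -p0 ph.
have E : `]0%R, p n.+1]%classic = `]0%R, p n]%classic `|` `]p n, p n.+1]%classic.
  by rewrite -itv_bndbnd_setU// bnd_simp.
rewrite big_ord_recr /= E ge0_integral_setU//=; last 3 first.
- by rewrite -E; apply: measurable_funS mg => //; exact: mS.
- move=> x hx; have /(mS _ nN) : `]0%R, p n.+1]%classic x by rewrite E.
  by rewrite /= in_itv; exact: g0.
- apply/disj_set2P; rewrite -subset0 => x [/=]; rewrite !in_itv /= => /andP[_ xu] /andP[ux _].
  by move: ux; rewrite ltNge xu.
apply: leeD; first exact: ih (ltnW nN).
have sub : `]p n, p n.+1]%classic `<=` `[0%R, p N]%classic.
  move=> x; rewrite /= !in_itv /= => /andP[px xp].
  by rewrite (le_trans p0n (ltW px)) (le_trans xp)// ph.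
apply: (@le_trans _ _ (\int[mu]_(x in `]p n, p n.+1]) cst (a n) x)).
  rewrite integral_cst//= lebesgue_measure_itv/= lte_fin.
  case: ltP => [pp|pp]; first by rewrite -EFinD muleC.
  have -> : p n.+1 = p n by apply: le_anti; rewrite pp pS.
  by rewrite subrr mul0e mule0.
apply: ge0_le_integral => //=.
- exact: measurable_funS mg.
- move=> x xp; apply: le_trans (fg _ (sub _ xp)).
  by move: xp; rewrite /= in_itv; exact: fa.
Qed.

End UpperIntegralTheory.

(** * Gronwall's inequality for upper integrals *)

Section Gronwall.
Context {R : realType}.
Local Open Scope ereal_scope.

(* The horizon is cut into steps of length 1 / (2 C): on one step the part of the integral
   over this step is at most half of the left-hand side. *)
Lemma gronwall (C T : R) : (0 <= C)%R -> (0 <= T)%R -> exists2 M : R, (0 <= M)%R &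
  forall (g : R -> \bar R) (a : R), (0 <= a)%R -> (forall t, (0 <= t <= T)%R -> 0 <= g t) ->
    (forall s t, (0 <= s <= t)%R -> (t <= T)%R -> g s <= g t) -> g T < +oo ->
    (forall t, (0 <= t <= T)%R -> g t <= a%:E + C%:E * ui t g) -> g T <= (M * a)%:E.
Proof.
(* C + 1 in place of C keeps the step length meaningful for C = 0. *)
move=> C0 T0; pose d := ((2 * (C + 1))^-1)%R; have C1 : (0 < C + 1)%R by rewrite ltr_wpDl.
have d0 : (0 < d)%R by rewrite invr_gt0 mulr_gt0.
have Cd : (C * d <= 1 / 2)%R by rewrite /d invfM mulrA ler_pdivrMr// mulrC; lra.
pose p n := Num.min T (n%:R * d)%R.
have p0 n : (0 <= p n <= T)%R by rewrite /p le_min T0 mulr_ge0 ?(ltW d0)//= ge_min lexx.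
have pS n : (p n <= p n.+1)%R.
  by rewrite /p le_min !ge_min lexx/= ler_wpM2r ?orbT ?ler_nat// ltW.
have pd n : (p n.+1 - p n <= d)%R.
  rewrite lerBlDl /p -natr1 mulrDl mul1r; move: (n%:R * d)%R => x.
  by rewrite /Num.min; case: ifPn; case: ifPn; rewrite -?leNgt; lra.
have [N pN] : exists N, p N = T.
  exists (Num.truncn (T / d)).+1; apply/min_idPl; rewrite -ler_pdivrMr//.
  by apply: ltW; rewrite truncnS_gt.
(* The induction carries the integral up to p n along with the value at p n. *)
suff h n : exists2 M : R, (0 <= M)%R & forall (g : R -> \bar R) (a : R), (0 <= a)%R ->
    (forall t, (0 <= t <= T)%R -> 0 <= g t) ->
    (forall s t, (0 <= s <= t)%R -> (t <= T)%R -> g s <= g t) -> g T < +oo ->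
    (forall t, (0 <= t <= T)%R -> g t <= a%:E + C%:E * ui t g) ->
    g (p n) <= (M * a)%:E /\ ui (p n) g <= (M * a)%:E.
  have [M M0 hM] := h N; exists M => // g a a0 g0 gm gT hg.
  by rewrite -pN; have [] := hM g a a0 g0 gm gT hg.
elim: n => [|n [M M0 hM]].
  have p00 : p 0%N = 0%R by rewrite /p mul0r min_r.
  exists 1%R => // g a a0 g0 gm gT hg; rewrite mul1r p00; split; last first.
    by rewrite (le_trans (ui0 _)).
  apply: le_trans (hg 0%R _) _; first by rewrite lexx.
  rewrite -[leRHS]adde0 leeD2l//; apply: le_trans (lee_wpmul2l _ (ui0 _)) _; first by rewrite lee_fin.
  by rewrite mule0.
(* For the value y at the next point, y <= a + C (M a + y e) and C y e <= y / 2 give y <= M' a;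
   subtracting y / 2 uses that g is finite. The integral grows by at most M' a d. *)
pose M' := (2 * (1 + C * M))%R; have M'0 : (0 <= M')%R by rewrite mulr_ge0// addr_ge0// mulr_ge0.
exists (M + M' * (1 + d))%R; first by rewrite addr_ge0// mulr_ge0// addr_ge0// ltW.
move=> g a a0 g0 gm gT hg; have [g1 u1] := hM g a a0 g0 gm gT hg.
have [/andP[pn0 pnT] /andP[pS0 pST]] := (p0 n, p0 n.+1).
have gfin : g (p n.+1) \is a fin_num.
  rewrite ge0_fin_numE ?g0 ?pS0//; apply: le_lt_trans gT; by apply: gm => //; rewrite pS0.
have usplit : ui (p n.+1) g <= (M * a + fine (g (p n.+1)) * (p n.+1 - p n))%:E.
  apply: (@le_trans _ _ (ui (p n) g + (fine (g (p n.+1)) * (p n.+1 - p n))%:E)).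
    apply: ui_split => //.
    - by rewrite fine_ge0// g0 ?pS0.
    - by move=> x /andP[x0 xp]; apply: g0; rewrite x0 (le_trans xp).
    - move=> x /andP[px xp]; rewrite fineK//; apply: gm => //.
      by rewrite xp (le_trans pn0 (ltW px)).
  by rewrite EFinD leeD2r.
have := hg (p n.+1); rewrite pS0 pST => /(_ isT).
have gy0 : (0 <= fine (g (p n.+1)))%R by rewrite fine_ge0// g0 ?pS0.
rewrite -{1 2}(fineK gfin) => hgn.
have : (fine (g (p n.+1)))%:E <= a%:E + C%:E * (M * a + fine (g (p n.+1)) * (p n.+1 - p n))%:E.
  by apply: le_trans hgn _; rewrite leeD2l// lee_wpmul2l// lee_fin.
rewrite -EFinM -EFinD lee_fin.
move: usplit gy0; move: (fine _) => y; move: (pd n).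
have : (0 <= p n.+1 - p n)%R by rewrite subr_ge0.
move: (p n.+1 - p n)%R => e e0 ed.
move=> us y0 hy.
have Ce : (C * (y * e) <= y / 2)%R.
  apply: (@le_trans _ _ (y * (C * d)))%R; last by rewrite ler_wpM2l// (le_trans Cd)// mul1r.
  by rewrite mulrCA ler_wpM2l// ler_wpM2l.
have yM : (y <= M' * a)%R.
  by move: hy; rewrite /M' mulrDr; move: Ce; move: (C * (y * e))%R => z; nra.
have Mda : (0 <= M' * d * a)%R by rewrite mulr_ge0 ?(mulr_ge0 M'0 (ltW d0)).
have Ma : (0 <= M * a)%R by rewrite mulr_ge0.
have M'a : (0 <= M' * a)%R by rewrite mulr_ge0.
have hd : (y * e <= M' * a * d)%R by rewrite ler_pM.
clearbody M' d.
split; first by rewrite lee_fin; nra.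
apply: le_trans us _; rewrite lee_fin.
by nra.
Qed.

End Gronwall.

(** * Energy estimates *)

Section SquareCalculus.
Context {R : realType} {T : R} {H : hilbertType R} {W : normedModType R}.
Hypotheses (T0 : 0 < T) (sepH : separable H).
Local Notation Omega := (Omega T H).
Variable P : set Omega.
Local Notation E := (outer_E P).
Local Open Scope ereal_scope.
Implicit Types (X : Omega -> W) (Y Z : R -> Omega -> W) (u : R).

Definition Esq X : \bar R := E (fun w => (`|X w| ^+ 2)%:E).
Definition I2 u Y : \bar R := ui u (fun t => Esq (Y t)).
Definition N2 u Y : \bar R := E (sup_sqr u Y).

Lemma Esq_ge0 X : 0 <= Esq X. Proof. exact: outer_E_ge0. Qed.
Lemma N2_ge0 u Y : 0 <= N2 u Y. Proof. exact: outer_E_ge0. Qed.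
Lemma I2_ge0 u Y : 0 <= I2 u Y. Proof. by apply: ui_ge0 => x _; exact: Esq_ge0. Qed.

Lemma outer_E_sum n (X : nat -> Omega -> \bar R) :
  (forall i w, P w -> 0 <= X i w) ->
  E (fun w => \sum_(i < n) X i w) <= \sum_(i < n) E (X i).
Proof.
move=> X0; elim: n => [|n ih].
  by rewrite big_ord0 (outer_E0 T0)// => w _; rewrite big_ord0.
rewrite big_ord_recr /=; apply: le_trans (leeD2r _ ih).
apply: le_trans (outer_ED T0 sepH _ (X0 n)); last by move=> w Pw; apply: sume_ge0 => i _; exact: X0.
by apply: (outer_E_le T0) => w _; rewrite big_ord_recr.
Qed.

Lemma sqr_normD2 (x y : W) : (`|x + y| ^+ 2 <= 2 * `|x| ^+ 2 + 2 * `|y| ^+ 2)%R.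
Proof.
have h : (`|x + y| ^+ 2 <= (`|x| + `|y|) ^+ 2)%R.
  by rewrite ler_sqr ?nnegrE ?addr_ge0// ler_normD.
apply: le_trans h _; have := sqr_ge0 (`|x| - `|y|)%R.
by move: (`|x|)%R (`|y|)%R => a b; nra.
Qed.

Lemma outer_E_lin (a b : R) (f g h : Omega -> \bar R) : (0 <= a)%R -> (0 <= b)%R ->
  (forall w, P w -> 0 <= f w) -> (forall w, P w -> 0 <= g w) ->
  (forall w, P w -> h w <= a%:E * f w + b%:E * g w) -> E h <= a%:E * E f + b%:E * E g.
Proof.
move=> a0 b0 f0 g0 hfg; apply: le_trans (outer_E_le T0 hfg) _.
have m0 (d : R) k : (0 <= d)%R -> (forall w, P w -> 0 <= k w) -> forall w, P w -> 0 <= d%:E * k w.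
  by move=> d0 k0 w Pw; rewrite mule_ge0 ?lee_fin ?k0.
apply: le_trans (outer_ED T0 sepH (m0 _ _ a0 f0) (m0 _ _ b0 g0)) _.
by apply: leeD; apply: outer_E_scale.
Qed.

Lemma EsqD X X' : Esq (fun w => X w + X' w)%R <= 2%:E * Esq X + 2%:E * Esq X'.
Proof.
apply: outer_E_lin => // w _; rewrite ?lee_fin ?sqr_ge0//.
exact: sqr_normD2.
Qed.

Lemma I2D u Y Z : I2 u (fun t w => Y t w + Z t w)%R <= 2%:E * I2 u Y + 2%:E * I2 u Z.
Proof.
have m0 Y' x : 0 <= 2%:E * Esq (Y' x) by rewrite mule_ge0 ?Esq_ge0.
apply: le_trans (ui_le (fun x _ => EsqD (Y x) (Z x))) _.
apply: le_trans (uiD (fun x _ => m0 Y x) (fun x _ => m0 Z x)) _.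
by apply: leeD; apply: uiZ => // x _; exact: Esq_ge0.
Qed.

Lemma N2D u Y Z : (0 <= u)%R -> N2 u (fun t w => Y t w + Z t w)%R <= 2%:E * N2 u Y + 2%:E * N2 u Z.
Proof.
move=> u0; apply: outer_E_lin => // w _; rewrite ?sup_sqr_ge0//.
apply: sup_sqr_le => t tu.
apply: (@le_trans _ _ (2%:E * (`|Y t w| ^+ 2)%:E + 2%:E * (`|Z t w| ^+ 2)%:E)).
  by rewrite -!EFinM -EFinD lee_fin sqr_normD2.
by apply: leeD; rewrite lee_pmul2l// sup_sqr_ge.
Qed.

Lemma Esq_triangle X X' X'' :
  Esq (fun w => X w - X'' w)%R <= 2%:E * Esq (fun w => X w - X' w)%R + 2%:E * Esq (fun w => X' w - X'' w)%R.
Proof.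
rewrite (_ : (fun w => X w - X'' w)%R = (fun w => (X w - X' w) + (X' w - X'' w))%R); first exact: EsqD.
by apply/funext => w; rewrite addrA subrK.
Qed.

Lemma I2_triangle u Y Y' Z : I2 u (fun t w => Y t w - Z t w)%R <=
  2%:E * I2 u (fun t w => Y t w - Y' t w)%R + 2%:E * I2 u (fun t w => Y' t w - Z t w)%R.
Proof.
rewrite (_ : (fun t w => Y t w - Z t w)%R = (fun t w => (Y t w - Y' t w) + (Y' t w - Z t w))%R).
  exact: I2D.
by apply/funext => t; apply/funext => w; rewrite addrA subrK.
Qed.

Lemma N2_triangle u Y Y' Z : (0 <= u)%R -> N2 u (fun t w => Y t w - Z t w)%R <=
  2%:E * N2 u (fun t w => Y t w - Y' t w)%R + 2%:E * N2 u (fun t w => Y' t w - Z t w)%R.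
Proof.
move=> u0.
rewrite (_ : (fun t w => Y t w - Z t w)%R = (fun t w => (Y t w - Y' t w) + (Y' t w - Z t w))%R).
  exact: N2D.
by apply/funext => t; apply/funext => w; rewrite addrA subrK.
Qed.

Lemma I2_distC u Y Z : I2 u (fun t w => Y t w - Z t w)%R = I2 u (fun t w => Z t w - Y t w)%R.
Proof.
congr (ui u _); apply/funext => t; congr E; apply/funext => w; by rewrite distrC.
Qed.

Lemma N2_distC u Y Z : N2 u (fun t w => Y t w - Z t w)%R = N2 u (fun t w => Z t w - Y t w)%R.
Proof.
congr E; apply/funext => w; congr ereal_sup; apply/seteqP.
by split=> _ [t tu <-]; exists t => //; rewrite distrC.
Qed.

Lemma Esq_le X X' : (forall w, P w -> (`|X w| <= `|X' w|)%R) -> Esq X <= Esq X'.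
Proof.
by move=> h; apply: (outer_E_le T0) => w Pw; rewrite lee_fin ler_sqr ?nnegrE ?h.
Qed.

Lemma N2_le u Y Z : (forall t w, P w -> (0 <= t <= u)%R -> (`|Y t w| <= `|Z t w|)%R) -> N2 u Y <= N2 u Z.
Proof.
move=> h; apply: (outer_E_le T0) => w Pw; apply: sup_sqr_le => t tu.
by apply: le_trans (sup_sqr_ge Z w tu); rewrite lee_fin ler_sqr ?nnegrE// h.
Qed.

Lemma N2_mono u v Y : (u <= v)%R -> N2 u Y <= N2 v Y.
Proof.
move=> uv; apply: (outer_E_le T0) => w Pw; apply: sup_sqr_le => t /andP[t0 tu].
by apply: sup_sqr_ge; rewrite t0 (le_trans tu).
Qed.

Lemma Esq_le_N2 u t Y : (0 <= t <= u)%R -> Esq (Y t) <= N2 u Y.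
Proof. by move=> tu; apply: (outer_E_le T0) => w Pw; exact: sup_sqr_ge. Qed.

Lemma I2_mono u v Y : (0 <= u)%R -> (u <= v)%R -> I2 u Y <= I2 v Y.
Proof. by move=> u0 uv; apply: ui_mono => // x _; exact: Esq_ge0. Qed.

Lemma EsqE X : Esq X = E (fun w => (`|X w| ^+ 2)%:E). Proof. by []. Qed.

Lemma I2E u Y : I2 u Y = ui u (fun t => Esq (Y t)). Proof. by []. Qed.

Lemma N2E u Y : N2 u Y = E (sup_sqr u Y). Proof. by []. Qed.

Lemma Esq_eq0 X : (forall w, P w -> X w = 0%R) -> Esq X = 0.
Proof. by move=> X0; apply: (outer_E0 T0) => w /X0 ->; rewrite normr0 expr0n. Qed.

Lemma I2_le_cst u Y (a : R) : (0 <= u)%R -> (0 <= a)%R ->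
  (forall x, (0 < x <= u)%R -> Esq (Y x) <= a%:E) -> I2 u Y <= (a * u)%:E.
Proof. by move=> u0 a0 h; apply: ui_cst => // x _; exact: Esq_ge0. Qed.

Lemma I2_subrr u Y : (0 <= u)%R -> I2 u (fun t w => Y t w - Y t w)%R = 0.
Proof.
move=> u0; have h : I2 u (fun t w => Y t w - Y t w)%R <= (0 * u)%:E.
  by apply: I2_le_cst => // x _; rewrite Esq_eq0// => w _; rewrite subrr.
by apply/eqP; rewrite eq_le I2_ge0 andbT; move: h; rewrite mul0r.
Qed.

End SquareCalculus.

Lemma H2_normE {R : realType} {T : R} {H : hilbertType R} {V W : normedModType R}
    (P : set (Omega T H)) (F : R -> Omega T H -> 'L(V, W)) :
  H2_norm P F = (I2 P T F `^ 2^-1)%E.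
Proof. by []. Qed.

(** * Energy bounds for the two integrators *)

Section EnergyBounds.
Context {R : realType} {T : R} {H : hilbertType R} {V W : normedModType R}.
Hypotheses (T0 : 0 < T) (sepH : separable H).
Local Notation Omega := (Omega T H).
Variable P : set Omega.
Local Notation simple := (@simple R T H V W).
Local Open Scope ereal_scope.
Implicit Types (N : R -> Omega -> V).

(** The L^2 estimate common to S and A. Together with [integrator] it is all that the Euler scheme
    uses about them. *)
Definition energy_bound (C : R) N := forall (F : simple) u, in_Hsc F -> (0 <= u <= T)%R ->
  N2 P u (simple_int F N) <= C%:E * I2 P u (simple_proc F).

(** Cutting the integrand at u stops its integral there and reduces the estimate to horizon T; the
    step sum is then at most the upper integral by [sum_le_ui]. *)
Lemma energy_bound_of_sum (C : R) N : (0 <= C)%R ->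
  (forall (F : simple) p M, in_Hsc F -> grid T p -> p M = T ->
    (forall n, (forall w, stime F n w = p n) /\ cadapted (p n) (scoef F n)) ->
    N2 P T (simple_int F N) <= C%:E * \sum_(n < M) (p n.+1 - p n)%:E * Esq P (scoef F n)) ->
  energy_bound C N.
Proof.
move=> C0 hN F u hF uT; have [u0 uT'] := andP uT.
have gF : simple_grid F by case: hF => /in_Hs_grid.
pose F' := simple_cut u F; have hF' : in_Hsc F' by exact: simple_cut_in_Hsc.
have [p [gp pF]] := (in_HscP T0 sepH F').1 hF'; have [p0 _ [M pM]] := gp.
apply: (@le_trans _ _ (N2 P T (simple_int F' N))).
  apply: (@le_trans _ _ (N2 P u (simple_int F' N))); last exact: N2_mono.
  apply: N2_le => // t w _ /andP[t0 tu].
  by rewrite simple_cut_int// min_l.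
apply: le_trans (hN F' p M hF' gp pM pF) _; apply: lee_wpmul2l; first by rewrite lee_fin.
have gF' : simple_grid F' by case: hF' => /in_Hs_grid.
apply: (@le_trans _ _ (I2 P T (simple_proc F'))).
  rewrite /I2 (_ : ui T = ui (p M)); last by rewrite pM.
  apply: (@sum_le_ui _ p M _ (fun n => Esq P (scoef F' n))) => //.
  - by move=> n; have [_ /(_ n)/andP[]] := gp.
  - by move=> x _; exact: Esq_ge0.
  - by move=> n; exact: Esq_ge0.
  - move=> n x xp; apply: (Esq_le T0) => w Pw.
    by rewrite (@simple_procE _ _ _ _ _ F' x w n)// !(pF _).1.
apply: le_trans (ui_cut u0 uT' (fun x _ => Esq_ge0 P (simple_proc F x))).
apply: ui_le => x _; case: ifPn => xu.
  by apply: (Esq_le T0) => w _; rewrite simple_cut_proc// xu.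
rewrite /Esq (outer_E0 T0)// => w _.
by rewrite simple_cut_proc// (negbTE xu) normr0 expr0n.
Qed.

End EnergyBounds.

Section BrownianEnergy.
Context {R : realType} {T : R} {H K : hilbertType R}.
Hypotheses (T0 : 0 < T) (sepH : separable H).
Variable c : R.
Hypothesis c0 : 0 <= c.
Local Open Scope ereal_scope.

Lemma procS_energy : energy_bound (W := K) (Xi c) (4 * c) (@procS R T H).
Proof.
apply: energy_bound_of_sum => //; first by rewrite mulr_ge0.
move=> F p M hF gp pM pF; apply: le_trans (BDG T0 sepH c0 gp pM pF) _.
rewrite ge0_sume_distrr => [|n _]; last first.
  by rewrite mule_ge0 ?Esq_ge0// lee_fin subr_ge0; have [_ /(_ n)/andP[]] := gp.
apply: lee_sum => n _; have pS : (0 <= p n.+1 - p n)%R.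
  by rewrite subr_ge0; have [_ /(_ n)/andP[]] := gp.
rewrite muleA -EFinM.
have h := @outer_E_scale R T H T0 sepH (Xi c) (4 * c * (p n.+1 - p n)) (fun w => (`|scoef F n w| ^+ 2)%:E).
apply: le_trans (h _ _); last 2 first.
- by rewrite !mulr_ge0.
- by move=> w _; rewrite lee_fin sqr_ge0.
by apply: (outer_E_le T0) => w _; rewrite -EFinM lee_fin mulrAC.
Qed.

End BrownianEnergy.

Section FiniteVariationEnergy.
Context {R : realType} {T : R} {H : hilbertType R} {K : hilbertType R}.
Hypotheses (T0 : 0 < T) (sepH : separable H).
Variables (c : R) (A : R -> Omega T H -> R^o).
Hypotheses (c0 : 0 <= c) (adA : adapted A).
Hypothesis cA : forall t, 0 <= t <= T -> continuous (A t).
Hypothesis vA : forall w, bounded_variation 0 T (fun t => A t w) /\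
  abs_cont_rate_le T c (fun t => fine (total_variation 0 t (fun s => A s w))).

(** The increment is at most the variation over [s, t], which by additivity is an increment of the
    absolutely continuous variation process. Bounded variation gives the finiteness needed to pass
    through [fine]. *)
Lemma finite_variation_incr w s t : 0 <= s -> s <= t -> t <= T -> `|A t w - A s w| <= c * (t - s).
Proof.
move=> s0 st tT; have [bv ac] := vA w; set f := fun r => A r w.
apply: le_trans (abs_cont_rate_le_incr c0 ac s0 st tT).
have fin v : 0 <= v <= T -> total_variation 0 v f \is a fin_num.
  move=> /andP[v0 vT]; have := (bounded_variationP f (ltW T0)).1 bv.
  rewrite (total_variationD f v0 vT) fin_numD => /andP[] //.
have tvs := total_variationD f s0 st.
have t0 := le_trans s0 st.
have fs : total_variation 0 s f \is a fin_num by apply: fin; rewrite s0 (le_trans st).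
have ft : total_variation 0 t f \is a fin_num by apply: fin; rewrite t0.
have fst : total_variation s t f \is a fin_num by move: ft; rewrite tvs fin_numD => /andP[].
rewrite -/f tvs fineD// [leRHS]addrAC subrr add0r -lee_fin fineK//; exact: total_variation_ge.
Qed.

Lemma finite_variation_dist w s t : 0 <= s <= T -> 0 <= t <= T -> `|A t w - A s w| <= c * `|t - s|.
Proof.
move=> /andP[s0 sT] /andP[t0 tT]; case/orP: (le_total s t) => st.
  by rewrite (ger0_norm (x := t - s)) ?subr_ge0// finite_variation_incr.
by rewrite distrC (distrC t) (ger0_norm (x := s - t)) ?subr_ge0// finite_variation_incr.
Qed.

Lemma finite_variation_integrator : integrator A.
Proof.
split.
  move=> w e e0; exists (e / (c + 1)); first by rewrite divr_gt0// ltr_wpDl.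
  move=> s t sT tT st; rewrite distrC; apply: le_lt_trans (finite_variation_dist _ sT tT) _.
  rewrite distrC; have c1 : 0 < c + 1 by rewrite ltr_wpDl.
  move: st; rewrite ltr_pdivlMr// mulrDr mulr1 mulrC => h.
  by apply: le_lt_trans h; rewrite lerDl.
move=> t tT; split; first exact: cA.
move=> w; apply: filt_plus_continuous_stop; [by case/andP: tT|exact: cA|exact: adA].
Qed.

(** Cauchy-Schwarz with weights d_i, by induction. The cross term satisfies 2 S x <= D x^2 + Q since
    S^2 <= D Q: multiplied by D, the difference is at least (D x - S)^2. *)
Lemma weighted_sum_sqr n (a d : nat -> R) : (forall i, 0 <= d i) ->
  (\sum_(i < n) a i * d i) ^+ 2 <= (\sum_(i < n) d i) * (\sum_(i < n) a i ^+ 2 * d i).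
Proof.
move=> d0; elim: n => [|n ih]; first by rewrite !big_ord0 mulr0 expr0n.
rewrite !big_ord_recr /=; have D0 : 0 <= \sum_(i < n) d i by apply: sumr_ge0.
have Q0 : 0 <= \sum_(i < n) a i ^+ 2 * d i by apply: sumr_ge0 => i _; rewrite mulr_ge0 ?sqr_ge0.
move: (\sum_(i < n) _) (\sum_(i < n) _) (\sum_(i < n) _) ih D0 Q0 (a n) (d n) (d0 n) => Q D S h D0 Q0 x y y0.
suff hx : 2 * S * x <= D * x ^+ 2 + Q by nra.
have [DE|Dn0] := eqVneq D 0.
  have -> : S = 0.
    by apply/eqP; rewrite -sqrf_eq0 eq_le sqr_ge0 andbT (le_trans h)// DE mul0r.
  by rewrite mulr0 mul0r addr_ge0// mulr_ge0// sqr_ge0.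
have {}D0 : 0 < D by rewrite lt_neqAle eq_sym Dn0.
rewrite -subr_ge0 -(pmulr_rge0 _ D0); have := sqr_ge0 (D * x - S); nra.
Qed.

(** Increments of A are at most c dp and the dp sum to T, so Cauchy-Schwarz bounds the squared
    integral by c^2 T sum |f_n|^2 dp on each path. Only subadditivity of the outer expectation is
    then needed, no hedge. *)
Lemma finite_variation_energy : energy_bound (W := K) (Xi c) (c ^+ 2 * T) A.
Proof.
apply: energy_bound_of_sum => //; first by rewrite mulr_ge0 ?sqr_ge0// ltW.
move=> F p M hF gp pM pF; have gF : simple_grid F by case: hF => /in_Hs_grid.
have pS n : 0 <= p n.+1 - p n by rewrite subr_ge0; have [_ /(_ n)/andP[]] := gp.
have sp : \sum_(n < M) (p n.+1 - p n) = T.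
  rewrite -(big_mkord predT (fun n => p n.+1 - p n)) telescope_sumr// pM.
  by have [-> _ _] := gp; rewrite subr0.
pose X n w := (c ^+ 2 * T * (p n.+1 - p n) * `|scoef F n w| ^+ 2)%:E.
have X0 n w : (0 <= X n w)%E by rewrite lee_fin !mulr_ge0 ?sqr_ge0// ltW.
apply: (@le_trans _ _ (outer_E (Xi c) (fun w => \sum_(n < M) X n w)%E)).
  apply: (outer_E_le T0) => w _; apply: sup_sqr_le => t tT.
  rewrite sumEFin lee_fin (@simple_int_sum _ _ _ _ _ F A t w M gF); last by rewrite (pF M).1.
  apply: (@le_trans _ _ ((\sum_(n < M) (c * `|scoef F n w|) * (p n.+1 - p n)) ^+ 2)).
    rewrite ler_sqr ?nnegrE//; last by apply: sumr_ge0 => n _; rewrite !mulr_ge0.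
    apply: le_trans (ler_norm_sum _ _ _) _; apply: ler_sum => n _.
    rewrite !(pF _).1; apply: le_trans (blin_norm_le _ _) _.
    rewrite [c * _]mulrC -mulrA ler_wpM2l//.
    have tm k : 0 <= Num.min (p k) t <= T.
      have /andP[k0 kT] := grid_bounds k gp; case/andP: tT => t0 tT.
      by rewrite le_min k0 t0 ge_min kT.
    apply: le_trans (finite_variation_dist _ (tm n) (tm n.+1)) _; rewrite ler_wpM2l//.
    move: (pS n); rewrite subr_ge0 => h; rewrite ger0_norm ?subr_ge0.
      case/orP: (le_total (p n) t) => ht; first by rewrite (min_l ht) lerB// ge_min lexx.
      by rewrite !min_r ?subrr ?subr_ge0// (le_trans ht).
    by rewrite le_min !ge_min lexx orbT h.
  apply: le_trans (@weighted_sum_sqr M (fun n => c * `|scoef F n w|) (fun n => p n.+1 - p n) pS) _.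
  rewrite sp mulr_sumr; apply: ler_sum => n _.
  by rewrite exprMn; move: (`|scoef F n w| ^+ 2) (p n.+1 - p n) => x y; rewrite le_eqVlt; apply/orP; left; apply/eqP; ring.
apply: le_trans (outer_E_sum T0 sepH M (fun n w _ => X0 n w)) _.
rewrite ge0_sume_distrr => [|n _]; last by rewrite mule_ge0 ?Esq_ge0// lee_fin.
apply: lee_sum => n _; rewrite muleA -EFinM.
apply: le_trans (outer_E_scale T0 sepH _ _) => [||w _]; last by rewrite lee_fin sqr_ge0.
  by apply: (outer_E_le T0) => w _; rewrite -EFinM.
by rewrite !mulr_ge0 ?sqr_ge0// ltW.
Qed.

End FiniteVariationEnergy.

(** * Stochastic integrals *)

Opaque Esq I2 N2 ui.

Section NegligibleSequences.
Context {R : realType}.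
Local Open Scope ereal_scope.
Implicit Types (u v : nat -> \bar R) (x y : \bar R).

(** Convergence to 0 through upper bounds only, so that finiteness of the terms need not be tracked;
    for nonnegative terms it is the usual limit by [tends0P]. *)
Definition tends0 u := forall e : R, (0 < e)%R ->
  exists n0, forall n, (n0 <= n)%N -> u n <= e%:E.

Lemma tends0P u : (forall n, 0 <= u n) -> tends0 u <-> u n @[n --> \oo] --> 0.
Proof.
move=> u0; split=> [h|h e e0].
  have fin : \forall n \near \oo, u n \is a fin_num.
    have [n0 h0] := h 1%R ltr01; exists n0 => // n /= nn0.
    by rewrite ge0_fin_numE// (le_lt_trans (h0 n nn0))// ltry.
  apply/fine_cvgP; split=> //; apply/cvgrPdist_le => e e0.
  have [n0 h0] := h e e0; exists n0 => // n /= nn0 /=.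
  rewrite sub0r normrN ger0_norm ?fine_ge0// -lee_fin fineK ?h0//.
  by rewrite ge0_fin_numE// (le_lt_trans (h0 n nn0))// ltry.
have /fine_cvgP[fin /cvgrPdist_le /(_ e e0) hd] := h.
have [n0 _ h0] : \forall n \near \oo, u n \is a fin_num /\ (`|0 - fine (u n)| <= e)%R.
  by near=> n; split; near: n.
exists n0 => n /h0[fn]; rewrite sub0r normrN ger0_norm ?fine_ge0// -lee_fin fineK//.
Unshelve. all: end_near.
Qed.

Lemma tends0_lin (a b : R) u v w : (0 <= a)%R -> (0 <= b)%R ->
  (forall n, u n <= a%:E * v n + b%:E * w n) -> tends0 v -> tends0 w -> tends0 u.
Proof.
move=> a0 b0 h hv hw e e0; have p : (0 < e / (a + b + 1))%R by rewrite divr_gt0// ltr_wpDl// addr_ge0.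
have [n1 h1] := hv _ p; have [n2 h2] := hw _ p; exists (maxn n1 n2) => n.
rewrite geq_max => /andP[n1n n2n]; apply: le_trans (h n) _.
apply: (@le_trans _ _ (a%:E * (e / (a + b + 1))%:E + b%:E * (e / (a + b + 1))%:E)).
  by apply: leeD; apply: lee_wpmul2l; rewrite ?lee_fin// ?h1 ?h2.
rewrite -!EFinM -EFinD lee_fin -mulrDl mulrCA -[leRHS]mulr1 ler_wpM2l ?(ltW e0)//.
by rewrite ler_pdivrMr ?mul1r ?lerDl ?ltr_wpDl ?addr_ge0.
Qed.

Lemma tends0_le u v : (forall n, u n <= v n) -> tends0 v -> tends0 u.
Proof. by move=> h hv e /hv[n0 h0]; exists n0 => n /h0; exact: le_trans. Qed.

Lemma le_of_tends0 x y u : tends0 u -> (forall n, x <= y + u n) -> x <= y.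
Proof.
move=> hu h; apply/lee_addgt0Pr => e e0; have [n0 h0] := hu e e0.
by apply: le_trans (h n0) _; rewrite leeD2l// h0.
Qed.

Lemma tends0_geometric (D : R) : (0 <= D)%R -> tends0 (fun n => (D / 4 ^+ n)%:E).
Proof.
move=> D0 e e0; exists (Num.truncn (D / e)).+1 => n nn; rewrite lee_fin ler_pdivrMr ?exprn_gt0//.
rewrite mulrC -ler_pdivrMr//; apply: le_trans (ltW (truncnS_gt _)) _.
apply: le_trans (_ : n%:R <= _)%R; first by rewrite ler_nat.
by rewrite -natrX ler_nat ltnW// ltn_expl.
Qed.

Lemma poweR_half_le x (e : R) : 0 <= x -> (0 <= e)%R ->
  (x `^ 2^-1 <= e%:E) = (x <= (e ^+ 2)%:E).
Proof.
case: x => [x||]// x0 e0.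
  rewrite poweR_EFin !lee_fin; rewrite lee_fin in x0.
  by rewrite powR12_sqrt// -{1}(ger0_norm e0) -sqrtr_sqr ler_sqrt// sqr_ge0.
by rewrite poweRyr ?invr_neq0// !leye_eq.
Qed.

Lemma tends0_poweR_half u : (forall n, 0 <= u n) ->
  tends0 (fun n => u n `^ 2^-1) <-> tends0 u.
Proof.
move=> u0; split=> h e e0.
  have se : (0 < Num.sqrt e)%R by rewrite sqrtr_gt0.
  have [n0 h0] := h _ se.
  exists n0 => n /h0; rewrite poweR_half_le ?sqrtr_ge0// sqr_sqrtr//; exact: ltW.
have [n0 h0] := h (e ^+ 2)%R (exprn_gt0 2 e0).
by exists n0 => n /h0; rewrite poweR_half_le// ltW.
Qed.

(** Collects the factors of nested triangle inequalities for squares: 2 * 2 * C * 4 = 16 C in front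
    of the main term z. *)
Lemma integral_diff_arith (C : R) x y z t : (0 <= C)%R -> 0 <= x -> 0 <= y -> 0 <= z -> 0 <= t ->
  2%:E * x + 2%:E * (2%:E * (C%:E * (4%:E * z + t)) + 2%:E * y) <=
  (16 * C)%:E * z + ((2%:E * x + 4%:E * y) + (4 * C)%:E * t).
Proof.
move=> C0 x0 y0 z0 t0; have C0' : 0 <= C%:E by rewrite lee_fin.
have z4 : 0 <= 4%:E * z by rewrite mule_ge0.
rewrite (ge0_muleDr _ z4 t0).
have p1 : 0 <= C%:E * (4%:E * z) by rewrite mule_ge0.
have p2 : 0 <= C%:E * t by rewrite mule_ge0.
rewrite (ge0_muleDr _ p1 p2) ge0_muleDr ?mule_ge0 ?adde_ge0 ?mule_ge0//.
rewrite ge0_muleDr ?mule_ge0// !muleA -!EFinM.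
have -> : (2 * 2 * C * 4 = 16 * C)%R by ring.
have -> : (2 * 2 * C = 4 * C)%R by ring.
have -> : (2 * 2 = 4 :> R)%R by ring.
by rewrite addeCA -!addeA (addeC (4%:E * y)) (addeCA (2%:E * x)).
Qed.

End NegligibleSequences.

Section IntegralTheory.
Context {R : realType} {T : R} {H : hilbertType R} {V W : normedModType R}.
Hypotheses (T0 : 0 < T) (sepH : separable H).
Local Notation Omega := (Omega T H).
Variable P : set Omega.
Local Notation simple := (@simple R T H V W).
Local Open Scope ereal_scope.
Implicit Types (N : R -> Omega -> V) (F : R -> Omega -> 'L(V, W)).

Definition proc_sub F (G : simple) : R -> Omega -> 'L(V, W) :=
  fun t w => (F t w - simple_proc G t w)%R.

Lemma H2_approxP F (Fn : nat -> simple) : H2_approx P F Fn <->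
  (forall n, in_Hsc (Fn n)) /\ tends0 (fun n => I2 P T (proc_sub F (Fn n))).
Proof.
have g0 n : 0 <= I2 P T (proc_sub F (Fn n)) by exact: I2_ge0.
have p0 n : 0 <= I2 P T (proc_sub F (Fn n)) `^ 2^-1 by exact: poweR_ge0.
by rewrite /H2_approx -(tends0_poweR_half g0) (tends0P p0).
Qed.

Lemma H2_norm_lty F : H2_norm P F < +oo <-> I2 P T F < +oo.
Proof.
rewrite H2_normE.
have : 0 <= I2 P T F by exact: I2_ge0.
by case: (I2 P T F) => [x||]// x0; rewrite ?poweR_EFin ?ltry// poweRyr ?invr_neq0.
Qed.

Lemma in_H2P F : in_H2 P F <-> I2 P T F < +oo /\ exists Fn : nat -> simple,
  (forall n, in_Hsc (Fn n)) /\ tends0 (fun n => I2 P T (proc_sub F (Fn n))).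
Proof.
by split=> -[hF [Fn hFn]]; (split; [exact/H2_norm_lty|exists Fn; exact/H2_approxP]).
Qed.

Variables (N : R -> Omega -> V) (C : R).
Hypotheses (C0 : (0 <= C)%R) (eN : energy_bound (W := W) P C N).

Lemma simple_int_diff (F G : simple) u : in_Hsc F -> in_Hsc G -> (0 <= u <= T)%R ->
  N2 P u (fun t w => simple_int F N t w - simple_int G N t w)%R <=
  C%:E * I2 P u (fun t w => simple_proc F t w - simple_proc G t w)%R.
Proof.
move=> hF hG uT; have gF : simple_grid F by case: hF => /in_Hs_grid.
have gG : simple_grid G by case: hG => /in_Hs_grid.
have := eN (simple_sub_in_Hsc T0 sepH hF hG) uT.
rewrite (_ : simple_int _ N = fun t w => simple_int F N t w - simple_int G N t w)%R; last first.
  by apply/funext => t; apply/funext => w; rewrite simple_sub_int.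
rewrite (_ : simple_proc _ = fun t w => simple_proc F t w - simple_proc G t w)%R//.
by apply/funext => t; apply/funext => w; rewrite simple_sub_proc.
Qed.

Lemma proc_sub_triangle F F' (Fn Gn : simple) u : (0 <= u <= T)%R ->
  I2 P u (fun t w => simple_proc Fn t w - simple_proc Gn t w)%R <=
  4%:E * I2 P u (fun t w => F t w - F' t w)%R +
  (2%:E * I2 P T (proc_sub F Fn) + 4%:E * I2 P T (proc_sub F' Gn)).
Proof.
move=> /andP[u0 uT].
apply: le_trans (I2_triangle T0 sepH P u (simple_proc Fn) F (simple_proc Gn)) _.
apply: (@le_trans _ _ (2%:E * I2 P T (proc_sub F Fn) + 2%:E * (2%:E * I2 P u (fun t w => F t w - F' t w)%R +
    2%:E * I2 P T (proc_sub F' Gn)))).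
  apply: leeD; apply: lee_wpmul2l => //.
    by rewrite I2_distC; apply: I2_mono.
  apply: le_trans (I2_triangle T0 sepH P u F F' (simple_proc Gn)) _.
  by apply: leeD => //; apply: lee_wpmul2l => //; apply: I2_mono.
rewrite ge0_muleDr ?mule_ge0 ?I2_ge0//.
by rewrite !muleA -!EFinM addeCA (_ : (2 * 2)%R = 4%R) ?lexx//; ring.
Qed.

Lemma is_integralP F Y : is_integral P F N Y <-> in_H2 P F /\
  forall Fn : nat -> simple, (forall n, in_Hsc (Fn n)) ->
    tends0 (fun n => I2 P T (proc_sub F (Fn n))) ->
    tends0 (fun n => N2 P T (fun t w => Y w t - simple_int (Fn n) N t w)%R).
Proof.
have g0 (Fn : nat -> simple) n : 0 <= N2 P T (fun t w => Y w t - simple_int (Fn n) N t w)%R.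
  exact: N2_ge0.
split=> -[hF hY]; split=> // Fn.
  by move=> hFn aFn; apply/(tends0P (g0 Fn)); apply: hY; exact/H2_approxP.
by move=> /H2_approxP[hFn aFn]; apply/(tends0P (g0 Fn)); exact: hY.
Qed.

(** Y - Y' is split at the simple integrals of G and G'. Only the middle difference is estimated by
    energy, up to the horizon u; the approximation errors are enlarged to the horizon T. *)
Lemma integral_diff_step F F' (Y Y' : Omega -> cpath T W) (G G' : simple) u : (0 <= u <= T)%R ->
  in_Hsc G -> in_Hsc G' -> N2 P u (fun t w => Y w t - Y' w t)%R <=
  (16 * C)%:E * I2 P u (fun t w => F t w - F' t w)%R +
    ((2%:E * N2 P T (fun t w => Y w t - simple_int G N t w)%R +
      4%:E * N2 P T (fun t w => Y' w t - simple_int G' N t w)%R) +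
    (4 * C)%:E * (2%:E * I2 P T (proc_sub F G) + 4%:E * I2 P T (proc_sub F' G'))).
Proof.
move=> uT hG hG'; have [u0 uT'] := andP uT.
have hd := le_trans (simple_int_diff hG hG' uT)
  (lee_wpmul2l (_ : 0 <= C%:E) (proc_sub_triangle F F' G G' uT)).
have h1 := N2_triangle T0 sepH P (fun t w => Y w t) (simple_int G N) (fun t w => Y' w t) u0.
have h2 := N2_triangle T0 sepH P (simple_int G N) (simple_int G' N) (fun t w => Y' w t) u0.
have h3 := N2_mono T0 P (fun t w => Y w t - simple_int G N t w)%R uT'.
have h4 := N2_mono T0 P (fun t w => Y' w t - simple_int G' N t w)%R uT'.
rewrite N2_distC in h4.
have x0 := I2_ge0 P u (fun t w => F t w - F' t w)%R.
have a0 := N2_ge0 P T (fun t w => Y w t - simple_int G N t w)%R.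
have b0 := N2_ge0 P T (fun t w => Y' w t - simple_int G' N t w)%R.
have c0 := I2_ge0 P T (proc_sub F G); have d0 := I2_ge0 P T (proc_sub F' G').
move: hd h1 h2 h3 h4 x0 a0 b0 c0 d0.
move: (N2 P u _) (N2 P u _) (N2 P u _) (N2 P u _) (N2 P u _) (N2 P T _) (N2 P T _).
move: (I2 P u _) (I2 P T _) (I2 P T _) => x c d r1 r2 r3 r4 r5 a b.
have C0' : 0 <= C%:E by rewrite lee_fin.
move=> /(_ C0') h5 h4 h2 h3 h1 x0 b0 a0 d0 c0.
have t0 : 0 <= 2%:E * d + 4%:E * c by rewrite adde_ge0 ?mule_ge0.
apply: le_trans (integral_diff_arith C0 b0 a0 x0 t0); apply: le_trans h4 _.
apply: leeD; apply: lee_wpmul2l => //; apply: le_trans h2 _.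
by apply: leeD; apply: lee_wpmul2l.
Qed.

(** The energy bound passes from simple integrands to H^2 along approximating sequences; the factor
    16 is the price of the squared triangle inequalities. *)
Lemma is_integral_diff F F' (Y Y' : Omega -> cpath T W) u : (0 <= u <= T)%R ->
  is_integral P F N Y -> is_integral P F' N Y' ->
  N2 P u (fun t w => Y w t - Y' w t)%R <= (16 * C)%:E * I2 P u (fun t w => F t w - F' t w)%R.
Proof.
move=> uT /is_integralP[/in_H2P[_ [Fn [hF aF]]] /(_ Fn hF aF) hY].
move=> /is_integralP[/in_H2P[_ [Gn [hG aG]]] /(_ Gn hG aG) hY'].
apply: (@le_of_tends0 _ _ _ (fun n => (2%:E * N2 P T (fun t w => Y w t - simple_int (Fn n) N t w)%R +
    4%:E * N2 P T (fun t w => Y' w t - simple_int (Gn n) N t w)%R) +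
    (4 * C)%:E * (2%:E * I2 P T (proc_sub F (Fn n)) + 4%:E * I2 P T (proc_sub F' (Gn n))))).
  have h1 := tends0_lin (ler0n R 2) (ler0n R 4) (fun n => lexx _) hY hY'.
  have h2 := tends0_lin (ler0n R 2) (ler0n R 4) (fun n => lexx _) aF aG.
  have C4 : (0 <= 4 * C)%R by rewrite mulr_ge0.
  by apply: (tends0_lin (@ler01 R) C4 _ h1 h2) => n; rewrite mul1e.
by move=> n; exact: integral_diff_step.
Qed.

(** One approximating sequence suffices: the simple integrals along two of them differ by at most
    the energy of the difference of the integrands, which tends to 0. *)
Lemma is_integral_of F (Y : Omega -> cpath T W) (Fn : nat -> simple) :
  I2 P T F < +oo -> (forall n, in_Hsc (Fn n)) -> tends0 (fun n => I2 P T (proc_sub F (Fn n))) ->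
  tends0 (fun n => N2 P T (fun t w => Y w t - simple_int (Fn n) N t w)%R) ->
  is_integral P F N Y.
Proof.
move=> FT hF aF hY; apply/is_integralP; split; first by apply/in_H2P; split=> //; exists Fn.
have TT : (0 <= T <= T)%R by rewrite ltW//= lexx.
move=> Gn hG aG.
apply: (@tends0_lin _ 2 (2 * C) _ _ (fun n => 4%:E * I2 P T (proc_sub F (Fn n)) + 4%:E * I2 P T (proc_sub F (Gn n))) _ _ _ hY) => //.
- by rewrite mulr_ge0.
- move=> n; apply: le_trans (N2_triangle T0 sepH P (fun t w => Y w t) (simple_int (Fn n) N) (simple_int (Gn n) N) (ltW T0)) _.
  apply: leeD => //.
  rewrite EFinM -muleA; apply: lee_wpmul2l => //.
  apply: le_trans (simple_int_diff (hF n) (hG n) TT) _; apply: lee_wpmul2l => //.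
  apply: le_trans (proc_sub_triangle F F (Fn n) (Gn n) TT) _.
  rewrite (I2_subrr T0 P F (ltW T0)) mule0 add0e; apply: leeD => //.
  by apply: lee_wpmul2r; rewrite ?I2_ge0// lee_fin ler_nat.
- exact: (tends0_lin (a := 4) (b := 4) _ _ (fun n => lexx _) aF aG).
Qed.

End IntegralTheory.

(** * Negligible sets and uniform limits of processes *)

Section Completeness.
Context {R : realType} {T : R} {H : hilbertType R} {W : completeNormedModType R}.
Hypotheses (T0 : 0 < T) (sepH : separable H).
Local Notation Omega := (Omega T H).
Variable P : set Omega.
Local Open Scope ereal_scope.

(** Y is dominated by a series of copies of X, which is +oo wherever X > 0; countable subadditivity
    gives the bound 0. With Y an indicator this produces statements for typical paths. *)
Lemma outer_E_null (X Y : Omega -> \bar R) : (forall w, P w -> 0 <= X w) ->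
  outer_E P X = 0 -> (forall w, P w -> X w = 0 -> Y w <= 0) -> outer_E P Y = 0.
Proof.
move=> X0 EX hY; apply/eqP; rewrite eq_le outer_E_ge0 andbT.
apply: le_trans (outer_E_sigma_subadditive T0 sepH (X := Y) (fun=> X0) _) _; last first.
  by rewrite EX eseries0.
move=> w Pw; have [Xw|Xn] := eqVneq (X w) 0; first by rewrite Xw eseries0// hY.
have Xw : 0 < X w by rewrite lt_neqAle eq_sym Xn X0.
apply: le_trans (leey _) _; rewrite leye_eq; apply/eqP; apply/eqyP => M M0.
have [r r0 rX] : exists2 r : R, (0 < r)%R & r%:E <= X w.
  case: (X w) Xw => [r||]// r0; last by exists 1%R => //; rewrite leey.
  by exists r.
pose k := (Num.truncn (M / r)).+1.
apply: (@le_trans _ _ (\sum_(0 <= n < k) X w)); last first.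
  by apply: (nneseries_lim_ge (P := predT)) => n _ _; exact: X0.
apply: (@le_trans _ _ (\sum_(0 <= n < k) r%:E)); last by apply: lee_sum.
rewrite sumEFin lee_fin sumr_const_nat subn0 -mulr_natl -ler_pdivrMr// ltW//.
exact: truncnS_gt.
Qed.

Lemma nneseries_geometric_le (D : R) : (0 <= D)%R ->
  \sum_(0 <= k <oo) (D / 2 ^+ k)%:E <= (2 * D)%:E.
Proof.
move=> D0; apply: lime_le.
  by apply: is_cvg_nneseries => n _ _; rewrite lee_fin divr_ge0// exprn_ge0.
near=> n; rewrite sumEFin lee_fin big_mkord.
apply: le_trans (sum_half_powers n (e := 2 * D) _); last by rewrite mulr_ge0.
apply: ler_sum => k _; rewrite exprS invfM mulrACA mulfV// mul1r //.
Unshelve. all: end_near.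
Qed.

Lemma geometric_small (s e : R) : (0 <= s)%R -> (0 < e)%R -> exists n, (s / 2 ^+ n <= e)%R.
Proof.
move=> s0 e0; exists (Num.truncn (s / e)).+1; rewrite ler_pdivrMr ?exprn_gt0//.
rewrite mulrC -ler_pdivrMr//; apply: le_trans (ltW (truncnS_gt _)) _.
by rewrite -natrX ler_nat ltnW// ltn_expl.
Qed.

(** The increments are dominated by a geometric series of ratio 1/2, and the uniform limit inherits
    uniform continuity, so it is a path. *)
Lemma fast_cauchy_cpath (Y : nat -> R -> W) (s : R) : (0 <= s)%R ->
  (forall n (e : R), (0 < e)%R -> exists2 d : R, (0 < d)%R & forall a b, (0 <= a <= T)%R ->
    (0 <= b <= T)%R -> (`|a - b| < d)%R -> (`|Y n a - Y n b| < e)%R) ->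
  (forall n t, (0 <= t <= T)%R -> (`|Y n.+1 t - Y n t| <= s / 2 ^+ n)%R) ->
  exists z : cpath T W, forall n t, (0 <= t <= T)%R -> (`|z t - Y n t| <= 2 * s / 2 ^+ n)%R.
Proof.
move=> s0 uY hY.
have p2 n : (0 < 2 ^+ n :> R)%R by rewrite exprn_gt0.
have far n j t : (0 <= t <= T)%R ->
    (`|Y (n + j)%N t - Y n t| <= 2 * s / 2 ^+ n - 2 * s / 2 ^+ (n + j))%R.
  move=> tT; elim: j => [|j ih]; first by rewrite addn0 !subrr normr0.
  rewrite addnS; have := ler_distD (Y (n + j)%N t) (Y (n + j).+1 t) (Y n t).
  have := hY (n + j)%N t tT; rewrite exprS invfM.
  have -> : (2 * s * (2^-1 * (2 ^+ (n + j))^-1) = s / 2 ^+ (n + j))%R.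
    by rewrite mulrA (mulrC _ s) mulfK.
  move: ih; rewrite -[in X in (_ <= _ - X)%R -> _]mulrA.
  move: (s / 2 ^+ (n + j))%R (2 * s / 2 ^+ n)%R => a b; move: (`|_|)%R (`|_|)%R (`|_|)%R => x y z; lra.
have far' n m t : (0 <= t <= T)%R -> (n <= m)%N -> (`|Y m t - Y n t| <= 2 * s / 2 ^+ n)%R.
  move=> tT nm; rewrite -(subnKC nm); apply: le_trans (far n (m - n)%N t tT) _.
  by rewrite lerBlDr lerDl divr_ge0 ?mulr_ge0// ltW.
have cv t : (0 <= t <= T)%R -> cvgn (fun n => Y n t).
  move=> tT; apply: cauchy_cvgn => e e0.
  have [n hn] := geometric_small (s := 2 * (2 * s)) (e := e) (mulr_ge0 (ler0n _ 2) (mulr_ge0 (ler0n _ 2) s0)) e0.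
  exists n => i j ni nj; apply: le_trans hn.
  apply: le_trans (ler_distD (Y n t) _ _) _; rewrite (distrC (Y n t)).
  by rewrite -mulrA mulr2n mulrDl mul1r lerD// far'.
pose f t := limn (fun n => Y n t).
have fY n t : (0 <= t <= T)%R -> (`|f t - Y n t| <= 2 * s / 2 ^+ n)%R.
  move=> tT; apply/ler_addgt0Pr => e e0.
  have /cvgrPdist_lt /(_ _ e0)[m _ hm] := cv t tT.
  apply: le_trans (ler_distD (Y (maxn m n) t) _ _) _; rewrite addrC; apply: lerD.
    by apply: far' => //; rewrite leq_maxr.
  by apply: ltW; apply: hm; rewrite /= leq_maxl.
have [z hz] : exists z : cpath T W, forall t, (0 <= t <= T)%R -> z t = f t.
  apply: cpath_of => e e0; have e3 : (0 < e / 3)%R by rewrite divr_gt0.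
  have [n hn] := geometric_small (s := 2 * s) (e := e / 3) (mulr_ge0 (ler0n _ 2) s0) e3.
  have [d d0 hd] := uY n _ e3; exists d => // a b aT bT ab.
  have := hd a b aT bT ab; have := fY n a aT; have := fY n b bT; rewrite (distrC (f b)).
  have := ler_distD (Y n a) (f a) (f b); have := ler_distD (Y n b) (Y n a) (f b).
  move: hn; move: (2 * s / 2 ^+ n)%R; move: (`|_|)%R (`|_|)%R (`|_|)%R (`|_|)%R (`|_|)%R => x1 x2 x3 x4 x5 x6; lra.
by exists z => n t tT; rewrite hz// fY.
Qed.

(* With e = sum_k 4^k sup |Y_(k+1) - Y_k|^2 one has sup |Z - Y_n|^2 <= 4^(1-n) e, trivially where
   e = +oo, so that no exceptional set is needed. *)
Lemma cpath_limit (Y : nat -> R -> Omega -> W) (D : R) : (0 <= D)%R ->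
  (forall n, unif_paths T (Y n)) ->
  (forall n, N2 P T (fun t w => Y n.+1 t w - Y n t w)%R <= (D / 8 ^+ n)%:E) ->
  exists Z : Omega -> cpath T W, forall n,
    N2 P T (fun t w => Z w t - Y n t w)%R <= (8 * D / 4 ^+ n)%:E.
Proof.
move=> D0 uY hY; pose d k := sup_sqr T (fun t w => Y k.+1 t w - Y k t w)%R.
pose e w := \sum_(0 <= k <oo) (4 ^+ k)%:E * d k w.
have d0 k w : 0 <= (4 ^+ k)%:E * d k w.
  by rewrite mule_ge0 ?lee_fin ?exprn_ge0// sup_sqr_ge0// ltW.
have e0 w : 0 <= e w by apply: nneseries_ge0.
(* The weights 4^k against the rate 8^-k leave a geometric series of ratio 1/2. *)
have Ee : outer_E P e <= (2 * D)%:E.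
  apply: le_trans (outer_E_sigma_subadditive T0 sepH (X := e) (Xn := fun k w => (4 ^+ k)%:E * d k w) _ _) _ => //.
  apply: le_trans (nneseries_geometric_le D0); apply: lee_nneseries => [k _ _|k _]; first exact: outer_E_ge0.
  apply: le_trans (outer_E_scale T0 sepH _ _) _; first by rewrite exprn_ge0.
    by move=> w _; rewrite sup_sqr_ge0// ltW.
  apply: (@le_trans _ _ ((4 ^+ k)%:E * (D / 8 ^+ k)%:E)).
    by apply: lee_wpmul2l; [rewrite lee_fin exprn_ge0|exact: hY].
  rewrite -EFinM lee_fin mulrCA ler_wpM2l// (_ : 8 = 4 * 2 :> R)%R; last by ring.
  by rewrite exprMn invfM mulrA mulfV ?mul1r// expf_neq0.
have ex w : exists z : cpath T W, forall n t, (0 <= t <= T)%R ->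
    (`|z t - Y n t w| ^+ 2)%:E <= (4 / 4 ^+ n)%:E * e w.
  have [einf|efin] := eqVneq (e w) +oo.
    have [z _] := @cpath0_ex R T W; exists z => n t tT.
    by rewrite einf gt0_muley ?leey// lte_fin divr_gt0// exprn_gt0.
  have fe : e w \is a fin_num by rewrite ge0_fin_numE// lt_neqAle efin leey.
  pose s := Num.sqrt (fine (e w)); have s0 : (0 <= s)%R by exact: sqrtr_ge0.
  have se : (s ^+ 2 = fine (e w))%R by rewrite sqr_sqrtr// fine_ge0.
  have step n t : (0 <= t <= T)%R -> (`|Y n.+1 t w - Y n t w| <= s / 2 ^+ n)%R.
    move=> tT; have p2 : (0 < 2 ^+ n :> R)%R by rewrite exprn_gt0.
    rewrite ler_pdivlMr// -ler_sqr ?nnegrE ?mulr_ge0 ?(ltW p2)// exprMn se -lee_fin fineK//.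
    have -> : ((2 ^+ n) ^+ 2 = 4 ^+ n :> R)%R by rewrite -exprM mulnC exprM; congr (_ ^+ _)%R; ring.
    rewrite mulrC EFinM.
    apply: (@le_trans _ _ ((4 ^+ n)%:E * d n w)).
      by apply: lee_wpmul2l; [rewrite lee_fin exprn_ge0|exact: (sup_sqr_ge (fun t w => Y n.+1 t w - Y n t w)%R)].
    apply: (@le_trans _ _ (\sum_(0 <= k < n.+1) (4 ^+ k)%:E * d k w)).
      by rewrite big_nat_recr//= leeDr// sume_ge0.
    by apply: (nneseries_lim_ge (P := predT)) => k _ _.
  have [z hz] := @fast_cauchy_cpath (fun n t => Y n t w) s s0 (fun n => uY n w) step.
  exists z => n t tT; rewrite -(fineK fe) -EFinM lee_fin -se.
  have -> : (4 / 4 ^+ n * s ^+ 2 = (2 * s / 2 ^+ n) ^+ 2)%R.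
    rewrite expr_div_n exprMn -!exprM mulnC exprM; have -> : (2 ^+ 2 = 4 :> R)%R by ring.
    by rewrite mulrAC.
  by rewrite ler_sqr ?nnegrE ?hz// divr_ge0 ?mulr_ge0// exprn_ge0.
have [Z hZ] := choice ex; exists Z => n.
rewrite N2E; apply: (@le_trans _ _ (outer_E P (fun w => (4 / 4 ^+ n)%:E * e w))).
  by apply: (outer_E_le T0) => w _; apply: sup_sqr_le => t tT; exact: hZ.
have p0 : (0 <= 4 / 4 ^+ n :> R)%R by rewrite divr_ge0// exprn_ge0.
apply: le_trans (outer_E_scale T0 sepH p0 _) _ => //.
apply: (@le_trans _ _ ((4 / 4 ^+ n)%:E * (2 * D)%:E)).
  by apply: lee_wpmul2l => //; rewrite lee_fin divr_ge0// exprn_ge0.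
rewrite -EFinM lee_fin mulrAC; have -> : (4 * (2 * D) = 8 * D)%R by ring.
by [].
Qed.

End Completeness.

(** * The Euler scheme *)

Lemma double_sqr_ge0 {R : realType} (x : R) : 0 <= 2 * x ^+ 2.
Proof. by rewrite mulr_ge0// sqr_ge0. Qed.

Section SquareBounds.
Context {R : realType} {T : R} {H : hilbertType R} {W W' : normedModType R}.
Hypotheses (T0 : 0 < T) (sepH : separable H).
Local Notation Omega := (Omega T H).
Variable P : set Omega.
Local Open Scope ereal_scope.

Lemma Esq_le_affine (X : Omega -> W) (Y : Omega -> W') (a b : R) : (0 <= a)%R -> (0 <= b)%R ->
  (forall w, P w -> (`|X w| ^+ 2 <= a + b * `|Y w| ^+ 2)%R) ->
  Esq P X <= a%:E + b%:E * Esq P Y.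
Proof.
move=> a0 b0 h; rewrite !EsqE.
have h1 := @outer_E_lin R T H T0 sepH P 1 b (fun=> a%:E) (fun w => (`|Y w| ^+ 2)%:E)
  (fun w => (`|X w| ^+ 2)%:E) ler01 b0.
apply: le_trans (h1 _ _ _) _ => [w _|w _|w Pw|].
- by rewrite lee_fin.
- by rewrite lee_fin sqr_ge0.
- by rewrite -!EFinM -EFinD lee_fin mul1r h.
by rewrite mul1e leeD2r// outer_E_le_cst.
Qed.

Lemma N2_le_affine u (X : R -> Omega -> W) (Y : R -> Omega -> W') (a b : R) : (0 <= u)%R ->
  (0 <= a)%R -> (0 <= b)%R ->
  (forall t w, P w -> (0 <= t <= u)%R -> (`|X t w| ^+ 2 <= a + b * `|Y t w| ^+ 2)%R) ->
  N2 P u X <= a%:E + b%:E * N2 P u Y.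
Proof.
move=> u0 a0 b0 h; rewrite !N2E.
have h1 := @outer_E_lin R T H T0 sepH P 1 b (fun=> a%:E) (sup_sqr u Y) (sup_sqr u X) ler01 b0.
apply: le_trans (h1 _ _ _) _ => [w _|w _|w Pw|].
- by rewrite lee_fin.
- exact: sup_sqr_ge0.
- rewrite mul1e; apply: sup_sqr_le => t tu.
  apply: (@le_trans _ _ (a%:E + b%:E * (`|Y t w| ^+ 2)%:E)).
    by rewrite -EFinM -EFinD lee_fin h.
  by rewrite leeD2l// lee_wpmul2l ?lee_fin// sup_sqr_ge.
by rewrite mul1e leeD2r// outer_E_le_cst.
Qed.

End SquareBounds.

Section ElementaryEnergy.
Context {R : realType} {T : R} {H : hilbertType R} {V W : normedModType R}.
Hypotheses (T0 : 0 < T) (sepH : separable H).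
Local Notation Omega := (Omega T H).
Variable P : set Omega.
Local Open Scope ereal_scope.

(** The energy bound for f 1_(u, v]: the upper integral is split at u and v, and only ]u, v]
    contributes, at most a (v - u). *)
Lemma elementary_energy (C a : R) (N : R -> Omega -> V) (f : Omega -> 'L(V, W)) u v :
  (0 <= C)%R -> energy_bound (W := W) P C N -> (0 <= u)%R -> (u <= v <= T)%R -> cadapted u f ->
  (0 <= a)%R -> Esq P f <= a%:E ->
  Esq P (fun w => f w (N v w - N u w)%R) <= (C * (a * (v - u)))%:E.
Proof.
move=> C0 eN u0 uv cf a0 fa; have [uv' vT] := andP uv; have v0 := le_trans u0 uv'.
have TT : (0 <= T <= T)%R by rewrite ltW//= lexx.
have hF : in_Hsc (elementary u v f) by exact: elementary_in_Hsc.
have vT' : (0 <= v <= T)%R by rewrite v0.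
have h1 := Esq_le_N2 T0 P (simple_int (elementary u v f) N) vT'.
rewrite (_ : simple_int _ N v = fun w => f w (N v w - N u w)%R) in h1; last first.
  by apply/funext => w; rewrite elementary_int// minxx min_l.
apply: le_trans h1 _; apply: le_trans (eN _ _ hF TT) _; rewrite EFinM.
apply: lee_wpmul2l; first by rewrite lee_fin.
rewrite I2E.
have f0 x : 0 <= Esq P (simple_proc (elementary u v f) x) by exact: Esq_ge0.
have out x : ~~ (u < x <= v)%R -> Esq P (simple_proc (elementary u v f) x) = 0.
  by move=> h; apply: (Esq_eq0 T0) => w _; rewrite elementary_proc// (negbTE h).
apply: le_trans (ui_split v0 vT (lexx 0%R) (fun x _ => f0 x) _) _.
  by move=> x /andP[vx _]; rewrite out// negb_and (lt_geF vx) orbT.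
rewrite mul0r adde0; apply: le_trans (ui_split u0 uv' a0 (fun x _ => f0 x) _) _.
  move=> x ux; apply: le_trans fa; rewrite le_eqVlt; apply/orP; left; apply/eqP; congr Esq.
  by apply/funext => w; rewrite elementary_proc// ux.
rewrite -[leRHS]add0e leeD2r//.
apply: le_trans (ui_cst u0 (lexx 0%R) (fun x _ => f0 x) _) _; last by rewrite mul0r.
by move=> x /andP[_ xu]; rewrite out// negb_and -leNgt xu.
Qed.

Lemma energy_bound_le (C C' : R) (N : R -> Omega -> V) : (C <= C')%R ->
  energy_bound (W := W) P C N -> energy_bound (W := W) P C' N.
Proof.
move=> CC eN F u hF uT; apply: le_trans (eN F u hF uT) _.
by apply: lee_wpmul2r; rewrite ?I2_ge0// lee_fin.
Qed.

End ElementaryEnergy.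

Section EulerScheme.
Context {R : realType} {T : R} {H K : hilbertType R}.
Hypotheses (T0 : 0 < T) (sepH : separable H).
Local Notation Omega := (Omega T H).
Variables (P : set Omega) (A : R -> Omega -> R^o) (C L : R) (x0 : K).
Variables (mu : R -> K -> 'L(R^o, K)) (sigma : R -> K -> 'L(H, K)).
Hypotheses (C0 : 0 <= C) (L0 : 0 <= L).
Hypotheses (iA : integrator A) (eA : energy_bound (W := K) P C A).
Hypotheses (eS : energy_bound (W := K) P C (@procS R T H)).

Definition lipschitz_coef {V W : normedModType R} (phi : R -> K -> 'L(V, W)) :=
  forall t t' k k', 0 <= t <= T -> 0 <= t' <= T ->
    `|phi t k - phi t' k'| <= L * (`|t - t'| + `|k - k'|).

Hypotheses (lmu : lipschitz_coef mu) (lsigma : lipschitz_coef sigma).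

Fixpoint euler (p : nat -> R) (n : nat) (w : Omega) : K :=
  if n is m.+1 then euler p m w + mu (p m) (euler p m w) (A (p n) w - A (p m) w) +
    sigma (p m) (euler p m w) (procS (p n) w - procS (p m) w)
  else x0.

(** The coefficient phi is general because, besides [mu] and [sigma], the Riesz map is frozen too,
    which yields approximants of the solution itself. *)
Definition frozen {V W : normedModType R} (phi : R -> K -> 'L(V, W)) (p : nat -> R) : @simple R T H V W :=
  Simple (fun n _ => p n) (fun n w => phi (p n) (euler p n w)).

(** Interpolates the scheme by its own integrals, so that it solves an equation with frozen
    coefficients at all times; [euler_path_grid] identifies its values at the grid times. *)
Definition euler_path p t w : K :=
  x0 + simple_int (frozen mu p) A t w + simple_int (frozen sigma p) (@procS R T H) t w.

Lemma lipschitz_continuous {V W : normedModType R} (phi : R -> K -> 'L(V, W)) t :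
  lipschitz_coef phi -> 0 <= t <= T -> continuous (phi t).
Proof.
move=> lp tT; apply/norm_continuousP => x e e0; exists (e / (L + 1)).
  by rewrite divr_gt0// ltr_wpDl.
move=> y; rewrite ltr_pdivlMr ?ltr_wpDl// => h.
apply: le_lt_trans (lp _ _ _ _ tT tT) _; rewrite subrr normr0 add0r mulrC.
by apply: le_lt_trans h; rewrite ler_wpM2l// lerDl.
Qed.

Section Grid.
Variable p : nat -> R.
Hypothesis gp : grid T p.

Let p0 n : 0 <= p n. Proof. by case/andP: (grid_bounds n gp). Qed.

Let pS n : p n <= p n.+1. Proof. by have [_ /(_ n)/andP[]] := gp. Qed.

Lemma euler_cadapted n : cadapted (p n) (euler p n).
Proof.
elim: n => [|n ih]; first exact: cadapted_cst.
have cD (f g : Omega -> K) u : cadapted u f -> cadapted u g -> cadapted u (fun w => f w + g w).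
  move=> [cf fu] [cg gu]; split; first exact: continuousD_Omega.
  by move=> w; rewrite fu gu.
have cI (V : normedModType R) (phi : R -> K -> 'L(V, K)) (N : R -> Omega -> V) :
    lipschitz_coef phi -> integrator N ->
    cadapted (p n.+1) (fun w => phi (p n) (euler p n w) (N (p n.+1) w - N (p n) w)).
  move=> lp [_ cN]; apply: cadapted_blin.
    apply: cadapted_comp; first exact: lipschitz_continuous (grid_bounds n gp).
    exact: cadapted_le (pS n) ih.
  have [c1 c2] := (cN _ (grid_bounds n.+1 gp), cadapted_le (p0 n) (pS n) (cN _ (grid_bounds n gp))).
  split; last by move=> w; rewrite c1.2 c2.2.
  apply: continuousD_Omega c1.1 _ => w.
  by apply: (@cvgN _ _ _ _ (nbhs_filter w)); exact: c2.1.
apply: (cD (fun w => euler p n w + mu (p n) (euler p n w) (A (p n.+1) w - A (p n) w))).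
  by apply: cD; [exact: cadapted_le (pS n) ih|exact: cI].
by apply: cI => //; exact: procS_integrator.
Qed.

Lemma frozen_cadapted {V W : normedModType R} (phi : R -> K -> 'L(V, W)) n : lipschitz_coef phi ->
  cadapted (p n) (scoef (frozen phi p) n).
Proof.
move=> lp; apply: cadapted_comp (euler_cadapted n).
exact: lipschitz_continuous (grid_bounds n gp).
Qed.

Lemma frozen_in_Hsc {V W : normedModType R} (phi : R -> K -> 'L(V, W)) : lipschitz_coef phi ->
  in_Hsc (frozen phi p).
Proof.
by move=> lp; apply/(in_HscP T0 sepH); exists p; split=> // n; split=> //; exact: frozen_cadapted.
Qed.

Lemma frozen_grid {V W : normedModType R} (phi : R -> K -> 'L(V, W)) : simple_grid (frozen phi p).
Proof. by []. Qed.

Lemma frozen_proc {V W : normedModType R} (phi : R -> K -> 'L(V, W)) n s w : p n < s <= p n.+1 ->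
  simple_proc (frozen phi p) s w = phi (p n) (euler p n w).
Proof. by move=> ps; rewrite (@simple_procE _ _ _ _ _ (frozen phi p) s w n). Qed.

Lemma euler_path_incr n s w : p n <= s <= p n.+1 -> euler_path p s w - euler_path p (p n) w =
  mu (p n) (euler p n w) (A s w - A (p n) w) +
  sigma (p n) (euler p n w) (procS s w - procS (p n) w).
Proof.
move=> /andP[ps sp]; rewrite /euler_path.
have h (V : normedModType R) (phi : R -> K -> 'L(V, K)) N : simple_int (frozen phi p) N s w -
    simple_int (frozen phi p) N (p n) w = phi (p n) (euler p n w) (N s w - N (p n) w).
  by rewrite (@simple_int_incr _ _ _ _ _ (frozen phi p) N w n).
by rewrite opprD addrACA h [x0 + _]addrC [x0 + _]addrC opprD addrACA h subrr addr0.
Qed.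

Lemma euler_path_grid n w : euler_path p (p n) w = euler p n w.
Proof.
elim: n => [|n ih].
  by have [-> _ _] := gp; rewrite /euler_path !simple_int0 ?addr0//; exact: frozen_grid.
have pn : p n <= p n.+1 <= p n.+1 by rewrite pS lexx.
by rewrite -[LHS](subrK (euler_path p (p n) w)) (euler_path_incr w pn) ih addrC addrA.
Qed.

End Grid.

Local Open Scope ereal_scope.

(** One constant for both coefficients, from |phi t k| <= |phi 0 0| + L T + L |k|. *)
Definition growth : R := (`|mu 0 0| + `|sigma 0 0| + L * T)%R.

Lemma growth_ge0 : (0 <= growth)%R.
Proof. by rewrite !addr_ge0// mulr_ge0// ltW. Qed.

Definition linear_growth {V W : normedModType R} (phi : R -> K -> 'L(V, W)) :=
  forall t k, (0 <= t <= T)%R -> (`|phi t k| <= growth + L * `|k|)%R.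

Lemma lipschitz_growth {V W : normedModType R} (phi : R -> K -> 'L(V, W)) : lipschitz_coef phi ->
  (`|phi 0 0| <= `|mu 0 0| + `|sigma 0 0|)%R -> linear_growth phi.
Proof.
move=> lp h t k tT; have T00 : (0 <= (0 : R) <= T)%R by rewrite lexx ltW.
have := lp _ _ k 0%R tT T00; rewrite !subr0 => h1; rewrite -[phi t k](subrK (phi 0%R 0%R)).
apply: le_trans (ler_normD _ _) _; have [t0 tT'] := andP tT.
apply: le_trans (lerD h1 h) _; rewrite /growth (ger0_norm t0) mulrDr.
have : (L * t <= L * T)%R by rewrite ler_wpM2l.
by move: (L * t)%R (L * T)%R (L * _)%R (`|mu 0%R 0%R|)%R (`|sigma 0%R 0%R|)%R => a b d e f; lra.
Qed.

Lemma mu_growth : linear_growth mu.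
Proof. by apply: lipschitz_growth => //; rewrite lerDl. Qed.

Lemma sigma_growth : linear_growth sigma.
Proof. by apply: lipschitz_growth => //; rewrite lerDr. Qed.

Lemma coef_Esq {V W : normedModType R} (phi : R -> K -> 'L(V, W)) t (X : Omega -> K) :
  linear_growth phi -> (0 <= t <= T)%R ->
  Esq P (fun w => phi t (X w)) <= (2 * growth ^+ 2)%:E + (2 * L ^+ 2)%:E * Esq P X.
Proof.
move=> gphi tT; apply: (Esq_le_affine T0 sepH); rewrite ?double_sqr_ge0// => w _.
have h := gphi t (X w) tT.
apply: (@le_trans _ _ ((growth + L * `|X w|) ^+ 2))%R.
  by rewrite ler_sqr ?nnegrE// addr_ge0 ?mulr_ge0// growth_ge0.
have := sqr_ge0 (growth - L * `|X w|)%R; move: growth (`|X w|)%R => g x; nra.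
Qed.

Lemma coef_Esq_bound {V W : normedModType R} (phi : R -> K -> 'L(V, W)) t (X : Omega -> K) (b : R) :
  linear_growth phi -> (0 <= t <= T)%R -> Esq P X <= b%:E ->
  Esq P (fun w => phi t (X w)) <= (2 * growth ^+ 2 + 2 * L ^+ 2 * b)%:E.
Proof.
move=> gphi tT Xb; apply: le_trans (coef_Esq X gphi tT) _.
apply: (@le_trans _ _ ((2 * growth ^+ 2)%:E + (2 * L ^+ 2)%:E * b%:E)).
  by apply: leeD => //; apply: lee_wpmul2l; rewrite ?lee_fin ?double_sqr_ge0.
by rewrite -EFinM -EFinD.
Qed.

Lemma coef_dist_Esq {V W : normedModType R} (phi : R -> K -> 'L(V, W)) s t (X Y : Omega -> K) :
  lipschitz_coef phi -> (0 <= s <= T)%R -> (0 <= t <= T)%R ->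
  Esq P (fun w => phi s (X w) - phi t (Y w))%R <=
  (2 * L ^+ 2 * `|s - t| ^+ 2)%:E + (2 * L ^+ 2)%:E * Esq P (fun w => X w - Y w)%R.
Proof.
move=> lp sT tT; apply: (Esq_le_affine T0 sepH); rewrite ?(mulr_ge0 (double_sqr_ge0 L)) ?double_sqr_ge0 ?sqr_ge0// => w _.
have h := lp s t (X w) (Y w) sT tT.
apply: (@le_trans _ _ ((L * (`|s - t| + `|X w - Y w|)) ^+ 2))%R.
  by rewrite ler_sqr ?nnegrE ?mulr_ge0 ?addr_ge0.
have L2 := sqr_ge0 L; have := sqr_ge0 (`|s - t| - `|X w - Y w|)%R.
rewrite exprMn; move: (`|s - t|)%R (`|X w - Y w|)%R => a b h2.
rewrite -subr_ge0 (_ : _ - _ = L ^+ 2 * (a - b) ^+ 2)%R; last by ring.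
by rewrite mulr_ge0.
Qed.

(** Gives finiteness only, with a bound depending on the grid; through [euler_path_lty] it supplies
    the finiteness hypothesis of Gronwall's inequality. *)
Lemma euler_Esq p n : grid T p -> exists2 b : R, (0 <= b)%R & Esq P (euler p n) <= b%:E.
Proof.
move=> gp; elim: n => [|n [b b0 hb]].
  exists (`|x0| ^+ 2)%R; first exact: sqr_ge0.
  by rewrite EsqE; apply: outer_E_le_cst => //; exact: sqr_ge0.
have /andP[p0 pT] := grid_bounds n gp; have [_ /(_ n) pp _] := gp.
pose a := (2 * growth ^+ 2 + 2 * L ^+ 2 * b)%R.
have a0 : (0 <= a)%R.
  by rewrite addr_ge0 ?(mulr_ge0 (double_sqr_ge0 L)) ?double_sqr_ge0.
pose m := (C * (a * (p n.+1 - p n)))%R.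
have m0 : (0 <= m)%R by rewrite !mulr_ge0// subr_ge0; case/andP: pp.
have ha (V : normedModType R) (phi : R -> K -> 'L(V, K)) : linear_growth phi ->
    Esq P (fun w => phi (p n) (euler p n w)) <= a%:E.
  by move=> gphi; exact: coef_Esq_bound gphi (grid_bounds n gp) hb.
have hmu := elementary_energy T0 sepH C0 eA p0 pp (frozen_cadapted gp n lmu) a0 (ha _ _ mu_growth).
have hsi := elementary_energy T0 sepH C0 eS p0 pp (frozen_cadapted gp n lsigma) a0 (ha _ _ sigma_growth).
exists (2 * (2 * b + 2 * m) + 2 * m)%R; first by apply: addr_ge0; [apply: mulr_ge0 => //; apply: addr_ge0|]; exact: mulr_ge0.
apply: le_trans (EsqD T0 sepH P (fun w => euler p n w + mu (p n) (euler p n w) (A (p n.+1) w - A (p n) w))%R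
  (fun w => sigma (p n) (euler p n w) (procS (p n.+1) w - procS (p n) w))%R) _.
apply: (@le_trans _ _ ((2 * (2 * b + 2 * m))%:E + (2 * m)%:E)); last by rewrite -EFinD.
apply: leeD; last by rewrite EFinM; exact: (lee_wpmul2l _ hsi).
rewrite EFinM; apply: lee_wpmul2l => //.
apply: le_trans (EsqD T0 sepH P (euler p n) (fun w => mu (p n) (euler p n w) (A (p n.+1) w - A (p n) w))%R) _.
apply: (@le_trans _ _ ((2 * b)%:E + (2 * m)%:E)); last by rewrite -EFinD.
by apply: leeD; rewrite EFinM; [exact: (lee_wpmul2l _ hb)|exact: (lee_wpmul2l _ hmu)].
Qed.

Lemma frozen_I2 {V W : normedModType R} (phi : R -> K -> 'L(V, W)) p u : grid T p ->
  linear_growth phi -> (0 <= u <= T)%R ->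
  I2 P u (simple_proc (frozen phi p)) <=
  (2 * growth ^+ 2 * u)%:E + (2 * L ^+ 2)%:E * ui u (fun s => N2 P s (euler_path p)).
Proof.
move=> gp gphi /andP[u0 uT].
have c1 : (0 <= 2 * growth ^+ 2)%R by rewrite mulr_ge0// sqr_ge0.
have c2 : (0 <= 2 * L ^+ 2)%R by rewrite mulr_ge0// sqr_ge0.
have n0 (x : R) : 0 <= (2 * L ^+ 2)%:E * N2 P x (euler_path p).
  by rewrite mule_ge0 ?lee_fin ?N2_ge0.
apply: (@le_trans _ _ (ui u (fun s => (2 * growth ^+ 2)%:E + (2 * L ^+ 2)%:E * N2 P s (euler_path p)))).
  rewrite I2E; apply: ui_le => x /andP[xu0 xu].
  have [->|xn0] := eqVneq x 0%R.
    rewrite Esq_eq0 ?adde_ge0 ?lee_fin// => w _.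
    by rewrite simple_proc_out ?ltxx//; exact: frozen_grid.
  have [n xn] : exists n, (p n < x <= p n.+1)%R.
    by apply: (grid_bracket_oc gp); rewrite lt_neqAle eq_sym xn0 xu0 (le_trans xu).
  have [px _] := andP xn; have [pn0 pnT] := andP (grid_bounds n gp).
  rewrite (_ : simple_proc _ x = fun w => phi (p n) (euler p n w)); last first.
    by apply/funext => w; exact: frozen_proc.
  apply: le_trans (coef_Esq _ gphi (grid_bounds n gp)) _; rewrite leeD2l// lee_wpmul2l//.
  rewrite (_ : euler p n = euler_path p (p n)); last by apply/funext => w; rewrite euler_path_grid.
  by apply: (Esq_le_N2 T0); rewrite pn0 ltW.
apply: le_trans (uiD (fun _ _ => _) (fun x _ => n0 x)) _; first by rewrite lee_fin.
apply: leeD; first by apply: (ui_cst u0 c1).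
by apply: uiZ => // x _; exact: N2_ge0.
Qed.

Lemma euler_path_N2 p u : (0 <= u)%R -> N2 P u (euler_path p) <= (4 * `|x0| ^+ 2)%:E +
  (4%:E * N2 P u (simple_int (frozen mu p) A) + 2%:E * N2 P u (simple_int (frozen sigma p) (@procS R T H))).
Proof.
move=> u0; apply: le_trans (N2D T0 sepH P (fun t w => x0 + simple_int (frozen mu p) A t w)%R _ u0) _.
rewrite addeA; apply: leeD => //.
have h : N2 P u (fun t w => x0 + simple_int (frozen mu p) A t w)%R <=
    (2 * `|x0| ^+ 2)%:E + 2%:E * N2 P u (simple_int (frozen mu p) A).
  apply: (N2_le_affine T0 sepH); rewrite ?mulr_ge0 ?sqr_ge0// => t w _ _.
  exact: sqr_normD2.
apply: le_trans (lee_wpmul2l _ h) _ => //.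
rewrite ge0_muleDr ?mule_ge0 ?N2_ge0 ?lee_fin ?mulr_ge0 ?sqr_ge0//.
rewrite muleA -!EFinM mulrA; have -> : (2 * 2 = 4 :> R)%R by ring.
by [].
Qed.

Lemma euler_path_lty p : grid T p -> N2 P T (euler_path p) < +oo.
Proof.
move=> gp; have [_ _ [M pM]] := gp; have TT : (0 <= T <= T)%R by rewrite ltW//= lexx.
have /choice[b hb] n : exists b : R, (0 <= b)%R /\ Esq P (euler p n) <= b%:E.
  by have [b b0 hb] := euler_Esq n gp; exists b.
pose B := (\sum_(n < M) b n)%R.
have b0 n : (0 <= b n)%R by case: (hb n).
have B0 : (0 <= B)%R by apply: sumr_ge0.
have a0 : (0 <= 2 * growth ^+ 2 + 2 * L ^+ 2 * B)%R.
  by rewrite addr_ge0 ?(mulr_ge0 (double_sqr_ge0 L)) ?double_sqr_ge0.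
have fin (V : normedModType R) (phi : R -> K -> 'L(V, K)) : linear_growth phi ->
    I2 P T (simple_proc (frozen phi p)) < +oo.
  move=> gphi; suff : I2 P T (simple_proc (frozen phi p)) <= ((2 * growth ^+ 2 + 2 * L ^+ 2 * B) * T)%:E.
    by move=> h; apply: le_lt_trans h (ltry _).
  apply: I2_le_cst => //; first exact: ltW.
  move=> x xT.
  have [n xn] := grid_bracket_oc gp xT.
  rewrite (_ : simple_proc _ x = fun w => phi (p n) (euler p n w)); last first.
    by apply/funext => w; exact: frozen_proc.
  apply: coef_Esq_bound gphi (grid_bounds n gp) _.
  have nM : (n < M)%N.
    rewrite ltnNge; apply/negP => Mn; have := andP xn => -[+ _].
    by rewrite (grid_end gp pM Mn) ltNge; case/andP: xT => _ ->.
  case: (hb n) => _ /le_trans -> //; rewrite lee_fin /B (bigD1 (Ordinal nM))//= lerDl.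
  by apply: sumr_ge0.
apply: le_lt_trans (euler_path_N2 p (ltW T0)) _.
have l (V : normedModType R) (phi : R -> K -> 'L(V, K)) N k : lipschitz_coef phi -> linear_growth phi ->
    energy_bound (W := K) P C N -> (0 <= k)%R -> k%:E * N2 P T (simple_int (frozen phi p) N) < +oo.
  move=> lp gphi eN k0; apply: lte_mul_pinfty; rewrite ?lee_fin//.
  apply: le_lt_trans (eN _ _ (frozen_in_Hsc gp lp) TT) _; apply: lte_mul_pinfty; rewrite ?lee_fin//.
  exact: fin.
by rewrite lte_add_pinfty ?ltry// lte_add_pinfty// l//; [exact: mu_growth|exact: sigma_growth].
Qed.

(** Gronwall's inequality for the expected squared supremum up to t makes the bound uniform over all
    grids. The factor 6 is the 4 + 2 of [euler_path_N2]. *)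
Lemma euler_apriori : exists2 B : R, (0 <= B)%R & forall p, grid T p -> N2 P T (euler_path p) <= B%:E.
Proof.
pose a := (4 * `|x0| ^+ 2 + 6 * C * (2 * growth ^+ 2 * T))%R.
pose D := (6 * C * (2 * L ^+ 2))%R.
have D0 : (0 <= D)%R by rewrite mulr_ge0 ?double_sqr_ge0// mulr_ge0.
have [M M0 hM] := gronwall D0 (ltW T0).
have g20 : (0 <= 2 * growth ^+ 2)%R by rewrite mulr_ge0// sqr_ge0.
have a0 : (0 <= a)%R.
  rewrite addr_ge0// mulr_ge0 ?sqr_ge0 ?(mulr_ge0 g20 (ltW T0))// mulr_ge0 //.
exists (M * a)%R; first by rewrite mulr_ge0.
move=> p gp; apply: (hM (fun t => N2 P t (euler_path p))) => //.
- by move=> t _; exact: N2_ge0.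
- by move=> s t /andP[_ st] _; exact: N2_mono.
- exact: euler_path_lty.
move=> t tT; have [t0 tT'] := andP tT; set u := ui t _.
have u0 : 0 <= u by apply: ui_ge0 => x _; exact: N2_ge0.
have bnd (V : normedModType R) (phi : R -> K -> 'L(V, K)) N : lipschitz_coef phi -> linear_growth phi ->
    energy_bound (W := K) P C N -> N2 P t (simple_int (frozen phi p) N) <=
    C%:E * ((2 * growth ^+ 2 * T)%:E + (2 * L ^+ 2)%:E * u).
  move=> lp gphi eN; apply: le_trans (eN _ _ (frozen_in_Hsc gp lp) tT) _.
  apply: lee_wpmul2l; first by rewrite lee_fin.
  apply: le_trans (frozen_I2 gp gphi tT) _; apply: leeD => //.
  by rewrite lee_fin ler_wpM2l.
have aE : a%:E = (4 * `|x0| ^+ 2)%:E + (6 * C * (2 * growth ^+ 2 * T))%:E by [].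
apply: le_trans (euler_path_N2 p t0) _; rewrite aE -addeA leeD2l//.
have h1 := lee_wpmul2l (_ : 0 <= 4%:E) (bnd _ _ _ lmu mu_growth eA).
have h2 := lee_wpmul2l (_ : 0 <= 2%:E) (bnd _ _ _ lsigma sigma_growth eS).
apply: (@le_trans _ _ (4%:E * (C%:E * ((2 * growth ^+ 2 * T)%:E + (2 * L ^+ 2)%:E * u)) +
    2%:E * (C%:E * ((2 * growth ^+ 2 * T)%:E + (2 * L ^+ 2)%:E * u)))).
  by apply: leeD; [apply: h1|apply: h2]; rewrite lee_fin.
have c2 : 0 <= (2 * growth ^+ 2 * T)%:E by rewrite lee_fin mulr_ge0// ltW.
have c3 : 0 <= (2 * L ^+ 2)%:E * u by rewrite mule_ge0// lee_fin mulr_ge0 ?sqr_ge0.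
rewrite -ge0_muleDl ?lee_fin// -EFinD muleA -EFinM ge0_muleDr// muleA -!EFinM.
by rewrite /D (_ : (4 + 2) = 6 :> R)%R//; ring.
Qed.

Section Bounded.
Variable B : R.
Hypotheses (B0 : (0 <= B)%R) (hB : forall p, grid T p -> N2 P T (euler_path p) <= B%:E).

Definition coef_bound : R := (2 * growth ^+ 2 + 2 * L ^+ 2 * B)%R.

Lemma coef_bound_ge0 : (0 <= coef_bound)%R.
Proof. by rewrite addr_ge0 ?double_sqr_ge0// mulr_ge0// double_sqr_ge0. Qed.

Lemma euler_Esq_bound p n : grid T p -> Esq P (euler p n) <= B%:E.
Proof.
move=> gp; apply: le_trans (hB gp).
rewrite (_ : euler p n = euler_path p (p n)); last by apply/funext => w; rewrite euler_path_grid.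
exact: (Esq_le_N2 T0) (grid_bounds n gp).
Qed.

(** By [elementary_energy] for each of the two integrals, the squared increment since the last grid
    time is of the order of the elapsed time. *)
Lemma euler_step_Esq p n s : grid T p -> (p n <= s <= p n.+1)%R ->
  Esq P (fun w => euler_path p s w - euler p n w)%R <= (4 * C * coef_bound * (s - p n))%:E.
Proof.
move=> gp ps; have /andP[p0 pT] := grid_bounds n gp; have [ps1 ps2] := andP ps.
have sT : (p n <= s <= T)%R by rewrite ps1 (le_trans ps2)//; case/andP: (grid_bounds n.+1 gp).
have ha (V : normedModType R) (phi : R -> K -> 'L(V, K)) : linear_growth phi ->
    Esq P (fun w => phi (p n) (euler p n w)) <= coef_bound%:E.
  by move=> gphi; exact: coef_Esq_bound gphi (grid_bounds n gp) (euler_Esq_bound n gp).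
have hmu := elementary_energy T0 sepH C0 eA p0 sT (frozen_cadapted gp n lmu) coef_bound_ge0 (ha _ _ mu_growth).
have hsi := elementary_energy T0 sepH C0 eS p0 sT (frozen_cadapted gp n lsigma) coef_bound_ge0 (ha _ _ sigma_growth).
rewrite (_ : (fun w => _) = (fun w => mu (p n) (euler p n w) (A s w - A (p n) w) +
    sigma (p n) (euler p n w) (procS s w - procS (p n) w))%R); last first.
  by apply/funext => w; rewrite -(euler_path_grid gp n w) (euler_path_incr gp w ps) euler_path_grid.
apply: le_trans (EsqD T0 sepH P _ _) _.
apply: (@le_trans _ _ ((2 * (C * (coef_bound * (s - p n))))%:E + (2 * (C * (coef_bound * (s - p n))))%:E)).
  by apply: leeD; rewrite EFinM; apply: lee_wpmul2l.
by rewrite -EFinD lee_fin; move: coef_bound => z; rewrite le_eqVlt; apply/orP; left; apply/eqP; ring.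
Qed.

Definition defect_cst : R := (2 * L ^+ 2 * T + 2 * L ^+ 2 * (4 * C * coef_bound))%R.

Lemma defect_cst_ge0 : (0 <= defect_cst)%R.
Proof.
have h := coef_bound_ge0; have h2 := double_sqr_ge0 L.
by rewrite addr_ge0// mulr_ge0// ?(ltW T0)// mulr_ge0// mulr_ge0.
Qed.

(** Freezing costs the time lag, with |s - p_n|^2 <= T d, and the increment of the scheme since p_n,
    whose square is of order d. *)
Lemma frozen_defect {V W : normedModType R} (phi : R -> K -> 'L(V, W)) p (d s : R) : lipschitz_coef phi ->
  grid T p -> (forall n, p n.+1 <= p n + d)%R -> (0 <= d <= T)%R -> (0 < s <= T)%R ->
  Esq P (fun w => simple_proc (frozen phi p) s w - phi s (euler_path p s w))%R <= (defect_cst * d)%:E.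
Proof.
move=> lp gp pd /andP[d0 dT] sT; have [n /andP[ps1 ps2]] := grid_bracket_oc gp sT.
have ps : (p n <= s <= p n.+1)%R by rewrite (ltW ps1).
have sT' : (0 <= s <= T)%R by case/andP: sT => /ltW ->.
rewrite (_ : (fun w => _) = (fun w => phi (p n) (euler p n w) - phi s (euler_path p s w))%R); last first.
  by apply/funext => w; rewrite (frozen_proc gp phi (n := n))// ps1.
apply: le_trans (coef_dist_Esq _ _ lp (grid_bounds n gp) sT') _.
have h := euler_step_Esq gp ps.
have sd : (s - p n <= d)%R by rewrite lerBlDl (le_trans ps2).
have sp0 : (0 <= s - p n)%R by rewrite subr_ge0 ltW.
apply: (@le_trans _ _ ((2 * L ^+ 2 * (T * d))%:E + (2 * L ^+ 2)%:E * (4 * C * coef_bound * d)%:E)).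
  apply: leeD.
    rewrite lee_fin ler_wpM2l ?double_sqr_ge0// distrC ger0_norm//.
    by rewrite expr2 ler_pM// (le_trans sd).
  apply: lee_wpmul2l; first by rewrite lee_fin double_sqr_ge0.
  rewrite (_ : Esq P _ = Esq P (fun w => euler_path p s w - euler p n w)%R); last first.
    by rewrite !EsqE; congr outer_E; apply/funext => w; rewrite distrC.
  apply: le_trans h _; rewrite lee_fin ler_wpM2l// mulr_ge0 ?coef_bound_ge0// mulr_ge0//.
by rewrite -EFinM -EFinD lee_fin /defect_cst; move: coef_bound => z; rewrite le_eqVlt; apply/orP; left; apply/eqP; ring.
Qed.

(** Passes through phi evaluated along the two paths: freezing errors of order d and d' at the ends,
    and in the middle the Lipschitz bound in terms of the distance of the paths. *)
Lemma frozen_diff {V W : normedModType R} (phi : R -> K -> 'L(V, W)) p p' (d d' u : R) : lipschitz_coef phi ->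
  grid T p -> (forall n, p n.+1 <= p n + d)%R -> (0 <= d <= T)%R ->
  grid T p' -> (forall n, p' n.+1 <= p' n + d')%R -> (0 <= d' <= T)%R -> (0 <= u <= T)%R ->
  I2 P u (fun t w => simple_proc (frozen phi p) t w - simple_proc (frozen phi p') t w)%R <=
  (4 * defect_cst * (d + d') * T)%:E +
  (8 * L ^+ 2)%:E * ui u (fun s => N2 P s (fun t w => euler_path p t w - euler_path p' t w)%R).
Proof.
move=> lp gp pd dT gp' pd' dT' /andP[u0 uT].
set g := fun s => N2 P s _; have g0 s : 0 <= g s by exact: N2_ge0.
have L2 := double_sqr_ge0 L.
have L8 : (0 <= 8 * L ^+ 2)%R by rewrite mulr_ge0// sqr_ge0.
have k0 : (0 <= 4 * defect_cst * (d + d'))%R.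
  by case/andP: dT => d0 _; case/andP: dT' => d'0 _; rewrite mulr_ge0 ?addr_ge0// mulr_ge0// defect_cst_ge0.
apply: (@le_trans _ _ (ui u (fun s => (4 * defect_cst * (d + d'))%:E + (8 * L ^+ 2)%:E * g s))); last first.
  apply: le_trans (uiD (fun _ _ => _) (fun x _ => _)) _.
  - by rewrite lee_fin.
  - by move=> x _; rewrite mule_ge0 ?lee_fin.
  apply: leeD; last by apply: uiZ.
  apply: le_trans (ui_cst u0 k0 _ _) _ => //.
  by rewrite lee_fin ler_wpM2l.
rewrite I2E; apply: ui_le => x /andP[xu0 xu].
have [->|xn0] := eqVneq x 0%R.
  rewrite Esq_eq0 ?adde_ge0 ?lee_fin ?mule_ge0 ?lee_fin// => w _.
  by rewrite !simple_proc_out ?ltxx ?subrr//; exact: frozen_grid.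
have xT : (0 < x <= T)%R by rewrite lt_neqAle eq_sym xn0 xu0 (le_trans xu).
have xT' : (0 <= x <= T)%R by rewrite xu0 (le_trans xu).
have h1 := frozen_defect lp gp pd dT xT; have h2 := frozen_defect lp gp' pd' dT' xT.
have h3 : Esq P (fun w => phi x (euler_path p x w) - phi x (euler_path p' x w))%R <= (2 * L ^+ 2)%:E * g x.
  apply: le_trans (coef_dist_Esq _ _ lp xT' xT') _; rewrite subrr normr0 expr0n mulr0 add0e.
  apply: lee_wpmul2l; first by rewrite lee_fin.
  by apply: (Esq_le_N2 T0 P (fun t w => euler_path p t w - euler_path p' t w)%R); rewrite xu0 lexx.
have t1 := Esq_triangle T0 sepH P (simple_proc (frozen phi p) x) (fun w => phi x (euler_path p x w))
  (simple_proc (frozen phi p') x).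
have t2 := Esq_triangle T0 sepH P (fun w => phi x (euler_path p x w)) (fun w => phi x (euler_path p' x w))
  (simple_proc (frozen phi p') x).
rewrite [X in _ <= _ + _ * X](_ : _ = Esq P (fun w => simple_proc (frozen phi p') x w - phi x (euler_path p' x w))%R) in t2; last first.
  by rewrite !EsqE; congr outer_E; apply/funext => w; rewrite distrC.
apply: le_trans t1 _.
apply: (@le_trans _ _ (2%:E * (defect_cst * d)%:E + 2%:E * (2%:E * ((2 * L ^+ 2)%:E * g x) + 2%:E * (defect_cst * d')%:E))).
  apply: leeD; apply: lee_wpmul2l => //; apply: le_trans t2 _.
  by apply: leeD; apply: lee_wpmul2l.
have p1 : 0 <= (2 * L ^+ 2)%:E * g x by rewrite mule_ge0 ?lee_fin.
have [/andP[d0 _] /andP[d'0 _]] := (dT, dT'); have dc := defect_cst_ge0.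
have p2 : 0 <= (defect_cst * d')%:E by rewrite lee_fin mulr_ge0.
rewrite ge0_muleDr ?mule_ge0// !muleA -!EFinM addeCA -EFinD addeC.
apply: leeD; last by rewrite le_eqVlt; apply/orP; left; apply/eqP; congr (_%:E * _); ring.
rewrite lee_fin; have : (0 <= defect_cst * d)%R by rewrite mulr_ge0.
by move: defect_cst => z; lra.
Qed.

(** The squared distance is linear in the meshes. Gronwall's constant 32 C L^2 is 4 C from the two
    integrals times 8 L^2 from [frozen_diff]; finiteness of the distance follows from that of each
    scheme. *)
Lemma euler_cauchy : exists2 M : R, (0 <= M)%R & forall p p' (d d' : R),
  grid T p -> (forall n, p n.+1 <= p n + d)%R -> (0 <= d <= T)%R ->
  grid T p' -> (forall n, p' n.+1 <= p' n + d')%R -> (0 <= d' <= T)%R ->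
  N2 P T (fun t w => euler_path p t w - euler_path p' t w)%R <= (M * (d + d'))%:E.
Proof.
pose D := (32 * C * L ^+ 2)%R; have D0 : (0 <= D)%R by rewrite mulr_ge0 ?sqr_ge0// mulr_ge0.
have [M M0 hM] := gronwall D0 (ltW T0).
have a0 : (0 <= 16 * C * defect_cst * T)%R.
  by rewrite mulr_ge0 ?(ltW T0)// mulr_ge0 ?defect_cst_ge0// mulr_ge0.
exists (M * (16 * C * defect_cst * T))%R; first exact: mulr_ge0.
move=> p p' d d' gp pd dT gp' pd' dT'; have dd : (0 <= d + d')%R.
  by apply: addr_ge0; [case/andP: dT|case/andP: dT'].
rewrite -mulrA; apply: (hM (fun t => N2 P t (fun t w => euler_path p t w - euler_path p' t w)%R)).
- exact: mulr_ge0.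
- by move=> t _; exact: N2_ge0.
- by move=> s t /andP[_ st] _; exact: N2_mono.
- apply: le_lt_trans (N2D T0 sepH P (euler_path p) (fun t w => - euler_path p' t w)%R (ltW T0)) _.
  rewrite (_ : N2 P T (fun t w => - euler_path p' t w)%R = N2 P T (euler_path p')); last first.
    by apply/eqP; rewrite eq_le !(N2_le T0)// => t w _ _; rewrite normrN.
  by apply: lte_add_pinfty; apply: lte_mul_pinfty => //; exact: euler_path_lty.
move=> t tT; have [t0 tT'] := andP tT.
set u := ui t _; have u0 : 0 <= u by apply: ui_ge0 => x _; exact: N2_ge0.
pose X := (4 * defect_cst * (d + d') * T)%:E + (8 * L ^+ 2)%:E * u.
have bnd (V : normedModType R) (phi : R -> K -> 'L(V, K)) N : lipschitz_coef phi ->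
    energy_bound (W := K) P C N ->
    N2 P t (fun t w => simple_int (frozen phi p) N t w - simple_int (frozen phi p') N t w)%R <= C%:E * X.
  move=> lp eN; apply: le_trans (simple_int_diff T0 sepH eN (frozen_in_Hsc gp lp) (frozen_in_Hsc gp' lp) tT) _.
  by apply: lee_wpmul2l; [rewrite lee_fin|exact: frozen_diff].
rewrite (_ : (fun t w => _) = (fun t w => (simple_int (frozen mu p) A t w - simple_int (frozen mu p') A t w) +
    (simple_int (frozen sigma p) (@procS R T H) t w - simple_int (frozen sigma p') (@procS R T H) t w))%R); last first.
  apply/funext => s; apply/funext => w.
  by rewrite /euler_path opprD addrACA [(x0 + _)%R]addrC addrKA.
apply: le_trans (N2D T0 sepH P _ _ t0) _.
have t2 : 0 <= 2%:E :> \bar R by rewrite lee_fin.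
apply: (@le_trans _ _ (2%:E * (C%:E * X) + 2%:E * (C%:E * X))).
  exact: leeD (lee_wpmul2l t2 (bnd _ _ _ lmu eA)) (lee_wpmul2l t2 (bnd _ _ _ lsigma eS)).
have c1 : 0 <= (4 * defect_cst * (d + d') * T)%:E.
  by rewrite lee_fin mulr_ge0 ?(ltW T0)// mulr_ge0// mulr_ge0// defect_cst_ge0.
have c2 : 0 <= (8 * L ^+ 2)%:E * u by rewrite mule_ge0// lee_fin mulr_ge0// sqr_ge0.
rewrite -ge0_muleDl// -EFinD muleA -EFinM /X ge0_muleDr// muleA -!EFinM.
rewrite le_eqVlt; apply/orP; left; apply/eqP; congr (_%:E + _%:E * _); last by rewrite /D; ring.
by move: defect_cst => z; ring.
Qed.

(** The same rate for the integrals, with one constant for all coefficients and integrators so as to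
    serve both [A] and [procS]. *)
Lemma frozen_cauchy : exists2 M : R, (0 <= M)%R & forall (V : normedModType R) (phi : R -> K -> 'L(V, K))
    (N : R -> Omega -> V) p p' (d d' : R), lipschitz_coef phi -> energy_bound (W := K) P C N ->
  grid T p -> (forall n, p n.+1 <= p n + d)%R -> (0 <= d <= T)%R ->
  grid T p' -> (forall n, p' n.+1 <= p' n + d')%R -> (0 <= d' <= T)%R ->
  N2 P T (fun t w => simple_int (frozen phi p) N t w - simple_int (frozen phi p') N t w)%R <=
    (M * (d + d'))%:E.
Proof.
have [M M0 hM] := euler_cauchy.
have TT : (0 <= T <= T)%R by rewrite ltW//= lexx.
have L8 : (0 <= 8 * L ^+ 2)%R by rewrite mulr_ge0// sqr_ge0.
exists (C * (4 * defect_cst * T + 8 * L ^+ 2 * (M * T)))%R.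
  apply: mulr_ge0 => //; apply: addr_ge0; apply: mulr_ge0 => //; first by apply: mulr_ge0 => //; exact: defect_cst_ge0.
    exact: ltW.
  by apply: mulr_ge0 => //; exact: ltW.
move=> V phi N p p' d d' lp eN gp pd dT gp' pd' dT'.
have dd : (0 <= d + d')%R by apply: addr_ge0; [case/andP: dT|case/andP: dT'].
apply: le_trans (simple_int_diff T0 sepH eN (frozen_in_Hsc gp lp) (frozen_in_Hsc gp' lp) TT) _.
rewrite -mulrA EFinM; apply: lee_wpmul2l; first by rewrite lee_fin.
apply: le_trans (frozen_diff lp gp pd dT gp' pd' dT' TT) _.
apply: (@le_trans _ _ ((4 * defect_cst * (d + d') * T)%:E + (8 * L ^+ 2)%:E * (M * (d + d') * T)%:E)).
  apply: leeD => //; apply: lee_wpmul2l; first by rewrite lee_fin.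
  apply: ui_cst; first exact: ltW.
  - exact: mulr_ge0.
  - by move=> x _; exact: N2_ge0.
  move=> x /andP[_ xT]; apply: le_trans (N2_mono T0 P _ xT) _; exact: hM.
rewrite -EFinM -EFinD lee_fin le_eqVlt; apply/orP; left; apply/eqP.
by move: defect_cst => z; ring.
Qed.

End Bounded.

End EulerScheme.

(** * Limit of the Euler schemes and uniqueness *)

Section EulerLimit.
Context {R : realType} {T : R} {H K : hilbertType R}.
Hypotheses (T0 : 0 < T) (sepH : separable H).
Local Notation Omega := (Omega T H).
Variables (P : set Omega) (A : R -> Omega -> R^o) (C L : R) (x0 : K).
Variables (mu : R -> K -> 'L(R^o, K)) (sigma : R -> K -> 'L(H, K)).
Hypotheses (C0 : 0 <= C) (L1 : 1 <= L).
Hypotheses (iA : integrator A) (eA : energy_bound (W := K) P C A).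
Hypotheses (eS : energy_bound (W := K) P C (@procS R T H)).
Hypotheses (lmu : @lipschitz_coef R T K L _ _ mu) (lsigma : @lipschitz_coef R T K L _ _ sigma).
Local Open Scope ereal_scope.

Let L0 : (0 <= L)%R. Proof. exact: le_trans ler01 L1. Qed.

(** The reason for assuming 1 <= L: the Riesz map becomes a coefficient like any other, and X in H^2
    is an instance of the convergence of frozen coefficients. *)
Lemma riesz_lipschitz : @lipschitz_coef R T K L _ _ (fun _ k => riesz k).
Proof.
move=> t t' k k' _ _; rewrite -rieszB riesz_norm -[leLHS]mul1r ler_pM// lerDr//.
Qed.

(** [uniform_grid T k] has k + 1 cells, hence the predecessor. The mesh T / 8^n gives the rate
    required by [cpath_limit]. *)
Definition euler_grid n := uniform_grid T (8 ^ n).-1.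

Lemma euler_grid_grid n : grid T (euler_grid n).
Proof. exact: uniform_grid_grid. Qed.

Lemma euler_grid_mesh n i : (euler_grid n i.+1 <= euler_grid n i + T / 8 ^+ n)%R.
Proof.
have := uniform_gridS T0 (8 ^ n).-1 i; rewrite prednK ?expn_gt0// natrX.
exact.
Qed.

Lemma euler_mesh_bounds n : (0 <= T / 8 ^+ n <= T)%R.
Proof.
have p1 : (1 <= 8 ^+ n :> R)%R by apply: exprn_ege1; rewrite ler1n.
rewrite divr_ge0 ?(ltW T0) ?exprn_ge0//= ler_pdivrMr ?(lt_le_trans ltr01)//.
by rewrite ler_peMr// ltW.
Qed.

Lemma geometric_8_4 (a : R) n : (0 <= a)%R -> (a / 8 ^+ n <= a / 4 ^+ n)%R.
Proof.
move=> a0; rewrite ler_wpM2l// lef_pV2 ?posrE ?exprn_gt0//.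
by rewrite lerXn2r ?nnegrE ?ler_nat.
Qed.

Lemma euler_limit : exists X Y Z : Omega -> cpath T K,
  [/\ forall w t, (0 <= t <= T)%R -> X w t = (x0 + Y w t + Z w t)%R,
      in_H2_vector P X,
      is_integral P (fun t w => mu t (X w t)) A Y &
      is_integral P (fun t w => sigma t (X w t)) (@procS R T H) Z].
Proof.
have [B B0 hB] := euler_apriori T0 sepH x0 C0 L0 iA eA eS lmu lsigma.
have [M M0 hM] := frozen_cauchy T0 sepH C0 L0 iA eA eS lmu lsigma B0 hB.
pose fr (V W : normedModType R) (phi : R -> K -> 'L(V, W)) n :=
  frozen A x0 mu sigma phi (euler_grid n).
pose Xn n := euler_path A x0 mu sigma (euler_grid n).
(* Bounds M (T / 8^(n+1) + T / 8^n) by D / 8^n. *)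
pose D := (2 * M * T)%R; have D0 : (0 <= D)%R by rewrite mulr_ge0 ?(ltW T0)// mulr_ge0.
have lim (V : normedModType R) (phi : R -> K -> 'L(V, K)) (N : R -> Omega -> V) :
    @lipschitz_coef R T K L _ _ phi -> unif_paths T N -> energy_bound (W := K) P C N ->
    exists Y : Omega -> cpath T K, forall n,
      N2 P T (fun t w => Y w t - simple_int (fr _ _ phi n) N t w)%R <= (8 * D / 4 ^+ n)%:E.
  move=> lp uN eN; apply: (cpath_limit T0 sepH D0) => n.
    by apply: simple_int_unif => //; apply: frozen_grid; exact: euler_grid_grid.
  apply: le_trans (hM _ _ _ _ _ _ _ lp eN (euler_grid_grid n.+1) (euler_grid_mesh n.+1)
    (euler_mesh_bounds n.+1) (euler_grid_grid n) (euler_grid_mesh n) (euler_mesh_bounds n)) _.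
  rewrite lee_fin /D -!mulrA [(2 * _)%R]mulrCA ler_wpM2l// mulr2n mulrDl !mul1r lerD2r.
  rewrite ler_wpM2l ?(ltW T0)// lef_pV2 ?posrE ?exprn_gt0//.
  by rewrite exprS ler_peMl ?exprn_ge0// ler1n.
clearbody D.
have [Y hY] := lim _ _ _ lmu iA.1 eA.
have [Z hZ] := lim _ _ _ lsigma (@procS_unif R T H) eS.
have /choice[X hX] w : exists x : cpath T K, forall t, (0 <= t <= T)%R -> x t = (x0 + Y w t + Z w t)%R.
  apply: cpath_of => e e0; have e2 : (0 < e / 2)%R by rewrite divr_gt0.
  have [d d0 hd] := cpath_unif (Y w) e2; have [d' d'0 hd'] := cpath_unif (Z w) e2.
  exists (Num.min d d'); first by rewrite lt_min d0.
  move=> s t sT tT; rewrite lt_min => /andP[st st'].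
  rewrite opprD addrACA [(x0 + _)%R]addrC addrKA.
  apply: le_trans (ler_normD _ _) _; rewrite (splitr e); apply: ltW.
  exact: ltrD (hd _ _ sT tT st) (hd' _ _ sT tT st').
(* The initial values cancel, leaving the errors of the two integrals; 32 = 2 * 8 + 2 * 8. *)
have XXn n : N2 P T (fun t w => X w t - Xn n t w)%R <= (32 * D / 4 ^+ n)%:E.
  apply: (@le_trans _ _ (N2 P T (fun t w => (Y w t - simple_int (fr _ _ mu n) A t w) +
      (Z w t - simple_int (fr _ _ sigma n) (@procS R T H) t w))%R)).
    apply: (N2_le T0) => t w _ tT; rewrite hX// /Xn /euler_path opprD addrACA.
    by rewrite [(x0 + _)%R]addrC addrKA.
  apply: le_trans (N2D T0 sepH P _ _ (ltW T0)) _.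
  apply: (@le_trans _ _ (2%:E * (8 * D / 4 ^+ n)%:E + 2%:E * (8 * D / 4 ^+ n)%:E)).
    exact: leeD (lee_wpmul2l _ (hY n)) (lee_wpmul2l _ (hZ n)).
  rewrite -EFinM -EFinD lee_fin le_eqVlt; apply/orP; left; apply/eqP.
  by move: (4 ^+ n)^-1%R => z; ring.
have EX s : (0 <= s <= T)%R -> Esq P (fun w => X w s) <= (2 * (32 * D) + 2 * B)%:E.
  move=> sT; apply: le_trans (Esq_le_N2 T0 P (fun t w => X w t) sT) _.
  apply: (@le_trans _ _ (N2 P T (fun t w => (X w t - Xn 0%N t w) + Xn 0%N t w)%R)).
    by apply: (N2_le T0) => t w _ _; rewrite subrK.
  apply: le_trans (N2D T0 sepH P _ _ (ltW T0)) _.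
  apply: (@le_trans _ _ (2%:E * (32 * D)%:E + 2%:E * B%:E)); last by rewrite -!EFinM -EFinD.
  have h0 := XXn 0%N; rewrite expr0 divr1 in h0.
  exact: leeD (lee_wpmul2l _ h0) (lee_wpmul2l _ (hB _ (euler_grid_grid 0))).
have b0 : (0 <= 2 * (32 * D) + 2 * B)%R by rewrite addr_ge0// mulr_ge0// mulr_ge0.
(* Stated for a general phi because it is applied to the Riesz map, to [mu] and to [sigma]. *)
have coef (V W : normedModType R) (phi : R -> K -> 'L(V, W)) : @lipschitz_coef R T K L _ _ phi ->
    (`|phi 0 0| <= `|mu 0 0| + `|sigma 0 0|)%R ->
    [/\ I2 P T (fun t w => phi t (X w t)) < +oo, forall n, in_Hsc (fr _ _ phi n) &
        tends0 (fun n => I2 P T (proc_sub (fun t w => phi t (X w t)) (fr _ _ phi n)))].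
  move=> lp phi0; have gphi := lipschitz_growth T0 L0 lp phi0; split.
  - set a := (2 * growth (T := T) L mu sigma ^+ 2 + 2 * L ^+ 2 * (2 * (32 * D) + 2 * B))%R.
    suff h : I2 P T (fun t w => phi t (X w t)) <= (a * T)%:E by exact: le_lt_trans h (ltry _).
    apply: I2_le_cst => //; first exact: ltW.
      by rewrite addr_ge0 ?double_sqr_ge0// mulr_ge0// double_sqr_ge0.
    move=> x /andP[/ltW xl xT]; have xT' : (0 <= x <= T)%R by rewrite xl.
    exact: (coef_Esq_bound T0 sepH L0 gphi xT' (EX _ xT')).
  - by move=> n; exact: (frozen_in_Hsc T0 sepH x0 L0 iA lmu lsigma (euler_grid_grid n) lp).
  pose k := defect_cst (T := T) C L mu sigma B.
  have k0 : (0 <= k)%R by exact: (defect_cst_ge0 T0 L mu sigma C0 B0).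
  (* The first summand comes from the distance between X and the scheme, the second from the
     freezing error. *)
  pose a := (2 * (2 * L ^+ 2 * (32 * D)) + 2 * (k * T))%R.
  have a0 : (0 <= a)%R.
    apply: addr_ge0; first by rewrite mulr_ge0// mulr_ge0 ?double_sqr_ge0// mulr_ge0.
    by apply: mulr_ge0 => //; apply: mulr_ge0 => //; exact: ltW.
  apply: (tends0_le (v := fun n => (a * T / 4 ^+ n)%:E)); last first.
    by apply: tends0_geometric; apply: mulr_ge0 => //; exact: ltW.
  move=> n; rewrite mulrAC; apply: I2_le_cst => //; first exact: ltW.
    by apply: divr_ge0 => //; exact: exprn_ge0.
  move=> s sT; have sT' : (0 <= s <= T)%R by case/andP: sT => /ltW ->.
  have h1 := Esq_triangle T0 sepH P (fun w => phi s (X w s)) (fun w => phi s (Xn n s w))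
    (simple_proc (fr _ _ phi n) s).
  have h2 := frozen_defect T0 sepH C0 L0 iA eA eS lmu lsigma B0 hB lp (euler_grid_grid n)
    (euler_grid_mesh n) (euler_mesh_bounds n) sT.
  have h3 : Esq P (fun w => phi s (X w s) - phi s (Xn n s w))%R <= (2 * L ^+ 2 * (32 * D / 4 ^+ n))%:E.
    apply: le_trans (coef_dist_Esq T0 sepH P L0 (fun w => X w s) (Xn n s) lp sT' sT') _.
    rewrite subrr normr0 expr0n mulr0 add0e [leRHS]EFinM; apply: lee_wpmul2l.
      by rewrite lee_fin double_sqr_ge0.
    apply: le_trans (XXn n).
    exact: (Esq_le_N2 T0 P (fun t w => X w t - Xn n t w)%R sT').
  apply: le_trans h1 _.
  apply: (@le_trans _ _ (2%:E * (2 * L ^+ 2 * (32 * D / 4 ^+ n))%:E + 2%:E * (k * (T / 8 ^+ n))%:E)).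
    apply: leeD; [exact: (lee_wpmul2l _ h3)|apply: lee_wpmul2l => //].
    apply: le_trans h2; rewrite le_eqVlt; apply/orP; left; apply/eqP.
    by rewrite !EsqE; congr outer_E; apply/funext => w; rewrite distrC.
  rewrite -!EFinM -EFinD lee_fin /a.
  have := geometric_8_4 n (mulr_ge0 k0 (ltW T0)).
  rewrite !mulrA; move: (8 ^+ n)^-1%R (4 ^+ n)^-1%R k {k0 a a0 h2} => y z k; nra.
exists X, Y, Z; split=> //.
- have r0 : (`|riesz (0 : K)| <= `|mu 0 0| + `|sigma 0 0|)%R by rewrite riesz_norm normr0 addr_ge0.
  have [h1 h2 h3] := coef _ _ _ riesz_lipschitz r0.
  by apply/in_H2P; split=> //; exists (fr _ _ (fun _ k => riesz k)).
- have m0 : (`|mu 0 0| <= `|mu 0 0| + `|sigma 0 0|)%R by rewrite lerDl.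
  have [h1 h2 h3] := coef _ _ _ lmu m0.
  apply: (is_integral_of T0 sepH C0 eA h1 h2 h3).
  by apply: (tends0_le hY); apply: tends0_geometric; exact: mulr_ge0.
have s0 : (`|sigma 0 0| <= `|mu 0 0| + `|sigma 0 0|)%R by rewrite lerDr.
have [h1 h2 h3] := coef _ _ _ lsigma s0.
apply: (is_integral_of T0 sepH C0 eS h1 h2 h3).
by apply: (tends0_le hZ); apply: tends0_geometric; exact: mulr_ge0.
Qed.

Lemma coef_I2 {V : normedModType R} (phi : R -> K -> 'L(V, K)) (X X' : R -> Omega -> K) t :
  @lipschitz_coef R T K L _ _ phi -> (0 <= t <= T)%R ->
  I2 P t (fun s w => phi s (X s w) - phi s (X' s w))%R <=
  (2 * L ^+ 2)%:E * I2 P t (fun s w => X s w - X' s w)%R.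
Proof.
move=> lp /andP[t0 tT]; rewrite !I2E.
apply: le_trans (uiZ (double_sqr_ge0 L) (fun x _ => Esq_ge0 P _)).
apply: ui_le => s /andP[s0 st]; have sT : (0 <= s <= T)%R by rewrite s0 (le_trans st).
apply: le_trans (coef_dist_Esq T0 sepH P L0 (X s) (X' s) lp sT sT) _.
by rewrite subrr normr0 expr0n mulr0 add0e.
Qed.

Lemma typical_N2 (Q : Omega -> Prop) (Y : R -> Omega -> K) :
  typical P Q -> (forall w, Q w -> forall t, (0 <= t <= T)%R -> Y t w = 0%R) -> N2 P T Y = 0.
Proof.
move=> hQ hY; rewrite N2E; apply: (outer_E_null T0 sepH _ hQ) => w _.
  by rewrite lee_fin indicE.
move=> Qw1; have {Qw1}Qw : Q w.
  by apply: contrapT => nQ; move: Qw1; rewrite indicE mem_set// => -[] /eqP; rewrite oner_eq0.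
by apply: sup_sqr_le => t tT; rewrite (hY w Qw t tT) normr0 expr0n.
Qed.

(** X solves its equation on every path and X' on typical ones, so the residue of X' has [N2] equal
    to 0. The integrals are compared by [is_integral_diff], which leaves the integral of E |X -
    X'|^2 on the right. *)
Lemma SDE_unique (X Y Z X' : Omega -> cpath T K) :
  (forall w t, (0 <= t <= T)%R -> X w t = (x0 + Y w t + Z w t)%R) -> in_H2_vector P X ->
  is_integral P (fun t w => mu t (X w t)) A Y ->
  is_integral P (fun t w => sigma t (X w t)) (@procS R T H) Z ->
  in_H2_vector P X' -> solves_SDE P mu sigma A x0 X' -> typical P (fun w => X w = X' w).
Proof.
move=> hX /in_H2P[FX _] iY iZ /in_H2P[FX' _] [Y' [Z' [iY' iZ' hX']]].
have res0 : N2 P T (fun t w => (x0 + Y' w t + Z' w t) - X' w t)%R = 0.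
  by apply: (typical_N2 hX') => w Qw t tT; rewrite Qw// subrr.
pose D t := I2 P t (fun t w => X w t - X' w t)%R.
have key t : (0 <= t <= T)%R -> N2 P t (fun t w => X w t - X' w t)%R <= (16 * (16 * C) * L ^+ 2)%:E * D t.
  move=> tT; have [t0 tT'] := andP tT.
  have D0 : 0 <= D t by exact: I2_ge0.
  have h1 := N2_triangle T0 sepH P (fun t w => X w t) (fun t w => x0 + Y' w t + Z' w t)%R (fun t w => X' w t) t0.
  have r0 : N2 P t (fun t w => (x0 + Y' w t + Z' w t) - X' w t)%R <= 0.
    by rewrite -res0; exact: N2_mono.
  have e16 : (0 <= 16 * C)%R by rewrite mulr_ge0.
  have hY := is_integral_diff T0 sepH C0 eA tT iY iY'.
  have hZ := is_integral_diff T0 sepH C0 eS tT iZ iZ'.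
  have e16' : 0 <= (16 * C)%:E by rewrite lee_fin.
  have hY2 := le_trans hY (lee_wpmul2l e16' (coef_I2 _ _ lmu tT)).
  have hZ2 := le_trans hZ (lee_wpmul2l e16' (coef_I2 _ _ lsigma tT)).
  have two : 0 <= 2%:E :> \bar R by rewrite lee_fin.
  have h2 : N2 P t (fun t w => X w t - (x0 + Y' w t + Z' w t))%R <=
      2%:E * ((16 * C)%:E * ((2 * L ^+ 2)%:E * D t)) + 2%:E * ((16 * C)%:E * ((2 * L ^+ 2)%:E * D t)).
    apply: (@le_trans _ _ (N2 P t (fun t w => (Y w t - Y' w t) + (Z w t - Z' w t))%R)).
      apply: (N2_le T0) => s w _ /andP[s0 st]; rewrite hX ?s0 ?(le_trans st)//.
      by rewrite opprD addrACA [(x0 + _)%R]addrC addrKA.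
    apply: le_trans (N2D T0 sepH P _ _ t0) _.
    exact: leeD (lee_wpmul2l two hY2) (lee_wpmul2l two hZ2).
  apply: le_trans h1 _; apply: le_trans (leeD (lee_wpmul2l two h2) (lee_wpmul2l two r0)) _.
  rewrite mule0 adde0 !muleA -!EFinM -ge0_muleDl ?lee_fin ?mulr_ge0 ?sqr_ge0//.
  rewrite -EFinD muleA -EFinM le_eqVlt; apply/orP; left; apply/eqP; congr (_%:E * _); ring.
have K0 : (0 <= 16 * (16 * C) * L ^+ 2)%R by apply: mulr_ge0; [rewrite mulr_ge0// mulr_ge0|exact: sqr_ge0].
have EX (x : Omega -> cpath T K) t : Esq P (fun w => x w t) = Esq P (fun w => riesz (x w t)).
  by rewrite !EsqE; congr outer_E; apply/funext => w; rewrite riesz_norm.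
(* Both processes have finite H^2 norm; [key] turns this into the finite expected supremum that
   Gronwall's inequality demands. *)
have DT : D T < +oo.
  have h := I2D T0 sepH P T (fun t w => X w t) (fun t w => - X' w t)%R.
  apply: le_lt_trans h _; have fin2 (x : \bar R) : x < +oo -> 2%:E * x < +oo by move=> xoo; exact: lte_mul_pinfty.
  apply: lte_add_pinfty; apply: fin2.
    by apply: le_lt_trans FX; rewrite !I2E; apply: ui_le => t _; rewrite EX.
  apply: le_lt_trans FX'; rewrite !I2E; apply: ui_le => t _; rewrite -EX.
  by apply: (Esq_le T0) => w _; rewrite normrN.
have [M M0 hM] := gronwall K0 (ltW T0).
have g0 : N2 P T (fun t w => X w t - X' w t)%R = 0.
  suff h : N2 P T (fun t w => X w t - X' w t)%R <= (M * 0)%:E.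
    by apply/eqP; rewrite eq_le N2_ge0 andbT; move: h; rewrite mulr0.
  apply: (hM (fun t => N2 P t (fun t w => X w t - X' w t)%R)) => //.
  - by move=> t _; exact: N2_ge0.
  - by move=> s t /andP[_ st] _; exact: N2_mono.
  - apply: le_lt_trans (key T _) _; first by rewrite (ltW T0) lexx.
    by apply: lte_mul_pinfty => //; rewrite lee_fin.
  move=> t tT; rewrite add0e; apply: le_trans (key t tT) _; apply: lee_wpmul2l; first by rewrite lee_fin.
  rewrite /D I2E; apply: ui_le => s /andP[s0 st].
  by apply: (Esq_le_N2 T0 P (fun t w => X w t - X' w t)%R); rewrite s0 lexx.
(* A vanishing supremum forces equality of the paths, so [outer_E_null] applies to the indicator of
   the paths where X and X' differ. *)
rewrite /typical; rewrite N2E in g0; apply: (outer_E_null T0 sepH _ g0) => w _.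
  by rewrite sup_sqr_ge0// ltW.
move=> sw; suff XX : X w = X' w by rewrite indicE memNset//; move=> /(_ XX).
apply: cpath_ext => t tT; apply/eqP; rewrite -subr_eq0 -normr_eq0 -sqrf_eq0 eq_le sqr_ge0 andbT.
by have := sup_sqr_ge (fun t w => X w t - X' w t)%R w tT; rewrite sw lee_fin.
Qed.

End EulerLimit.

Theorem theorem2p12 (R : realType) (H K : hilbertType R) (T c : R)
    (A : R -> Omega T H -> R^o)
    (mu : R -> K -> 'L(R^o, K)) (sigma : R -> K -> 'L(H, K)) (x0 : K) :
  separable H -> separable K -> 0 < T -> 0 <= c ->
  adapted A ->
  (forall t, 0 <= t <= T -> continuous (A t)) ->
  (forall w, bounded_variation 0 T (fun t => A t w) /\
    abs_cont_rate_le T c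
      (fun t => fine (total_variation 0 t (fun s => A s w)))) ->
  (exists2 L : R, 0 < L & forall t t' k k', 0 <= t <= T -> 0 <= t' <= T ->
    `|sigma t k - sigma t' k'| <= L * (`|t - t'| + `|k - k'|) /\
    `|mu t k - mu t' k'| <= L * (`|t - t'| + `|k - k'|)) ->
  exists X : Omega T H -> cpath T K,
    [/\ in_H2_vector (Xi c) X,
        solves_SDE (Xi c) mu sigma A x0 X &
        forall X' : Omega T H -> cpath T K,
          in_H2_vector (Xi c) X' -> solves_SDE (Xi c) mu sigma A x0 X' ->
          typical (Xi c) (fun w => X w = X' w)].
Proof.
move=> sepH _ T0 c0 adA cA vA [L L0 hL].
(* A common constant for the energy bounds of S and A. *)
pose C := 4 * c + c ^+ 2 * T.
have cT0 : 0 <= c ^+ 2 * T by rewrite mulr_ge0 ?sqr_ge0// ltW.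
have c4 : 0 <= 4 * c by rewrite mulr_ge0.
have C0 : 0 <= C by rewrite addr_ge0.
(* L is enlarged so that the Riesz map satisfies the same Lipschitz bound. *)
have L1 : 1 <= L + 1 by rewrite lerDr ltW.
have lip (V : normedModType R) (phi : R -> K -> 'L(V, K)) :
    (forall t t' k k', 0 <= t <= T -> 0 <= t' <= T ->
      `|phi t k - phi t' k'| <= L * (`|t - t'| + `|k - k'|)) -> @lipschitz_coef R T K (L + 1) _ _ phi.
  move=> h t t' k k' tT tT'; apply: le_trans (h t t' k k' tT tT') _.
  by rewrite ler_wpM2r ?addr_ge0// lerDl.
have lmu : @lipschitz_coef R T K (L + 1) _ _ mu by apply: lip => t t' k k' tT tT'; case: (hL t t' k k' tT tT').
have lsigma : @lipschitz_coef R T K (L + 1) _ _ sigma by apply: lip => t t' k k' tT tT'; case: (hL t t' k k' tT tT').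
have iA := finite_variation_integrator T0 c0 adA cA vA.
have eA : energy_bound (W := K) (Xi c) C A.
  by apply: energy_bound_le (finite_variation_energy T0 sepH c0 vA); rewrite lerDr.
have eS : energy_bound (W := K) (Xi c) C (@procS R T H).
  by apply: energy_bound_le (procS_energy T0 sepH c0); rewrite lerDl.
have [X [Y [Z [hX X2 iY iZ]]]] := euler_limit T0 sepH x0 C0 L1 iA eA eS lmu lsigma.
exists X; split=> //.
  (* The equation fails on no path, so the indicator of the exceptional set is 0. *)
  exists Y, Z; split=> //; apply: (outer_E0 T0) => w _.
  by rewrite indicE memNset//= => /(_ (hX w)).
by move=> X' X2' sX'; exact: (SDE_unique T0 sepH C0 L1 eA eS lmu lsigma hX X2 iY iZ X2' sX').
Qed.
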